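(* Let $(\Omega,\mathcal{T},\mu)$ be a probability space, let $T:\Omega\to\Omega$ be an ergodic ($\mu$-preserving) transformation, and let $\sigma\in L^\infty(\Omega,\mathcal{T},\mu)$ be complex-valued. Let $q(w)=w+w^2+O(w^3)$ be a holomorphic germ at the origin of $\mathbb{C}$. Consider a sequence of measurable skew-products of the form $$f_n(z,w)=\big(T(z),\,q(w)+\varepsilon_n(z)^2\big),\qquad \varepsilon_n(z):=\frac{\pi}{n}+\frac{\pi}{n^2}\sigma(z)+O\Big(\frac{1}{n^{2+\alpha}}\Big),$$ for some $0<\alpha<1$ (with the $O$ uniform in $z$). Then for $\mu$-almost every $z$ and every $w\in\mathcal{B}_q$, $$\lim_{n\to\infty}\pi_2\circ f_n^n(z,w)=L_u(w),\qquad\text{where } u:=\int\sigma(z)\,d\mu(z)$$ and $\pi_2$ denotes the projection of $\Omega\times\mathbb{C}$ onto the second coordinate.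
   Context: $f_n^n$ is the $n$-th iterate of $f_n$. Write $q(w)=w+w^2+aw^3+O(w^4)$. For sufficiently small $r>0$ let $P^\iota=\{|w+r|<r\}$ (attracting petal) and $P^o=\{|w-r|<r\}$ (repelling petal). $P^\iota$ is forward invariant under $q$ and $q^m(w)\to0$ for $w\in P^\iota$. The parabolic basin is $\mathcal{B}_q=\bigcup_{m\ge0}q^{-m}(P^\iota)$. Let $\log$ be the principal branch. The attracting and repelling Fatou coordinates are the (univalent, for $r$ small) holomorphic maps $\phi^\iota:P^\iota\to\mathbb{C}$, $\phi^o:P^o\to\mathbb{C}$ with $\phi^\iota(q(w))=\phi^\iota(w)+1$ and $\phi^o(q(w))=\phi^o(w)+1$ (the latter when $w,q(w)\in P^o$), normalized by $\phi^\iota(w)=-\frac1w+(1-a)\log(-w)+o(1)$ and $\phi^o(w)=-\frac1w+(1-a)\log w+o(1)$ as $w\to0$ in the respective petal. The map $\phi^\iota$ is extended to $\mathcal{B}_q$ by $\phi^\iota(w)=\phi^\iota(q^m(w))-m$ ($m$ large). The inverse $(\phi^o)^{-1}$, defined on a left half-plane, is extended to $\mathbb{C}$ by $(\phi^o)^{-1}(\zeta)=q^m\big((\phi^o)^{-1}(\zeta-m)\big)$ ($m$ large). For $u\in\mathbb{C}$ the Lavaurs map of phase $u$ is $L_u=(\phi^o)^{-1}\circ T_u\circ\phi^\iota$ on $\mathcal{B}_q$, where $T_u(\zeta)=\zeta+u$. Convention: $q$ is understood to be defined on a domain for which these extensions make sense (as is automatic, for instance, if $q$ is entire). *)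

(* Defs.v *)
From HB Require Import structures.
From mathcomp Require Import all_boot all_order all_algebra.
From mathcomp Require Import all_classical all_reals all_analysis.
From mathcomp Require Export complex.

Set Implicit Arguments.
Unset Strict Implicit.
Unset Printing Implicit Defensive.

Import Order.TTheory GRing.Theory Num.Theory.
Import numFieldNormedType.Exports.

Local Open Scope classical_set_scope.
Local Open Scope ring_scope.
Local Open Scope complex_scope.

(* The complex numbers are R[i]^o, the field R[i] as a module over itself: it
   carries the topology of its norm, and [derivable f w 1] is complex
   differentiability at [w]. *)

Section complex_numbers.
Context {R : realType}.
Implicit Types (w : R[i]^o) (A : set R[i]^o).

Definition holomorphic_on A (f : R[i]^o -> R[i]^o) :=
  forall w, A w -> derivable f w 1.

Definition cmod w : R := ComplexField.Normc.normc w.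

(* with values in ]-pi, pi] for w != 0 *)
Definition principal_arg w : R :=
  if 0 <= complex.Im w then acos (complex.Re w / cmod w)
  else - acos (complex.Re w / cmod w).

Definition principal_log w : R[i]^o := ln (cmod w) +i* principal_arg w.

(* The common value of [s m] for all large [m], when there is one. *)
Definition eventual_value (s : nat -> R[i]^o) : R[i]^o :=
  get [set v | \forall m \near \oo, s m = v].

End complex_numbers.

Definition borelC (R : realType) :=
  g_sigma_algebraType (@open R[i]^o).

Section measure.
Context {R : realType} {d : measure_display} {Omega : measurableType d}.
Variable mu : probability Omega R.

Definition measure_preserving (T : Omega -> Omega) :=
  measurable_fun setT T /\
  forall A, measurable A -> mu (T @^-1` A) = mu A.

Definition ergodic (T : Omega -> Omega) :=
  measure_preserving T /\
  forall A, measurable A -> T @^-1` A = A -> mu A = 0%E \/ mu A = 1%E.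

Definition complex_Linfty (s : Omega -> R[i]^o) :=
  measurable_fun setT (s : Omega -> borelC R) /\
  finite_norm mu +oo%E (cmod \o s).

Definition complex_integral (s : Omega -> R[i]^o) : R[i]^o :=
  (\int[mu]_z complex.Re (s z)) +i* (\int[mu]_z complex.Im (s z)).

End measure.

Definition skew_product {R : realType} {Omega : Type} (T : Omega -> Omega)
    (q : R[i]^o -> R[i]^o) (eps : Omega -> R[i]^o) (p : Omega * R[i]^o) :
    Omega * R[i]^o :=
  (T p.1, q p.2 + eps p.1 ^+ 2).

(* In this section [q] is a total function, but only its restriction to the
   set [U] is meaningful: a map defined on a domain [U] is represented by any
   extension of it, and orbits are required to stay in [U]. *)
Section parabolic.
Context {R : realType}.
Local Notation C := R[i]^o.
Variables (U : set C) (q : C -> C).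

Definition attracting_petal (r : R) : set C := [set w | `|w + r%:C| < r%:C].
Definition repelling_petal (r : R) : set C := [set w | `|w - r%:C| < r%:C].

(* The conditions that hold for every sufficiently small r. *)
Definition admissible_radius (r : R) :=
  [/\ 0 < r,
      attracting_petal r `<=` U,
      repelling_petal r `<=` U,
      forall w, attracting_petal r w -> attracting_petal r (q w) &
      forall w, attracting_petal r w -> (iter m q w) @[m --> \oo] --> (0 : C)].

Definition parabolic_basin (r : R) : set C :=
  [set w | exists m, (forall k, (k < m)%N -> U (iter k q w)) /\
                     attracting_petal r (iter m q w)].

(* [a] is the coefficient of w^3 in the expansion of [q] at 0. *)
Definition attracting_fatou_coordinate (a : C) (r : R) (phi : C -> C) :=
  [/\ holomorphic_on (attracting_petal r) phi,
      {in attracting_petal r &, injective phi},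
      forall w, attracting_petal r w -> phi (q w) = phi w + 1 &
      (fun w => phi w - (- w^-1 + (1 - a) * principal_log (- w)))
        @ within (attracting_petal r) (nbhs (0 : C)) --> (0 : C)].

Definition repelling_fatou_coordinate (a : C) (r : R) (phi : C -> C) :=
  [/\ holomorphic_on (repelling_petal r) phi,
      {in repelling_petal r &, injective phi},
      forall w, repelling_petal r w -> repelling_petal r (q w) ->
        phi (q w) = phi w + 1 &
      (fun w => phi w - (- w^-1 + (1 - a) * principal_log w))
        @ within (repelling_petal r) (nbhs (0 : C)) --> (0 : C)].

Definition attracting_extension (phi : C -> C) (w : C) : C :=
  eventual_value (fun m => phi (iter m q w) - m%:R).

(* Every zeta - m with m large lies in the image of the repelling petal,
   although this image need not contain a left half-plane. *)
Definition repelling_inverse (r : R) (phi : C -> C) : C -> C :=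
  'pinv_(fun=> 0) (repelling_petal r) phi.

Definition repelling_inverse_extension (r : R) (phi : C -> C) (zeta : C) : C :=
  eventual_value (fun m => iter m q (repelling_inverse r phi (zeta - m%:R))).

(* The iterates used in the previous definition stay in the domain of q. *)
Definition repelling_extension_defined (r : R) (phi : C -> C) :=
  forall zeta : C, \forall m \near \oo, forall k, (k < m)%N ->
    U (iter k q (repelling_inverse r phi (zeta - m%:R))).

Definition lavaurs_map (r : R) (phii phio : C -> C) (u w : C) : C :=
  repelling_inverse_extension r phio (attracting_extension phii w + u).

End parabolic.

(* Main.v *)
Require Import Defs.
From mathcomp Require Import all_boot all_order all_algebra.
From mathcomp Require Import all_classical all_reals all_analysis.
From mathcomp Require Import measurable_realfun ess_sup_inf.
From mathcomp Require Import ring lra zify.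
Set Implicit Arguments.
Unset Strict Implicit.
Unset Printing Implicit Defensive.
Import Order.TTheory GRing.Theory Num.Theory.
Import numFieldNormedType.Exports.
Local Open Scope classical_set_scope.
Local Open Scope ring_scope.
Local Open Scope complex_scope.

(** Put e = pi / n. The vector field w^2 + e^2 has the orbit W_k = - e cot(e k),
    which turns into its opposite when k is replaced by n - k. Let Y_k be the
    Moebius coordinate of the k-th point of the perturbed orbit relative to W_k:
    it is invariant under the flow, it is close to - 1 / w - k when k is bounded,
    and to - 1 / w + (n - k) when n - k is bounded. One step of the perturbed map
    changes Y_k by an odd function of W_k, plus (2 / n) sin(e k)^2 sigma(T^k z),
    plus a summable error of order (1 + |Y_k|) / min(k, n - k)^2. The odd terms
    cancel in pairs, and the weighted averages of sigma converge to its integral by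
    Birkhoff's theorem and summation by parts. Hence, from time K
    to time n - K, the value of - 1 / w increases by u - 2 K + o(1) as K grows; the
    logarithmic terms of the two Fatou coordinates agree up to o(1).

    For every limit P_m of the perturbed points at time n - m along a fixed
    ultrafilter on n, the functional equation q(P_(m+1)) = P_m and the expansion of
    the repelling coordinate at P_m force phio(P_m) = phii(w) + u - m. So the
    preimage of phii(w) + u - m under phio exists and is P_m, and the orbit at time
    n tends to q^m(P_m), which is the value of the Lavaurs map. *)

(** To first order the perturbation is E_k = e^2 + (2 e^2 / n) s_k. Dividing its second part by e^2
    + W_k^2 = (e / sin(e k))^2 produces the weights 2 sin(e k)^2 / n; their total mass is 1, so the
    phase is the mean of sigma with no further factor. Sigma enters only through these averages and
    a bound along one orbit: the dynamical part is deterministic, for a fixed sequence s, and the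
    null set of z is chosen before w.

    The coordinate Y_k grows at most like a logarithm. A bound by the square root of min(k, n - k)
    is enough, because j^(1/2) / j^2 is summable with tail of order K^(-1/2), and it telescopes by
    mere algebra.

    Two obstacles shape the last part. Nothing says in advance that the points at time n - m
    converge; boundedness gives limits along ultrafilters, and their identification shows that they
    do not depend on the ultrafilter. Moreover the image of a round petal under phio need not
    contain a left half-plane, so the preimages that define the Lavaurs map must be produced by the
    orbit itself. *)

Section modulus.
Context {R : realType}.
Implicit Types (x y : R[i]) (s t : R).

Lemma cmodE x : `|x| = (cmod x)%:C.
Proof. by []. Qed.

Lemma cmod_ge0 x : 0 <= cmod x.
Proof. by case: x => a b; rewrite /cmod /= sqrtr_ge0. Qed.

Lemma cmodM x y : cmod (x * y) = cmod x * cmod y.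
Proof. exact: ComplexField.Normc.normcM. Qed.

Lemma cmodV x : cmod x^-1 = (cmod x)^-1.
Proof. exact: ComplexField.Normc.normcV. Qed.

Lemma cmodX x n : cmod (x ^+ n) = cmod x ^+ n.
Proof.
elim: n => [|n IH]; first exact: ComplexField.Normc.normc1.
by rewrite !exprS cmodM IH.
Qed.

Lemma cmodD x y : cmod (x + y) <= cmod x + cmod y.
Proof. exact: le_normcD. Qed.

Lemma cmodN x : cmod (- x) = cmod x.
Proof. exact: normcN. Qed.

Lemma cmodB x y : cmod (x - y) <= cmod x + cmod y.
Proof. by rewrite -(cmodN y) cmodD. Qed.

Lemma cmod_distC x y : cmod (x - y) = cmod (y - x).
Proof. by rewrite -cmodN opprB. Qed.

Lemma cmod_real t : cmod t%:C = `|t|.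
Proof. by rewrite /cmod /= expr0n /= addr0 sqrtr_sqr. Qed.

Lemma cmod0 : cmod (0 : R[i]) = 0.
Proof. exact: ComplexField.Normc.normc0. Qed.

Lemma cmod1 : cmod (1 : R[i]) = 1.
Proof. exact: ComplexField.Normc.normc1. Qed.

Lemma cmod_gt0 x : x != 0 -> 0 < cmod x.
Proof.
move=> x0; rewrite lt_neqAle cmod_ge0 andbT eq_sym.
by apply: contra x0 => /eqP /ComplexField.Normc.eq0_normc ->.
Qed.

Lemma cmod_neq0 x : 0 < cmod x -> x != 0.
Proof. by apply: contraTN => /eqP ->; rewrite cmod0 ltxx. Qed.

Lemma cmodD_le x y s t : cmod x <= s -> cmod y <= t -> cmod (x + y) <= s + t.
Proof. by move=> xs yt; apply: (le_trans (cmodD _ _)); exact: lerD. Qed.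

Lemma cmodB_le x y s t : cmod x <= s -> cmod y <= t -> cmod (x - y) <= s + t.
Proof. by move=> xs yt; apply: (le_trans (cmodB _ _)); exact: lerD. Qed.

Lemma cmodM_le x y s t : cmod x <= s -> cmod y <= t -> cmod (x * y) <= s * t.
Proof. by move=> xs yt; rewrite cmodM; apply: ler_pM => //; exact: cmod_ge0. Qed.

Lemma cmodX_le x s n : cmod x <= s -> cmod (x ^+ n) <= s ^+ n.
Proof.
move=> xs; rewrite cmodX; apply: lerXn2r => //; rewrite nnegrE ?cmod_ge0//.
exact: le_trans (cmod_ge0 _) xs.
Qed.

Lemma cmod_div_le x y s t : 0 < t ->
  cmod x <= s -> t <= cmod y -> cmod (x / y) <= s / t.
Proof.
move=> t0 xs ty; apply: cmodM_le => //; rewrite cmodV lef_pV2// posrE//.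
exact: lt_le_trans ty.
Qed.

Lemma cmod_ge x y s t : s <= cmod x -> cmod (x - y) <= t -> s - t <= cmod y.
Proof.
move=> sx xyt; rewrite lerBlDr; apply: (le_trans sx).
by rewrite -{1}(subrK y x) addrC; apply: cmodD_le.
Qed.

End modulus.

Lemma eq_subr_eq (V : zmodType) (x y s t : V) : s = t -> x - y = s - t -> x = y.
Proof. by move=> ->; rewrite subrr => /eqP; rewrite subr_eq0 => /eqP. Qed.

Lemma mulr_subr_frac (F : fieldType) (g s p t : F) : s != 0 -> t != 0 ->
  g * (s * p - t) / (s * t) = g * p / t - g / s.
Proof. by move=> s0 t0; field; rewrite s0 t0. Qed.

(** * One step of the perturbed map in the Moebius coordinate *)

Section parabolic_step.
Context {R : realType}.

(* If the flow of the vector field [w^2 + eps^2] takes time [t] from [W] to [w],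
   then [moebius eps W w] is [tan (eps t) / eps]. [moebius_rel] is the addition
   formula of the tangent: it avoids the division by 0. *)
Definition moebius_rel (eps W Y w : R[i]) := w * (1 - W * Y) = W + eps ^+ 2 * Y.

Definition moebius (eps W w : R[i]) := (w - W) / (eps ^+ 2 + w * W).

(** Solving the relation gives w - W = v^2 Y / (1 - W Y), since v^2 = eps^2 + W^2; the smallness of
    [y * v] keeps the denominator near 1. *)
Lemma moebius_size (v y : R) (eps W Y w : R[i]) :
  0 < v -> eps ^+ 2 + W ^+ 2 = (v ^+ 2)%:C -> cmod W <= v ->
  cmod Y = y -> y * v <= 1 / 32 -> moebius_rel eps W Y w ->
  cmod (w - W) <= 2 * v ^+ 2 * y /\ cmod w <= 2 * v.
Proof.
move=> v0 hV hW hy yv hw.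
have y0 : 0 <= y by rewrite -hy cmod_ge0.
have v20 : 0 < v ^+ 2 by rewrite exprn_gt0.
have hWY : cmod (W * Y) <= 1 / 32.
  by rewrite (le_trans (cmodM_le hW (lexx _)))// hy mulrC.
set P := 1 - W * Y.
have hP : 31 / 32 <= cmod P.
  have := @cmod_ge _ 1 P 1 (1/32); rewrite cmod1 /P opprB addrC subrK.
  by move=> /(_ (lexx _) hWY); clear; lra.
have P0 : P != 0 by apply: cmod_neq0; clear -hP; lra.
have wE : w = (W + eps ^+ 2 * Y) / P by rewrite -hw mulfK.
set d := w - W.
have dE : d = (v ^+ 2)%:C * Y / P.
  by rewrite /d wE -hV; apply: (mulIf P0); rewrite mulrBl !divfK// /P; ring.
have v2C : cmod (v ^+ 2)%:C = v ^+ 2 by rewrite cmod_real ger0_norm// ltW.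
have hd : cmod d <= 2 * v ^+ 2 * y.
  rewrite dE; apply: (le_trans (cmod_div_le (t := 31/32) _ (lexx _) hP)); first by clear; lra.
  by rewrite cmodM v2C hy; clear -v20 y0; nra.
have hdv : cmod d <= v / 16 by apply: (le_trans hd); rewrite expr2; clear -v0 yv y0; nra.
have wdE : w = W + d by rewrite /d addrC subrK.
have hw2 : cmod w <= 2 * v.
  by rewrite wdE; apply: (le_trans (cmodD_le hW hdv)); clear -v0; lra.
by split.
Qed.

(** The flow of the model field moves [W] to [W'] and preserves [Y], so the coordinate changes only
    through the defect of [w'] against the flow image of [w]. Up to order v^4 that defect is a w^3 -
    w (w^2 + eps^2) + kappa; replacing [w] by [W] and dividing by v^2 gives the main term. [G]
    bounds the defect by G v^3, and [C] collects the remainders. *)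
Lemma moebius_step (al K1 k0 G C v y : R) (a eps W tau W' Y w w' kappa rho : R[i]) :
  cmod a <= al -> 0 <= K1 -> 0 <= k0 ->
  G = 8 * al + 16 * K1 + k0 + 20 -> C = 26 * G + 14 * al + 16 * K1 + 100 ->
  0 < v -> v <= 1 / 32 -> v * G <= 1 / 32 ->
  eps ^+ 2 + W ^+ 2 = (v ^+ 2)%:C -> cmod W <= v -> cmod eps <= v ->
  cmod (tau - 1) <= v ^+ 2 ->
  W' * (1 - W * tau) = W + eps ^+ 2 * tau ->
  cmod Y = y -> y * v <= 1 / 32 ->
  moebius_rel eps W Y w ->
  w' = w + w ^+ 2 + a * w ^+ 3 + rho + eps ^+ 2 + kappa ->
  cmod rho <= K1 * cmod w ^+ 4 -> cmod kappa <= k0 * v ^+ 3 ->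
  [/\ cmod w <= 2 * v, moebius_rel eps W' (moebius eps W' w') w' &
   cmod (moebius eps W' w' - Y
      - (- W + a * (W ^+ 3 / (v ^+ 2)%:C) + kappa / (v ^+ 2)%:C))
     <= C * v ^+ 2 * (1 + y)].
Proof.
move=> hal K10 k00 hG hC v0 v32 vG hV hW heps htau hW' hy yv hw hw' hrho hkappa.
have al0 : 0 <= al := le_trans (cmod_ge0 _) hal.
have y0 : 0 <= y by rewrite -hy cmod_ge0.
have G0 : 20 <= G by rewrite hG; clear -al0 K10 k00; lra.
have v2 : v ^+ 2 <= v / 32 by rewrite expr2; clear -v0 v32; nra.
have v20 : 0 < v ^+ 2 by rewrite exprn_gt0.
have hWY : cmod (W * Y) <= 1 / 32.
  by rewrite (le_trans (cmodM_le hW (lexx _)))// hy mulrC.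
set P := 1 - W * Y.
have hP : 31 / 32 <= cmod P.
  have := @cmod_ge _ 1 P 1 (1/32); rewrite cmod1 /P opprB addrC subrK.
  by move=> /(_ (lexx _) hWY); clear; lra.
have P0 : P != 0 by apply: cmod_neq0; clear -hP; lra.
set d := w - W.
have [hd hw2] : cmod d <= 2 * v ^+ 2 * y /\ cmod w <= 2 * v := moebius_size v0 hV hW hy yv hw.
have v2C : cmod (v ^+ 2)%:C = v ^+ 2 by rewrite cmod_real ger0_norm// ltW.
set D := w ^+ 2 + eps ^+ 2.
have hD : cmod D <= 5 * v ^+ 2.
  apply: (le_trans (cmodD_le (cmodX_le 2 hw2) (cmodX_le 2 heps))).
  by rewrite exprMn; clear -v20; lra.
have htau2 : cmod tau <= 2.
  rewrite -(subrK 1 tau); apply: (le_trans (cmodD_le htau (lexx _))).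
  by rewrite cmod1; clear -v2 v32; lra.
have hwt : cmod (w * tau) <= 4 * v.
  by apply: (le_trans (cmodM_le hw2 htau2)); clear; lra.
have hQ1 : 1 / 2 <= cmod (1 - w * tau).
  have := @cmod_ge _ 1 (1 - w * tau) 1 (4 * v); rewrite cmod1 opprB addrC subrK.
  by move=> /(_ (lexx _) hwt); clear -v32; lra.
have Q10 : 1 - w * tau != 0 by apply: cmod_neq0; clear -hQ1; lra.
have hWt : cmod (W * tau) <= 2 * v.
  by apply: (le_trans (cmodM_le hW htau2)); clear; lra.
have hQ2 : 1 / 2 <= cmod (1 - W * tau).
  have := @cmod_ge _ 1 (1 - W * tau) 1 (2 * v); rewrite cmod1 opprB addrC subrK.
  by move=> /(_ (lexx _) hWt); clear -v32; lra.
have Q20 : 1 - W * tau != 0 by apply: cmod_neq0; clear -hQ2; lra.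
(* The difference between w + w^2 + eps^2 and the flow image of [w] is D (- w + S): the part - w D
   is the cubic term of the flow, and [S] has order v^2. *)
set S := ((1 - tau) * (1 + w) - w ^+ 2 * tau) / (1 - w * tau).
have hS : cmod S <= 20 * v ^+ 2.
  have h1 : cmod (1 + w) <= 2.
    by apply: (le_trans (cmodD_le (lexx _) hw2)); rewrite cmod1; clear -v32; lra.
  have h2 : cmod (1 - tau) <= v ^+ 2 by rewrite cmod_distC.
  have := cmodB_le (cmodM_le h2 h1) (cmodM_le (cmodX_le 2 hw2) htau2).
  move=> h3; apply: (le_trans (cmod_div_le (t := 1/2) _ h3 hQ1)); first by clear; lra.
  by rewrite exprMn; clear -v20; lra.
(* [ws] is the image of [w] under the flow, [g] the defect of the actual step. *)
set ws := (w + eps ^+ 2 * tau) / (1 - w * tau).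
set g := w' - ws.
have gE : g = a * w ^+ 3 + rho + kappa + D * (- w + S).
  apply: (mulIf Q10); rewrite /g /ws mulrBl divfK//.
  rewrite mulrDl (mulrDr D) (mulrDl (D * - w)) -(mulrA D S) /S divfK// hw' /D.
  ring.
have hg : cmod g <= G * v ^+ 3.
  have h1 : cmod (- w + S) <= 2 * v + 20 * v ^+ 2.
    by apply: cmodD_le => //; rewrite cmodN.
  have h0 : cmod w ^+ 4 <= (2 * v) ^+ 4.
    by rewrite -cmodX; apply: cmodX_le.
  have h3 : cmod rho <= K1 * (2 * v) ^+ 4.
    by apply: (le_trans hrho); apply: ler_wpM2l.
  rewrite gE; apply: (le_trans (cmodD_le (cmodD_le (cmodD_le
    (cmodM_le hal (cmodX_le 3 hw2)) h3) hkappa) (cmodM_le hD h1))).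
  rewrite hG !exprMn.
  have e3 : v ^+ 3 = v * v ^+ 2 by rewrite exprS.
  have e4 : v ^+ 4 = v * v ^+ 3 by rewrite exprS.
  have v30 : 0 < v ^+ 3 by rewrite exprn_gt0.
  have h4 : v ^+ 4 <= v ^+ 3 / 32 by rewrite e4; clear -v30 v32; nra.
  have h5 : v ^+ 2 * v ^+ 2 = v ^+ 4 by rewrite -exprD.
  have h6 : K1 * v ^+ 4 <= K1 * (v ^+ 3) by apply: ler_wpM2l => //; clear -h4 v30; lra.
  have -> : 5 * v ^+ 2 * (2 * v + 20 * v ^+ 2) = 10 * v ^+ 3 + 100 * v ^+ 4.
    by rewrite -h5 e3; ring.
  clear -h4 h6 v30; lra.
have dW' : W' - W = (v ^+ 2)%:C * tau / (1 - W * tau).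
  apply: (mulIf Q20); rewrite divfK// mulrBl hW' -hV; ring.
have hdW' : cmod (W' - W) <= 4 * v ^+ 2.
  rewrite dW'; apply: (le_trans (cmod_div_le (t := 1/2) _
    (cmodM_le (lexx _) htau2) hQ2)); first by clear; lra.
  by rewrite v2C; clear; lra.
have hW'2 : cmod W' <= 2 * v.
  rewrite -(subrK W W'); apply: (le_trans (cmodD_le hdW' hW)); clear -v2 v0; lra.
set V' := eps ^+ 2 + W' ^+ 2.
have hV' : cmod (V' - (v ^+ 2)%:C) <= 12 * v ^+ 3.
  have -> : V' - (v ^+ 2)%:C = (W' - W) * (W' + W) by rewrite -hV /V'; ring.
  apply: (le_trans (cmodM_le hdW' (cmodD_le hW'2 hW))).
  by rewrite (exprS v 2); clear; lra.
set P' := 1 - W' * Y.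
have hW'Y : cmod (W' * Y) <= 2 * v * y.
  by apply: (le_trans (cmodM_le hW'2 (lexx _))); rewrite hy.
have hP'2 : cmod P' <= 2.
  by apply: (le_trans (cmodB_le (lexx _) hW'Y)); rewrite cmod1; clear -yv; lra.
have hP'1 : 1 / 2 <= cmod P'.
  have := @cmod_ge _ 1 P' 1 (2 * v * y); rewrite cmod1 /P' opprB addrC subrK.
  by move=> /(_ (lexx _) hW'Y); clear -yv; lra.
have P'0 : P' != 0 by apply: cmod_neq0; clear -hP'1; lra.
have v30 : 0 < v ^+ 3 by rewrite exprn_gt0.
have v3 : v ^+ 3 <= v ^+ 2 / 32 by rewrite (exprS v 2); clear -v20 v32; nra.
have hgWP : cmod (g * W' * P') <= v ^+ 3 / 8.
  apply: (le_trans (cmodM_le (cmodM_le hg hW'2) hP'2)).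
  have -> : G * v ^+ 3 * (2 * v) * 2 = (v * G) * (4 * v ^+ 3) by ring.
  clear -vG v30; nra.
set Q := V' + g * W' * P'.
have hQ : v ^+ 2 / 2 <= cmod Q.
  have := @cmod_ge _ (v ^+ 2)%:C Q (v ^+ 2) (12 * v ^+ 3 + v ^+ 3 / 8).
  rewrite v2C => /(_ (lexx _)) h.
  suff : v ^+ 2 - (12 * v ^+ 3 + v ^+ 3 / 8) <= cmod Q by clear -v3 v20; lra.
  apply: h; rewrite /Q opprD addrA; apply: cmodB_le => //.
  by rewrite cmod_distC.
have Q0 : Q != 0 by apply: cmod_neq0; clear -hQ v20; lra.
(* The flow that sends [W] to [W'] sends [w] to [ws], and keeps [Y]. *)
have wsE : ws * P' = W' + eps ^+ 2 * Y.
  have hP'E : P' * (1 - W * tau) = 1 - W * tau - (W + eps ^+ 2 * tau) * Y.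
    by rewrite /P' -hW'; ring.
  apply: (mulIf Q20); rewrite -mulrA hP'E [RHS]mulrDl hW'.
  apply: (mulIf Q10); rewrite /ws mulrAC divfK//.
  apply: (mulIf P0).
  have h : w * P = W + eps ^+ 2 * Y := hw.
  have -> : forall z, (w + eps ^+ 2 * tau) * z * P = (w * P + eps ^+ 2 * tau * P) * z.
    by move=> z; ring.
  have -> : forall z, z * (1 - w * tau) * P = z * (P - (w * P) * tau).
    by move=> z; ring.
  rewrite h /P; ring.
have denE : (eps ^+ 2 + w' * W') * P' = Q.
  have -> : w' = g + ws by rewrite /g subrK.
  have -> : (eps ^+ 2 + (g + ws) * W') * P' =
     eps ^+ 2 * P' + g * W' * P' + (ws * P') * W' by ring.
  by rewrite wsE /Q /V' /P'; ring.
have den0 : eps ^+ 2 + w' * W' != 0.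
  by apply: contra Q0 => /eqP h; rewrite -denE h mul0r.
set Y' := moebius eps W' w'.
have dY : Y' - Y = g * P' ^+ 2 / Q.
  apply: (mulIf Q0); rewrite divfK// -{1}denE mulrA mulrBl /Y' /moebius divfK//.
  have -> : (w' - W' - Y * (eps ^+ 2 + w' * W')) = w' * P' - (W' + eps ^+ 2 * Y).
    by rewrite /P'; ring.
  by rewrite -wsE /g; ring.
split => //.
  have : Y' * (eps ^+ 2 + w' * W') = w' - W' by rewrite /Y' /moebius divfK.
  by move=> h; rewrite /moebius_rel; apply: (eq_subr_eq (esym h)); ring.
have v2n0 : (v ^+ 2)%:C != 0 :> R[i] by apply: cmod_neq0; rewrite v2C.
set V := (v ^+ 2)%:C in hV' v2n0 v2C hV dW' *.
have hv2V : v ^+ 2 <= cmod V by rewrite v2C.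
(* The exact change is g P'^2 / Q with Q close to V. Here [e1] = V P'^2 - Q accounts for replacing
   it by g / V, and [e2] below for evaluating g at [W] instead of [w]. *)
pose e1 := V * P' ^+ 2 - V' - g * W' * P'.
have he1 : cmod e1 <= v ^+ 3 * (6 * y + 13).
  have h1 : cmod (V * (P' ^+ 2 - 1)) <= v ^+ 2 * (6 * v * y).
    apply: cmodM_le; first by rewrite v2C.
    have -> : P' ^+ 2 - 1 = - (W' * Y) * (P' + 1) by rewrite /P'; ring.
    have h2 : cmod (P' + 1) <= 3.
      by apply: (le_trans (cmodD_le hP'2 (lexx _))); rewrite cmod1; clear; lra.
    rewrite -cmodN in hW'Y.
    by apply: (le_trans (cmodM_le hW'Y h2)); clear; lra.
  have -> : e1 = V * (P' ^+ 2 - 1) - (V' - V) - g * W' * P' by rewrite /e1; ring.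
  apply: (le_trans (cmodB_le (cmodB_le h1 hV') hgWP)).
  rewrite (exprS v 2) in v30 *; clear -v30; lra.
pose e2 := a * (w ^+ 3 - W ^+ 3) + rho + D * S - d * D - W * d * (w + W).
have he2 : cmod e2 <= v ^+ 4 * (1 + y) * (14 * al + 16 * K1 + 100).
  have h1 : cmod (a * (w ^+ 3 - W ^+ 3)) <= al * (2 * v ^+ 2 * y * (7 * v ^+ 2)).
    apply: cmodM_le => //.
    have -> : w ^+ 3 - W ^+ 3 = d * (w ^+ 2 + w * W + W ^+ 2) by rewrite /d; ring.
    apply: cmodM_le => //.
    apply: (le_trans (cmodD_le (cmodD_le (cmodX_le 2 hw2) (cmodM_le hw2 hW))
      (cmodX_le 2 hW))).
    by rewrite exprMn expr2; clear; lra.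
  have h2 : cmod rho <= K1 * (2 * v) ^+ 4.
    apply: (le_trans hrho); apply: ler_wpM2l => //.
    by rewrite -cmodX; apply: cmodX_le.
  apply: (le_trans (cmodB_le (cmodB_le (cmodD_le (cmodD_le h1 h2)
    (cmodM_le hD hS)) (cmodM_le hd hD))
    (cmodM_le (cmodM_le hW hd) (cmodD_le hw2 hW)))).
  have v4 : v ^+ 4 = v ^+ 2 * v ^+ 2 by rewrite -exprD.
  have v40 : 0 <= v ^+ 4 by rewrite exprn_ge0// ltW.
  have -> : al * (2 * v ^+ 2 * y * (7 * v ^+ 2)) + K1 * (2 * v) ^+ 4 +
    5 * v ^+ 2 * (20 * v ^+ 2) + 2 * v ^+ 2 * y * (5 * v ^+ 2) +
    v * (2 * v ^+ 2 * y) * (2 * v + v) =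
    v ^+ 4 * (14 * al * y + 16 * K1 + 100 + 16 * y) by rewrite v4; ring.
  rewrite -[leRHS]mulrA ler_wpM2l//.
  have := mulr_ge0 K10 y0; clear -y0 al0; lra.
have gV : g = (- W + a * (W ^+ 3 / V) + kappa / V) * V + e2.
  have -> : (- W + a * (W ^+ 3 / V) + kappa / V) * V = - W * V + a * W ^+ 3 + kappa.
    by rewrite !mulrDl -(mulrA a) !divfK.
  rewrite gE /e2 -hV /D /d; ring.
have -> : Y' - Y - (- W + a * (W ^+ 3 / V) + kappa / V) =
    g * e1 / (V * Q) + e2 / V.
  have e1E : e1 = V * P' ^+ 2 - Q by rewrite /e1 /Q; ring.
  have -> : g * e1 / (V * Q) = g * P' ^+ 2 / Q - g / V.
    by rewrite e1E mulr_subr_frac.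
  have -> : - W + a * (W ^+ 3 / V) + kappa / V = g / V - e2 / V.
    by rewrite {1}gV mulrDl mulfK// addrK.
  rewrite dY; ring.
have h1 : cmod (g * e1 / (V * Q)) <= 26 * G * v ^+ 2 * (1 + y).
  have hVQ : v ^+ 2 * (v ^+ 2 / 2) <= cmod (V * Q).
    by rewrite cmodM v2C ler_wpM2l// ltW.
  apply: (le_trans (cmod_div_le _ (cmodM_le hg he1) hVQ)).
    by rewrite mulr_gt0// divr_gt0.
  have -> : G * v ^+ 3 * (v ^+ 3 * (6 * y + 13)) / (v ^+ 2 * (v ^+ 2 / 2)) =
     2 * G * v ^+ 2 * (6 * y + 13) by clear -v0; field; rewrite gt_eqF.
  have : 0 <= G * v ^+ 2 by rewrite mulr_ge0//; [clear -G0; lra|exact: ltW].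
  clear -y0; nra.
have h2 : cmod (e2 / V) <= v ^+ 2 * (1 + y) * (14 * al + 16 * K1 + 100).
  apply: (le_trans (cmod_div_le _ he2 hv2V)) => //.
  have -> // : v ^+ 4 * (1 + y) * (14 * al + 16 * K1 + 100) / v ^+ 2 =
     v ^+ 2 * (1 + y) * (14 * al + 16 * K1 + 100).
  by clear -v0; field; rewrite gt_eqF.
apply: (le_trans (cmodD_le h1 h2)); rewrite hC; clear; lra.
Qed.

End parabolic_step.

(** * Trigonometric estimates and the cotangent model orbit *)

Section trigonometry.
Context {R : realType}.
Implicit Types x y e : R.

Lemma sin_MVT x : 0 < x -> exists2 c, 0 < c < x & sin x = x * cos c.
Proof.
move=> x0; have [|c] := @MVT R sin cos 0 x x0.
  exact/continuous_subspaceT/continuous_sin.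
by rewrite in_itv /= sin0 !subr0 => hc ->; exists c => //; rewrite mulrC.
Qed.

Lemma sin_le x : 0 <= x -> sin x <= x.
Proof.
rewrite le_eqVlt => /predU1P[<-|x0]; first by rewrite sin0.
have [c _ ->] := sin_MVT x0; rewrite -[leRHS]mulr1.
by rewrite ler_wpM2l ?cos_le1// ltW.
Qed.

Lemma abs_sin_le x : `|sin x| <= `|x|.
Proof.
wlog x0 : x / 0 <= x => [hw|].
  case: (leP 0 x) => [|x0]; first exact: hw.
  by rewrite -normrN -sinN -(normrN x) hw// oppr_ge0 ltW.
rewrite (ger0_norm x0) ler_norml sin_le// andbT.
have [x1|x1] := leP x 1.
  have h : 0 <= sin x.
    apply: sin_ge0_pi; rewrite x0 (le_trans x1)// (le_trans _ (pi_ge2 R))//.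
    by clear; lra.
  by clear -h x0; lra.
by have := sin_geN1 x; clear -x1; lra.
Qed.

Lemma cos_ge x : 1 - x ^+ 2 / 2 <= cos x.
Proof.
have xE : x = (x / 2) *+ 2 by rewrite mulr2n; field.
rewrite {2}xE cos_mulr2n cos2sin2.
have : sin (x / 2) ^+ 2 <= (x / 2) ^+ 2.
  by rewrite -[leLHS]real_normK ?num_real// -[leRHS]real_normK ?num_real//
    lerXn2r ?nnegrE// abs_sin_le.
by rewrite exprMn; clear; lra.
Qed.

(** A weak Jordan inequality: up to 1 it follows from the mean value theorem and cos >= 1 / 2,
    beyond 1 from monotonicity, because pi / 2 < 2. *)
Lemma sin_lb x : 0 <= x <= pi / 2 -> x / 4 <= sin x.
Proof.
move=> /andP[x0 xpi].
have small y : 0 <= y <= 1 -> y / 2 <= sin y.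
  move=> /andP[]; rewrite le_eqVlt => /predU1P[<- _|y0 y1].
    by rewrite sin0 mul0r.
  have [c /andP[c0 cy] ->] := sin_MVT y0; rewrite ler_pM2l//.
  have c1 : c ^+ 2 <= 1 by rewrite expr_le1// ltW// (lt_le_trans cy).
  by have := cos_ge c; clear -c1; lra.
have [x1|x1] := leP x 1.
  by have := small x; rewrite x0 x1 => /(_ isT); clear -x0; lra.
have h2 : pi / 2 < 2 :> R := pihalf_lt2 R.
have h1 : sin 1 <= sin x.
  have := @ltr_sin R x 1; rewrite !in_itv /=.
  have -> : - (pi / 2) <= x <= pi / 2 by rewrite xpi andbT; clear -x0 xpi; lra.
  have -> : - (pi / 2) <= (1 : R) <= pi / 2.
    by apply/andP; split; [clear -x0 xpi; lra|exact: pihalf_ge1].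
  by move=> /(_ isT isT) h; rewrite leNgt h -leNgt ltW.
have := small 1; rewrite ler01 lexx => /(_ isT).
by clear -h1 h2 xpi; lra.
Qed.

Lemma sin2_lipschitz x y : `|sin x ^+ 2 - sin y ^+ 2| <= `|x - y|.
Proof.
have -> : sin x ^+ 2 - sin y ^+ 2 = sin (x - y) * sin (x + y).
  rewrite sinB sinD; have := cos2Dsin2 x; have := cos2Dsin2 y => hy hx.
  have -> : (sin x * cos y - cos x * sin y) * (sin x * cos y + cos x * sin y) =
     sin x ^+ 2 * cos y ^+ 2 - cos x ^+ 2 * sin y ^+ 2 by ring.
  by rewrite !cos2sin2; ring.
by rewrite normrM -[leRHS]mulr1 ler_pM// ?abs_sin_le ?sin_max.
Qed.

(** Multiplication by 2 sin e makes the sum telescope over a full period; for n = 1 that factor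
    vanishes. *)
Lemma sum_cos_double n : (1 < n)%N ->
  \sum_(k < n) cos (2 * (pi / n%:R * k%:R)) = 0 :> R.
Proof.
move=> n1; set e := pi / n%:R.
have n0 : 0 < n%:R :> R by rewrite ltr0n ltnW.
have en : e * n%:R = pi by rewrite /e divfK// gt_eqF.
have se : 0 < sin e.
  apply: sin_gt0_pi; rewrite /e divr_gt0 ?pi_gt0//=.
  by rewrite ltr_pdivrMr// ltr_pMr ?pi_gt0// ltr1n.
have tele k : 2 * sin e * cos (2 * (e * k%:R)) =
    sin (2 * (e * k.+1%:R) - e) - sin (2 * (e * k%:R) - e).
  have -> : 2 * (e * k.+1%:R) - e = 2 * (e * k%:R) + e by rewrite -natr1; ring.
  by rewrite sinD sinB; ring.
have : 2 * sin e * \sum_(k < n) cos (2 * (e * k%:R)) = 0.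
  rewrite mulr_sumr; under eq_bigr => k _ do rewrite tele.
  rewrite -(big_mkord xpredT (fun k => sin (2 * (e * k.+1%:R) - e) - sin (2 * (e * k%:R) - e))).
  rewrite (telescope_sumr (fun k => sin (2 * (e * k%:R) - e)))// en.
  rewrite mulr0 mulr0 sub0r; have -> : 2 * pi - e = - e + pi *+ 2 :> R by ring.
  by rewrite sinD2pi subrr.
move=> /eqP; rewrite mulf_eq0 => /orP[|/eqP//].
by rewrite mulf_eq0 pnatr_eq0/= gt_eqF.
Qed.

Lemma sum_sin2 n : (1 < n)%N ->
  \sum_(k < n) 2 * sin (pi / n%:R * k%:R) ^+ 2 = n%:R :> R.
Proof.
move=> n1; transitivity (\sum_(k < n) (1 - cos (2 * (pi / n%:R * k%:R))) : R).
  apply: eq_bigr => k _.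
  rewrite (_ : 2 * (pi / n%:R * k%:R) = (pi / n%:R * k%:R) *+ 2 :> R); last by ring.
  by rewrite cos_mulr2n cos2sin2 !mulr2n; ring.
by rewrite sumrB sum_cos_double// subr0 big_const_ord iter_addr_0.
Qed.

End trigonometry.

(* [cot_orbit n] is an orbit of the time-one map of the vector field
   [w^2 + (pi / n)^2], and [sin_gap n k] is the distance from [cot_orbit n k] to
   either zero of that field. *)
Section model_orbit.
Context {R : realType}.
Implicit Types n k : nat.

Definition step_size n : R := pi / n%:R.

Definition cot_orbit n k : R :=
  - (step_size n * cos (step_size n * k%:R) / sin (step_size n * k%:R)).

Definition sin_gap n k : R := step_size n / sin (step_size n * k%:R).

(** This is tan(e) / e, the Moebius coordinate reached after time one; it is the [tau] of
    [moebius_step]. *)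
Definition flow_time n : R := sin (step_size n) / (step_size n * cos (step_size n)).

Lemma step_size_gt0 n : (0 < n)%N -> 0 < step_size n.
Proof. by move=> n0; rewrite divr_gt0 ?pi_gt0 ?ltr0n. Qed.

Lemma step_sizeM n : (0 < n)%N -> step_size n * n%:R = pi.
Proof. by move=> n0; rewrite divfK// gt_eqF ?ltr0n. Qed.

Lemma step_sizeE n : step_size n = pi / n%:R.
Proof. by []. Qed.

Opaque step_size.

Lemma sin_step_gt0 n k : (0 < k < n)%N -> 0 < sin (step_size n * k%:R).
Proof.
move=> /andP[k0 kn]; have n0 : (0 < n)%N by exact: leq_ltn_trans kn.
apply: sin_gt0_pi; rewrite mulr_gt0 ?step_size_gt0 ?ltr0n//=.
by rewrite -(step_sizeM n0) ltr_pM2l ?step_size_gt0// ltr_nat.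
Qed.

Lemma sin_gap_gt0 n k : (0 < k < n)%N -> 0 < sin_gap n k.
Proof.
move=> kn; rewrite divr_gt0 ?sin_step_gt0// step_size_gt0//.
by case/andP: kn => ? ?; exact: ltn_trans (_ : (k < n)%N).
Qed.

Lemma sin_gap_sqr n k : (0 < k < n)%N ->
  step_size n ^+ 2 + cot_orbit n k ^+ 2 = sin_gap n k ^+ 2.
Proof.
move=> kn; have /gt_eqF s0 := sin_step_gt0 kn.
rewrite /cot_orbit /sin_gap; move: (step_size n) s0 => e s0.
by rewrite sqrrN !exprMn exprVn cos2sin2; field; rewrite s0.
Qed.

Lemma step_size_le_gap n k : (0 < k < n)%N -> step_size n <= sin_gap n k :> R.
Proof.
move=> kn; have s0 := sin_step_gt0 kn.
rewrite /sin_gap ler_pdivlMr// -[leRHS]mulr1 ler_wpM2l ?sin_le1//.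
by rewrite ltW// step_size_gt0//; case/andP: kn => ? ?; exact: ltn_trans (_ : (k < n)%N).
Qed.

Lemma cot_orbit_le_gap n k : (0 < k < n)%N -> `|cot_orbit n k| <= sin_gap n k.
Proof.
move=> kn; have s0 := sin_step_gt0 kn; have v0 := sin_gap_gt0 kn.
rewrite -(ler_pXn2r (ltn0Sn 1)) ?nnegrE ?(ltW v0)// real_normK ?num_real//.
by rewrite -(sin_gap_sqr kn) lerDr sqr_ge0.
Qed.

Lemma step_rev n k : (0 < n)%N -> (k <= n)%N ->
  step_size n * (n - k)%:R = pi - step_size n * k%:R :> R.
Proof. by move=> n0 kn; rewrite natrB// mulrBr step_sizeM. Qed.

Lemma cot_orbit_rev n k : (0 < n)%N -> (k <= n)%N ->
  cot_orbit n (n - k) = - cot_orbit n k.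
Proof.
move=> n0 kn; rewrite /cot_orbit step_rev// sinB cosB sinpi cospi !mul0r !mulN1r.
by rewrite sub0r opprK addr0 mulrN mulNr.
Qed.

Lemma sin_gap_rev n k : (0 < n)%N -> (k <= n)%N -> sin_gap n (n - k) = sin_gap n k.
Proof.
by move=> n0 kn; rewrite /sin_gap step_rev// sinB sinpi cospi mul0r mulN1r sub0r opprK.
Qed.

Lemma sin_gap_half n k : (0 < k)%N -> (k.*2 <= n)%N -> sin_gap n k <= 4 / k%:R.
Proof.
move=> k0 kn; have n0 : (0 < n)%N by apply: leq_trans kn; rewrite double_gt0.
have k0' : 0 < k%:R :> R by rewrite ltr0n.
have e0 := step_size_gt0 n0.
have h : step_size n * k%:R / 4 <= sin (step_size n * k%:R).
  apply: sin_lb; rewrite mulr_ge0 ?(ltW e0)//= -(step_sizeM n0).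
  rewrite -mulrA ler_pM2l// ler_pdivlMr// mulrC -natrM ler_nat.
  by rewrite mul2n.
have s0 : 0 < sin (step_size n * k%:R).
  by apply: lt_le_trans h; rewrite divr_gt0// mulr_gt0.
rewrite /sin_gap ler_pdivrMr// mulrAC ler_pdivlMr//.
by move: h; clear; lra.
Qed.

Lemma sin_gap_le n k : (0 < k < n)%N -> sin_gap n k <= 4 / (minn k (n - k))%:R.
Proof.
move=> /andP[k0 kn]; case: (leqP k (n - k)) => h.
  by apply: sin_gap_half => //; rewrite -addnn -leq_subRL// ltnW.
rewrite -sin_gap_rev//; [|exact: ltn_trans kn|exact: ltnW].
apply: sin_gap_half; first by rewrite subn_gt0.
rewrite -addnn -leq_subRL ?leq_subr//.
by rewrite subKn ltnW// ltnW.
Qed.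

(** The addition formula of the cotangent, in the form that [moebius_step] requires of [W']. *)
Lemma cot_orbit_flow n k : (0 < k)%N -> (k.+1 < n)%N -> cos (step_size n) != 0 :> R ->
  cot_orbit n k.+1 * (1 - cot_orbit n k * flow_time n) =
  cot_orbit n k + step_size n ^+ 2 * flow_time n.
Proof.
move=> k0 kn c0; have n0 : (0 < n)%N by exact: leq_ltn_trans kn.
have /gt_eqF s0 : 0 < sin (step_size n * k%:R) by apply: sin_step_gt0; rewrite k0 ltnW.
have /gt_eqF s1 : 0 < sin (step_size n * k.+1%:R) by apply: sin_step_gt0; rewrite kn.
have /gt_eqF e0 := step_size_gt0 n0.
rewrite /cot_orbit /flow_time.
move: s1; rewrite -natr1 mulrDr mulr1 sinD cosD => s1.
move: (step_size n * k%:R) (step_size n) s0 s1 c0 e0 => A e s0 s1 c0 e0.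
by field; rewrite s0 s1 c0 e0.
Qed.

Lemma flow_time_sub1 n : (0 < n)%N -> step_size n <= 1 :> R ->
  `|flow_time n - 1| <= step_size n ^+ 2 :> R.
Proof.
move=> n0 e1; have e0 := step_size_gt0 n0.
have [c /andP[c0 ce] se] := sin_MVT e0.
have h1 := cos_ge (step_size n); have h2 := cos_ge c.
have h3 := cos_le1 (step_size n); have h4 := cos_le1 c.
have hc : 1 / 2 <= cos (step_size n).
  by move: h1; clear -e1 e0; nra.
have -> : flow_time n - 1 = (cos c - cos (step_size n)) / cos (step_size n).
  rewrite /flow_time se; move: (step_size n) e0 hc => e e0 hc; field.
  by apply/andP; split; rewrite gt_eqF//; move: hc; clear; lra.
rewrite normrM normfV (ger0_norm (_ : 0 <= cos (step_size n))); last by move: hc; clear; lra.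
rewrite ler_pdivrMr; last by move: hc; clear; lra.
have hc2 : c ^+ 2 <= step_size n ^+ 2 by rewrite !expr2; clear -c0 ce; move: (step_size n) ce => e ce; nra.
have e20 : 0 <= step_size n ^+ 2 :> R by rewrite sqr_ge0.
have h5 : step_size n ^+ 2 / 2 <= step_size n ^+ 2 * cos (step_size n).
  by rewrite ler_wpM2l//; move: hc; clear; lra.
by rewrite ler_norml; apply/andP; split; clear -h1 h2 h3 h4 h5 hc2; lra.
Qed.

(** At its start the model orbit follows the unperturbed field w^2, whose solution is - 1 / k. *)
Lemma cot_orbit_near n k : (0 < k < n)%N -> step_size n * k%:R <= 1 :> R ->
  `|cot_orbit n k + k%:R^-1| <= step_size n ^+ 2 * k%:R.
Proof.
move=> /andP[k0 kn] x1; have n0 : (0 < n)%N by exact: leq_ltn_trans kn.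
have e0 := step_size_gt0 n0.
have k0' : 0 < k%:R :> R by rewrite ltr0n.
set x := step_size n * k%:R in x1 *; have x0 : 0 < x by rewrite mulr_gt0.
have [c /andP[c0 cx] sx] := sin_MVT x0.
have h1 := cos_ge x; have h2 := cos_ge c; have h3 := cos_le1 x; have h4 := cos_le1 c.
have hc : 1 / 2 <= cos c by move: h2; clear -c0 cx x1; nra.
have hc0 : 0 < cos c by move: hc; clear; lra.
have -> : cot_orbit n k + k%:R^-1 = (cos c - cos x) / (cos c * k%:R).
  rewrite /cot_orbit -/x sx /x; move: (step_size n) (cos _) hc0 e0 => e cc hc0 e0.
  by field; rewrite !gt_eqF.
rewrite normrM normfV (ger0_norm (_ : 0 <= cos c * k%:R)); last by rewrite mulr_ge0 ?ltW.
rewrite ler_pdivrMr; last by rewrite mulr_gt0.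
have -> : step_size n ^+ 2 * k%:R * (cos c * k%:R) = x ^+ 2 * cos c by rewrite /x; ring.
have hc2 : c ^+ 2 <= x ^+ 2 by rewrite !expr2; clear -c0 cx; nra.
have h5 : x ^+ 2 / 2 <= x ^+ 2 * cos c.
  by rewrite ler_wpM2l ?sqr_ge0//; move: hc; clear; lra.
by rewrite ler_norml; apply/andP; split; clear -h1 h2 h3 h4 h5 hc2; lra.
Qed.

End model_orbit.

(** * Summation estimates uniform in n *)

Section sums.
Context {R : realType}.

Lemma sqrt_succ k : (0 < k)%N -> let s := Num.sqrt k%:R : R in
  let t := Num.sqrt k.+1%:R in
  [/\ 1 <= s, s <= t, t <= 2 * s & (t - s) * (t + s) = 1].
Proof.
move=> k0 s t.
have s2 : s ^+ 2 = k%:R by rewrite sqr_sqrtr.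
have t2 : t ^+ 2 = k.+1%:R by rewrite sqr_sqrtr.
have s0 : 0 <= s by rewrite sqrtr_ge0.
have t0 : 0 <= t by rewrite sqrtr_ge0.
have s1 : 1 <= s by rewrite -sqrtr1 ler_wsqrtr// ler1n.
have st : s <= t by rewrite ler_wsqrtr// ler_nat.
have e : (t - s) * (t + s) = 1.
  have -> : (t - s) * (t + s) = t ^+ 2 - s ^+ 2 by ring.
  by rewrite s2 t2 -natr1; ring.
by split=> //; clear -e s1 t0 st; nra.
Qed.

(** By [sqrt_succ], 1 / k is at most 4 times the increment of the square root, so the bound
    telescopes. *)
Lemma sum_inv_le K k : (0 < K)%N -> (K <= k)%N ->
  \sum_(K <= j < k) j%:R^-1 <= 4 * Num.sqrt k%:R :> R.
Proof.
move=> K0; elim: k => [|k IH]; first by rewrite leqn0 => /eqP Kk; rewrite Kk in K0.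
rewrite leq_eqVlt => /predU1P[<-|Kk].
  by rewrite big_geq// mulr_ge0// sqrtr_ge0.
rewrite big_nat_recr//=.
have k0 : (0 < k)%N by exact: leq_trans K0 Kk.
have /= := sqrt_succ k0; have ih := IH Kk.
have kE : k%:R = Num.sqrt k%:R ^+ 2 :> R by rewrite sqr_sqrtr.
move: kE ih; set s := Num.sqrt k%:R; set t := Num.sqrt k.+1%:R.
move=> kE ih [s1 st t2 e].
suff : k%:R^-1 <= 4 * (t - s) by move: ih; clear; lra.
rewrite kE; move: s1 st t2 e; clear; move: s t => s t s1 st t2 e.
have s0 : 0 < s by move: s1; clear; lra.
rewrite -div1r ler_pdivrMr ?exprn_gt0//.
have : (t - s) * (t + s) <= (t - s) * (3 * s) by move: st t2; clear; nra.
rewrite e; move: s1; clear; nra.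
Qed.

Lemma inv_sqrt_cube_le k : (0 < k)%N ->
  (k%:R * Num.sqrt k%:R)^-1 <=
  8 / Num.sqrt k%:R - 8 / Num.sqrt k.+1%:R :> R.
Proof.
move=> k0; have /= := sqrt_succ k0.
have kE : k%:R = Num.sqrt k%:R ^+ 2 :> R by rewrite sqr_sqrtr.
move: kE; set s := Num.sqrt k%:R; set t := Num.sqrt k.+1%:R.
move=> -> [s1 st t2 e]; move: s1 st t2 e; clear; move: s t => s t s1 st t2 e.
have s0 : 0 < s by move: s1; clear; lra.
have t0 : 0 < t by move: s0 st; clear; lra.
have -> : 8 / s - 8 / t = 8 * (t - s) / (s * t) by field; rewrite !gt_eqF.
rewrite ler_pdivlMr ?mulr_gt0// mulrC ler_pdivrMr ?mulr_gt0 ?exprn_gt0//.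
have h : 1 <= (t - s) * (3 * s) by rewrite -[leLHS]e; move: st t2; clear; nra.
have : s * t <= 2 * s ^+ 2 by rewrite expr2; move: s0 t2; clear; nra.
have s20 : 0 < s ^+ 2 by rewrite exprn_gt0.
have -> : 8 * (t - s) * (s ^+ 2 * s) = 8 / 3 * (((t - s) * (3 * s)) * s ^+ 2) by field.
move: h s20; clear; nra.
Qed.

(** These are the step errors (1 + |Y_j|) / m^2 with m = min(j, n - j) and |Y_j| of order sqrt(m).
    Bounding each term by the sum of its values for j and for n - j lets both ends telescope; the
    result is small for large K, whatever n is. *)
Lemma sum_two_sided_le K k n : (0 < K)%N -> (K <= k)%N -> (k <= n - K)%N ->
  \sum_(K <= j < k) (((minn j (n - j))%:R * Num.sqrt (minn j (n - j))%:R)^-1)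
    <= 16 / Num.sqrt K%:R :> R.
Proof.
move=> K0 Kk kn; pose f i : R := (i%:R * Num.sqrt i%:R)^-1.
pose g i : R := 8 / Num.sqrt i%:R.
have g0 i : 0 <= g i by rewrite divr_ge0// sqrtr_ge0.
have f0 i : 0 <= f i by rewrite invr_ge0 mulr_ge0// sqrtr_ge0.
suff h : \sum_(K <= j < k) f (minn j (n - j)) <=
    (g K - g k) + (g (n - k).+1 - g (n - K).+1).
  apply: (le_trans h).
  have h2 : g (n - k).+1 <= g K.
    rewrite ler_pM2l// lef_pV2 ?posrE ?sqrtr_gt0 ?ltr0n// ler_wsqrtr// ler_nat; lia.
  have := g0 k; have := g0 (n - K).+1; move: h2; rewrite /g; clear; lra.
elim: k Kk kn => [|k IH]; first by rewrite leqn0 => /eqP Kk; rewrite Kk in K0.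
rewrite leq_eqVlt => /predU1P[<- _|Kk kn].
  by rewrite big_geq// !subrr addr0.
rewrite big_nat_recr//=.
have h1 : f (minn k (n - k)) <= f k + f (n - k)%N.
  by case: (leqP k (n - k)) => _; rewrite ?lerDl ?lerDr.
have h2 : f k <= g k - g k.+1 by apply: inv_sqrt_cube_le; lia.
have h3 : f (n - k)%N <= g (n - k)%N - g (n - k).+1.
  by apply: inv_sqrt_cube_le; lia.
have -> : (n - k.+1).+1 = (n - k)%N by lia.
have := IH ltac:(lia) ltac:(lia).
move: h1 h2 h3; clear; lra.
Qed.

(** The indices between k and n - k cancel in pairs. Formally, the difference [D] of the two sides
    does not change when k moves by one, and its values at the two ends are opposite, so it vanishes
    by [char0]. *)
Lemma odd_sum (V : zmodType) (c : nat -> V) n K k : (0 < K)%N ->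
  (forall x : V, x = - x -> x = 0) ->
  (forall j, (j <= n)%N -> c (n - j)%N = - c j) ->
  (K <= k)%N -> (k <= n - K)%N ->
  \sum_(K <= j < k) c j = \sum_(K <= j < (n - k).+1) c j.
Proof.
move=> K0 char0 codd Kk kn.
pose D i := \sum_(K <= j < K + i) c j - \sum_(K <= j < (n - (K + i)).+1) c j.
have DE i : (K + i <= (n - K).+1)%N -> D i = D 0%N.
  elim: i => // i IH h; rewrite -IH; last by lia.
  rewrite /D addnS big_nat_recr/=; last by lia.
  have -> : (n - (K + i).+1).+1 = (n - (K + i))%N by lia.
  rewrite [X in _ = _ - X]big_nat_recr/=; last by lia.
  by rewrite codd; [rewrite opprB addrA|lia].
have D00 : D 0%N = 0.
  apply: char0; rewrite -{1}(DE (n - K - K).+1); last by lia.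
  have h : (K + (n - K - K).+1)%N = (n - K).+1 by lia.
  have h' : (n - (n - K).+1).+1 = K by lia.
  by rewrite /D h h' addn0 [\sum_(K <= j < K) _]big_geq// sub0r opprK subr0.
have := DE (k - K)%N; rewrite D00 /D subnKC// => /(_ ltac:(lia)) /eqP.
by rewrite subr_eq0 => /eqP.
Qed.

End sums.

(* [lia] may diverge when there are hypotheses on complex numbers. *)
Ltac lia_nat := repeat match goal with H : ?T |- _ =>
  lazymatch type of T with Prop =>
    lazymatch T with
    | is_true (leq _ _) => fail
    | is_true (leq _ _ && leq _ _) => fail
    | @eq nat _ _ => fail
    | _ => clear H
    end
  end end; lia.

(** * The passage between the two zeros of the model field *)

Section transit.
Context {R : realType}.

Lemma cmod_sum (K k : nat) (f : nat -> R[i]) (g : nat -> R) :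
  (forall j, (K <= j < k)%N -> cmod (f j) <= g j) ->
  cmod (\sum_(K <= j < k) f j) <= \sum_(K <= j < k) g j.
Proof.
move=> h; rewrite big_seq [leRHS]big_seq.
elim/big_ind2: _ => [|x s y t|j]; first by rewrite cmod0.
  exact: cmodD_le.
by rewrite mem_index_iota; exact: h.
Qed.

(* The drift of the coordinate at time [j] in the unperturbed model: it changes
   sign under [j -> n - j], so that its sum over a symmetric interval is 0. *)
Definition odd_term (a : R[i]) n j : R[i] :=
  - (cot_orbit n j)%:C + a * ((cot_orbit n j)%:C ^+ 3 / (sin_gap n j ^+ 2)%:C).

Lemma odd_term_le a n j : (0 < j < n)%N ->
  cmod (odd_term a n j) <= (1 + cmod a) * sin_gap n j.
Proof.
move=> hj; have hW := cot_orbit_le_gap hj (R := R).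
have v0 := sin_gap_gt0 hj (R := R); rewrite mulrDl mul1r.
apply: cmodD_le; first by rewrite cmodN cmod_real.
apply: cmodM_le => //.
rewrite [leRHS](_ : _ = sin_gap n j ^+ 3 / sin_gap n j ^+ 2); last first.
  by move: v0; clear => v0; move: (sin_gap n j) v0 => v v0; field; rewrite gt_eqF.
apply: cmod_div_le; rewrite ?exprn_gt0//; first by apply: cmodX_le; rewrite cmod_real.
by rewrite cmod_real ger0_norm ?sqr_ge0.
Qed.

Lemma odd_term_rev a n j : (0 < n)%N -> (j <= n)%N ->
  odd_term a n (n - j) = - odd_term a n j.
Proof.
move=> n0 jn; rewrite /odd_term cot_orbit_rev// sin_gap_rev// rmorphN.
by rewrite exprNn -signr_odd /= expr1 opprD !mulN1r mulNr mulrN.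
Qed.

(** Before the middle the terms are of order 1 / j. After it [odd_sum] trades the long sum for the
    short one up to n - k, so the bound decreases again towards the exit. *)
Lemma odd_term_sum_le a n K k : (0 < K)%N -> (K <= k)%N -> (k <= n - K)%N ->
  cmod (\sum_(K <= j < k) odd_term a n j) <=
  32 * (1 + cmod a) * Num.sqrt (minn k (n - k))%:R.
Proof.
move=> K0 Kk kn; have n0 : (0 < n)%N by lia.
have a0 : 0 <= 1 + cmod a by rewrite addr_ge0// cmod_ge0.
have half l : (K <= l)%N -> (l.*2 <= n.+2)%N -> (l <= n)%N ->
    cmod (\sum_(K <= j < l) odd_term a n j) <= 16 * (1 + cmod a) * Num.sqrt l%:R.
  move=> Kl l2 ln; apply: (@le_trans _ _ (\sum_(K <= j < l) (1 + cmod a) * 4 * j%:R^-1)).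
    apply: cmod_sum => j /andP[Kj jl].
    have jn : (0 < j < n)%N by lia.
    apply: (le_trans (odd_term_le a jn)); rewrite -mulrA ler_wpM2l//.
    by apply: sin_gap_half; lia.
  rewrite -mulr_sumr; have := sum_inv_le (R := R) K0 Kl.
  by move: a0; clear; nra.
have s0 : 0 <= Num.sqrt (minn k (n - k))%:R :> R by rewrite sqrtr_ge0.
case: (leqP k (n - k)) => h.
  apply: (le_trans (half k Kk ltac:(lia) ltac:(lia))).
  move: h => /minn_idPl h; rewrite h in s0; move: a0 s0; clear; nra.
rewrite (odd_sum K0 _ _ Kk kn); last first.
- by move=> j jn; exact: odd_term_rev.
- by move=> x /esym/eqP; rewrite eqNr => /eqP.
apply: (le_trans (half (n - k).+1 ltac:(lia) ltac:(lia) ltac:(lia))).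
have /= := @sqrt_succ R (n - k) ltac:(lia).
by case=> s1 _ h2 _; move: a0 s1 h2; clear; nra.
Qed.

Definition fatou_shift n k (w : R[i]) : R[i] :=
  moebius (step_size n)%:C (cot_orbit n k)%:C w.

(** [moebius] contains a division, hence takes the value 0 when its denominator vanishes; for 0 < k
    < n this relation certifies that the denominator is nonzero. *)
Definition shift_rel n k (w : R[i]) : Prop :=
  moebius_rel (step_size n)%:C (cot_orbit n k)%:C (fatou_shift n k w) w.

(** A bootstrap. The step estimate at time k needs |Y_k| v_k small, which follows from the square
    root bound on Y_k, itself a consequence of the errors accumulated before k. The loop closes
    because for large K the accumulated error C / sqrt(K) is at most 1, and [A] has room for it. *)
Lemma transit (a : R[i]) (K1 M rho A0 : R) :
  0 <= K1 -> 0 <= M -> 0 < rho -> 0 <= A0 ->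
  exists A C : R, exists2 K0 : nat, (0 < K0)%N &
  forall K n (q : R[i] -> R[i]) (x kap : nat -> R[i]),
  (K0 <= K)%N -> (K.*2 < n)%N ->
  (forall w, cmod w < rho ->
     cmod (q w - (w + w ^+ 2 + a * w ^+ 3)) <= K1 * cmod w ^+ 4) ->
  (forall k, (K <= k < n - K)%N ->
     x k.+1 = q (x k) + (step_size n)%:C ^+ 2 + kap k) ->
  (forall k, (K <= k < n - K)%N -> cmod (kap k) <= M * step_size n ^+ 3) ->
  shift_rel n K (x K) -> cmod (fatou_shift n K (x K)) <= A0 * Num.sqrt K%:R ->
  forall k, (K <= k <= n - K)%N ->
  [/\ cmod (x k) <= 2 * sin_gap n k, cmod (x k) < rho, shift_rel n k (x k),
   cmod (fatou_shift n k (x k)) <= A * Num.sqrt (minn k (n - k))%:R &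
   cmod (fatou_shift n k (x k) - fatou_shift n K (x K)
      - \sum_(K <= j < k) (odd_term a n j + kap j / (sin_gap n j ^+ 2)%:C))
    <= C / Num.sqrt K%:R].
Proof.
move=> K10 M0 rho0 A00; set al := cmod a.
have al0 : 0 <= al by exact: cmod_ge0.
have [G GE] : exists G, G = 8 * al + 16 * K1 + M + 20 by eexists.
have [Cs CsE] : exists Cs, Cs = 26 * G + 14 * al + 16 * K1 + 100 by eexists.
(* The four terms bound the initial value, the odd sums, the total perturbation (at most M e n = M
   pi) and the accumulated error. *)
have [A AE] : exists A, A = A0 + 32 * (1 + al) + 4 * M + 1 by eexists.
(* From v <= 4 / m and 1 + |Y| <= (1 + A) sqrt(m); the factor 16 in [C] is that of
   [sum_two_sided_le]. *)
have [c cE] : exists c, c = 16 * Cs * (1 + A) by eexists.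
have [C CE] : exists C, C = c * 16 by eexists.
have G0 : 20 <= G by rewrite GE; move: al0 K10 M0; clear; lra.
have Cs0 : 0 <= Cs by rewrite CsE; move: al0 K10 G0; clear; lra.
have A1 : 1 <= A by rewrite AE; move: al0 M0 A00; clear; lra.
have Age0 : 0 <= A by move: A1; clear; lra.
have c0 : 0 <= c by rewrite cE !mulr_ge0// addr_ge0.
have C0 : 0 <= C by rewrite CE mulr_ge0.
(* [B] is the threshold for sqrt(K). Its terms ensure in turn |Y| v <= 1 / 32, v G <= 1 / 32, C /
   sqrt(K) <= 1, 2 v < rho and sqrt(K) >= 1. *)
have [B BE] : exists B, B = 128 * A + 128 * G + C + 8 / rho + 1 by eexists.
have r0 : 0 < 8 / rho by rewrite divr_gt0.
have B1 : 1 <= B by rewrite BE; move: Age0 G0 C0 r0; clear; lra.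
have [N0 hN0] : exists N0 : nat, B ^+ 2 <= N0%:R.
  by exists (Num.Def.archi_bound (B ^+ 2)); rewrite ltW// archi_boundP// sqr_ge0.
exists A, C, N0.+1 => //.
move=> K n q x kap KB Kn hq hx hkap rel0 Y0.
have K0 : (0 < K)%N by lia_nat.
have n0 : (0 < n)%N by lia_nat.
have sKB : B <= Num.sqrt K%:R.
  have -> : B = Num.sqrt (B ^+ 2) by rewrite sqrtr_sqr ger0_norm// (le_trans _ B1).
  by rewrite ler_wsqrtr// (le_trans hN0)// ler_nat; lia_nat.
set sK := Num.sqrt K%:R in sKB Y0 *.
have e0 := step_size_gt0 (R := R) n0.
set e := step_size n in hx hkap e0.
pose m k := minn k (n - k).
pose Y k := fatou_shift n k (x k).
pose S k := \sum_(K <= j < k) (odd_term a n j + kap j / (sin_gap n j ^+ 2)%:C).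
pose f k : R := ((m k)%:R * Num.sqrt (m k)%:R)^-1.
have sm k : (K <= k <= n - K)%N -> sK <= Num.sqrt (m k)%:R.
  by move=> hk; rewrite ler_wsqrtr// ler_nat /m; lia_nat.
have S_le k : (K <= k <= n - K)%N ->
    cmod (S k) <= 32 * (1 + al) * Num.sqrt (m k)%:R + 4 * M.
  move=> /andP[Kk kn]; rewrite /S big_split /=; apply: cmodD_le.
    exact: odd_term_sum_le.
  apply: (@le_trans _ _ (\sum_(K <= j < k) M * e)).
    apply: cmod_sum => j /andP[Kj jk].
    have jn : (0 < j < n)%N by lia_nat.
    have v0 := sin_gap_gt0 (R := R) jn.
    have ev := step_size_le_gap (R := R) jn.
    have -> : M * e = M * e ^+ 3 / e ^+ 2 by field; rewrite gt_eqF.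
    apply: cmod_div_le; rewrite ?exprn_gt0//.
      by apply: hkap; lia_nat.
    rewrite cmod_real ger0_norm ?exprn_ge0 ?(ltW v0)//.
    by rewrite lerXn2r// nnegrE ltW.
  rewrite sumr_const_nat -mulrnAr -[_ *+ _]mulr_natr mulrC ler_wpM2r//.
  apply: (@le_trans _ _ (e * n%:R)).
    by rewrite ler_wpM2l ?(ltW e0)// ler_nat; lia_nat.
  by rewrite step_sizeM//; have := pihalf_lt2 R; clear; lra.
have Y_le k : (K <= k <= n - K)%N -> cmod (Y k - Y K - S k) <= C / sK ->
    cmod (Y k) <= A * Num.sqrt (m k)%:R.
  move=> hk h; have -> : Y k = (Y k - Y K - S k) + Y K + S k by ring.
  apply: (le_trans (cmodD_le (cmodD_le h Y0) (S_le _ hk))).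
  have h1 : C / sK <= 1.
    rewrite ler_pdivrMr ?mul1r; last by move: B1 sKB; clear; lra.
    by apply: le_trans sKB; rewrite BE; move: Age0 G0 r0; clear; lra.
  have h2 := sm k hk; have h5 : A0 * sK <= A0 * Num.sqrt (m k)%:R.
    by rewrite ler_wpM2l// sm.
  have h3 : 1 <= sK by exact: le_trans sKB.
  have h4 : M <= M * Num.sqrt (m k)%:R.
    by rewrite ler_peMr// (le_trans h3).
  by rewrite AE; move: h1 h2 h3 h4 h5; clear; lra.
have numerics k : (K <= k <= n - K)%N -> cmod (Y k) <= A * Num.sqrt (m k)%:R ->
   let v := sin_gap n k in
   [/\ v <= 1 / 32, v * G <= 1 / 32, cmod (Y k) * v <= 1 / 32, 2 * v < rho &
      Cs * v ^+ 2 * (1 + cmod (Y k)) <= c * f k].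
  move=> hk hY v; have hkn : (0 < k < n)%N by lia_nat.
  have v0 : 0 < v := sin_gap_gt0 (R := R) hkn.
  have hv : v <= 4 / (m k)%:R := sin_gap_le (R := R) hkn.
  have := sm k hk; rewrite /f.
  have -> : (m k)%:R = Num.sqrt (m k)%:R ^+ 2 :> R by rewrite sqr_sqrtr.
  rewrite sqrtr_sqr ger0_norm ?sqrtr_ge0//.
  have mE : (m k)%:R = Num.sqrt (m k)%:R ^+ 2 :> R by rewrite sqr_sqrtr.
  move: hv hY; rewrite {1}mE; set s := Num.sqrt (m k)%:R => hv hY ss.
  have sB : B <= s := le_trans sKB ss.
  have s1 : 1 <= s := le_trans B1 sB.
  have s0 : 0 < s := lt_le_trans ltr01 s1.
  have vs : v * s <= 4 / s.
    apply: (le_trans (ler_wpM2r (ltW s0) hv)).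
    by rewrite expr2 invfM mulrA divfK// gt_eqF.
  have vsB z : z <= s -> 0 < z -> v * s * z <= 4.
    move=> zs z0; apply: (le_trans (ler_wpM2r (ltW z0) vs)).
    by rewrite mulrAC ler_pdivrMr// ler_wpM2l.
  have y0 := cmod_ge0 (Y k).
  have hA : v * s * A <= 1 / 32.
    have := vsB (128 * A); move: sB; rewrite BE; move: A1 G0 C0 r0; clear.
    by move=> A1 G0 C0 r0 sB /(_ ltac:(lra) ltac:(lra)); lra.
  have hG : v * s * G <= 1 / 32.
    have := vsB (128 * G); move: sB; rewrite BE; move: A1 G0 C0 r0; clear.
    by move=> A1 G0 C0 r0 sB /(_ ltac:(lra) ltac:(lra)); lra.
  have vvs : v <= v * s by rewrite ler_peMr// ltW.
  have vG0 : v * G <= v * s * G by rewrite ler_wpM2r//; move: G0; clear; lra.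
  split.
  - by apply: (le_trans vvs); apply: le_trans hA; rewrite ler_peMr// mulr_ge0// ltW.
  - exact: le_trans hG.
  - by rewrite mulrC; apply: le_trans hA; rewrite -mulrA ler_pM2l// mulrC.
  - have h8 : 8 / rho < s by move: sB Age0 G0 C0; rewrite BE; clear; lra.
    have h4 : v * (s * s) <= 4 by rewrite mulrA; apply: vsB.
    have h5 : v * s <= v * (s * s).
      by rewrite ler_pM2l// ler_peMl// ltW.
    move: h8; rewrite ltr_pdivrMr// => h8.
    have h6 : 2 * v * s <= 8 by move: h4 h5; clear; lra.
    rewrite -(ltr_pM2r s0); apply: (le_lt_trans h6).
    by rewrite mulrC.
  - have h1 : 1 + cmod (Y k) <= (1 + A) * s by move: hY s1; clear; lra.
    have h2 : v ^+ 2 <= 16 / (s ^+ 2 * s ^+ 2).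
      have -> : 16 / (s ^+ 2 * s ^+ 2) = (4 / s ^+ 2) ^+ 2 by field; rewrite gt_eqF.
      by rewrite lerXn2r ?nnegrE ?(ltW v0)// divr_ge0// sqr_ge0.
    apply: (@le_trans _ _ (Cs * (16 / (s ^+ 2 * s ^+ 2)) * ((1 + A) * s))).
      apply: ler_pM => //; first by rewrite mulr_ge0// sqr_ge0.
      - by rewrite addr_ge0.
      - by rewrite ler_wpM2l.
    rewrite le_eqVlt; apply/orP; left; apply/eqP; rewrite cE.
    by move: s0; clear => s0; field; rewrite gt_eqF.
have claim i : (K + i <= n - K)%N -> shift_rel n (K + i) (x (K + i)%N) /\
    cmod (Y (K + i)%N - Y K - S (K + i)%N) <= c * \sum_(K <= j < K + i) f j.
  elim: i => [_|i IH hi].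
    rewrite addn0; split => //.
    by rewrite /S !big_geq// subrr subr0 cmod0 mulr0.
  have [reli hYi] := IH ltac:(lia_nat).
  set k := (K + i)%N in reli hYi *.
  have hk : (K <= k <= n - K)%N by lia_nat.
  have hkn : (0 < k < n)%N by lia_nat.
  have hYi2 : cmod (Y k) <= A * Num.sqrt (m k)%:R.
    apply: (Y_le _ hk); apply: (le_trans hYi).
    have := sum_two_sided_le (R := R) (n := n) K0 (k := k) ltac:(lia_nat) ltac:(lia_nat).
    by rewrite -/sK CE -mulrA => h; rewrite ler_wpM2l.
  have /= [v32 vG yv vrho hErr] := numerics k hk hYi2.
  have v0 := sin_gap_gt0 (R := R) hkn.
  have hW : cmod (cot_orbit n k : R)%:C <= sin_gap n k.
    by rewrite cmod_real cot_orbit_le_gap.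
  have heps : cmod e%:C <= sin_gap n k.
    by rewrite cmod_real gtr0_norm// step_size_le_gap.
  have e1 : e <= 1 / 32 by apply: le_trans v32; exact: step_size_le_gap.
  have hV : e%:C ^+ 2 + (cot_orbit n k : R)%:C ^+ 2 = (sin_gap n k ^+ 2)%:C.
    by rewrite -sin_gap_sqr// rmorphD !rmorphXn.
  have [_ hxk] := moebius_size v0 hV hW erefl yv reli.
  have hqx := hq (x k) (le_lt_trans hxk vrho).
  have htau : cmod ((flow_time n : R)%:C - 1) <= sin_gap n k ^+ 2.
    rewrite (_ : _ - 1 = (flow_time n - 1 : R)%:C); last by rewrite rmorphB rmorph1.
    rewrite cmod_real.
    apply: (le_trans (flow_time_sub1 n0 _)).
      by apply: (le_trans e1); clear; lra.
    by rewrite lerXn2r ?nnegrE ?(ltW e0) ?(ltW v0)// step_size_le_gap.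
  have hflow : (cot_orbit n k.+1 : R)%:C * (1 - (cot_orbit n k)%:C * (flow_time n)%:C) =
      (cot_orbit n k)%:C + e%:C ^+ 2 * (flow_time n)%:C.
    have cos0 : cos (step_size n : R) != 0.
      have := cos_ge (step_size n : R); move: e1 e0; rewrite -/e; clear => e1 e0 h.
      by rewrite gt_eqF//; nra.
    have lift (t z w u : R) : t * (1 - z * w) = z + u ^+ 2 * w ->
        t%:C * (1 - z%:C * w%:C) = z%:C + u%:C ^+ 2 * w%:C.
      by move/(congr1 (real_complex R)); rewrite !(rmorphM, rmorphB, rmorphD, rmorphXn, rmorph1).
    by apply: lift; apply: cot_orbit_flow => //; lia_nat.
  have hstep : x k.+1 = x k + x k ^+ 2 + a * x k ^+ 3 +
      (q (x k) - (x k + x k ^+ 2 + a * x k ^+ 3)) + e%:C ^+ 2 + kap k.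
    rewrite hx; [ring|lia_nat].
  have hkapk : cmod (kap k) <= M * sin_gap n k ^+ 3.
    apply: (le_trans (hkap k ltac:(lia_nat))); rewrite ler_wpM2l//.
    by rewrite lerXn2r ?nnegrE ?(ltW e0) ?(ltW v0)// step_size_le_gap.
  have [_ rel' hdiff] := moebius_step (lexx al) K10 M0 GE CsE v0 v32 vG hV hW
    heps htau hflow erefl yv reli hstep hqx hkapk.
  have -> : (K + i.+1)%N = k.+1 by rewrite addnS.
  split => //.
  rewrite /S !big_nat_recr/=; [|lia_nat|lia_nat].
  rewrite mulrDr.
  rewrite (_ : _ - _ = (Y k - Y K - S k) + (Y k.+1 - Y k - (odd_term a n k +
    kap k / (sin_gap n k ^+ 2)%:C))); last by rewrite /S; ring.
  by apply: cmodD_le => //; exact: le_trans hErr.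
move=> k hk; have kE : (K + (k - K))%N = k by lia_nat.
have [] := claim (k - K)%N ltac:(lia_nat); rewrite kE => relk hYk.
have hC : cmod (Y k - Y K - S k) <= C / sK.
  apply: (le_trans hYk).
  have := sum_two_sided_le (R := R) (n := n) K0 (k := k) ltac:(lia_nat) ltac:(lia_nat).
  by rewrite -/sK CE -mulrA => h; rewrite ler_wpM2l.
have hYA := Y_le k hk hC.
have /= [_ _ yv vrho _] := numerics k hk hYA.
have hkn : (0 < k < n)%N by lia_nat.
have hW : cmod (cot_orbit n k : R)%:C <= sin_gap n k.
  by rewrite cmod_real cot_orbit_le_gap.
have hV : e%:C ^+ 2 + (cot_orbit n k : R)%:C ^+ 2 = (sin_gap n k ^+ 2)%:C.
  by rewrite -sin_gap_sqr// rmorphD !rmorphXn.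
have [_ hxk] := moebius_size (sin_gap_gt0 hkn) hV hW erefl yv relk.
by split => //; exact: le_lt_trans vrho.
Qed.

End transit.

(** * Birkhoff's ergodic theorem through a maximal inequality *)

Section birkhoff.
Context {R : realType} {d : measure_display} {Omega : measurableType d}.
Variables (mu : probability Omega R) (T : Omega -> Omega).
Hypothesis hT : measure_preserving mu T.
Implicit Types (f g : Omega -> R).

Definition birkhoff_sum f n z : R := \sum_(k < n) f (iter k T z).

(* The maximum of [0] and of the Birkhoff sums of length at most [n]. *)
Fixpoint birkhoff_max f n z : R :=
  if n is m.+1 then Num.max 0 (f z + birkhoff_max f m (T z)) else 0.

Lemma birkhoff_sumS f n z : birkhoff_sum f n.+1 z = f z + birkhoff_sum f n (T z).
Proof.
rewrite /birkhoff_sum big_ord_recl /=; congr (_ + _).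
by apply: eq_bigr => k _; rewrite /= -iterSr.
Qed.

Lemma birkhoff_sumB f (c : R) n z :
  birkhoff_sum (fun x => f x - c) n z = birkhoff_sum f n z - c *+ n.
Proof. by rewrite /birkhoff_sum sumrB big_const_ord iter_addr_0. Qed.

Lemma birkhoff_max_ge0 f n z : 0 <= birkhoff_max f n z.
Proof. by case: n => //= n; rewrite le_max lexx. Qed.

Lemma birkhoff_max_ge_sum f n z : birkhoff_sum f n z <= birkhoff_max f n z.
Proof.
elim: n z => [|n IH] z; first by rewrite /birkhoff_sum big_ord0.
by rewrite birkhoff_sumS /= le_max lerD2l IH orbT.
Qed.

Lemma birkhoff_maxS f n z : birkhoff_max f n z <= birkhoff_max f n.+1 z.
Proof.
elim: n z => [|n IH] z; first exact: birkhoff_max_ge0.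
rewrite [leLHS]/= [leRHS]/= ge_max le_max lexx /= le_max.
by rewrite lerD2l IH orbT.
Qed.

Lemma birkhoff_max_le f m n z : (m <= n)%N -> birkhoff_max f m z <= birkhoff_max f n z.
Proof.
move=> mn; rewrite -(subnKC mn); elim: (n - m)%N => [|i IH]; first by rewrite addn0.
by rewrite addnS (le_trans IH)// birkhoff_maxS.
Qed.

Lemma measurable_iter k : measurable_fun setT (iter k T).
Proof.
elim: k => [|k IH]; first exact: measurable_id.
exact: (measurableT_comp hT.1 IH).
Qed.

Lemma measurable_birkhoff_sum f n : measurable_fun setT f ->
  measurable_fun setT (birkhoff_sum f n).
Proof.
move=> mf; apply: measurable_sum => k.
exact: (measurableT_comp mf (measurable_iter k)).
Qed.

Lemma measurable_birkhoff_max f n : measurable_fun setT f ->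
  measurable_fun setT (birkhoff_max f n).
Proof.
move=> mf; elim: n => [|n IH]; first exact: measurable_cst.
apply: measurable_maxr; first exact: measurable_cst.
by apply: measurable_funD => //; exact: (measurableT_comp IH hT.1).
Qed.

Lemma integral_preserving (h : Omega -> \bar R) : measurable_fun setT h ->
  mu.-integrable setT (h \o T) ->
  (\int[mu]_z h (T z) = \int[mu]_z h z)%E.
Proof.
move=> mh ih.
have := integral_pushforward hT.1 mh (mu := mu) (D := setT).
rewrite preimage_setT => /(_ ih measurableT) <-.
apply: eq_measure_integral; first exact: hT.1.
by move=> mT A mA _; exact: hT.2.
Qed.



Lemma integrable_preserving (h : Omega -> \bar R) :
  mu.-integrable setT h -> mu.-integrable setT (h \o T).
Proof.
move=> /integrableP[mh ih]; apply/integrableP; split.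
  exact: measurableT_comp hT.1.
rewrite (le_lt_trans _ ih)//.
have m1 : measurable_fun setT (abse \o h) by exact: measurableT_comp.
have := ge0_integral_pushforward hT.1 mu (D := setT) (f := abse \o h)
  measurableT m1 ltac:(by move=> y _; exact: abse_ge0).
rewrite preimage_setT => <-.
rewrite (@eq_measure_integral _ _ _ _ mu)//; first exact: hT.1.
by move=> mT A mA _; exact: hT.2.
Qed.

Lemma integrable_birkhoff_max f n : mu.-integrable setT (EFin \o f) ->
  mu.-integrable setT (EFin \o birkhoff_max f n).
Proof.
move=> fi; elim: n => [|n IH]; first exact: integrable0.
have mf : measurable_fun setT f by apply/measurable_EFinP; case/integrableP: fi.
have IH' := integrable_preserving IH.
have hD := integrableD measurableT fi IH'.
apply: le_integrable hD => //.
  apply/measurable_EFinP; exact: (measurable_birkhoff_max n.+1).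
move=> z _ /=; rewrite lee_fin.
by rewrite ger0_norm ?le_max ?lexx// ge_max normr_ge0 ler_norm.
Qed.

(* Garsia: where [birkhoff_max f n.+1 z] is positive it is at most
   [f z + birkhoff_max f n.+1 (T z)], and [T] preserves its integral. *)
Lemma maximal_ergodic f : mu.-integrable setT (EFin \o f) ->
  {ae mu, forall z, exists n, 0 < birkhoff_sum f n z} ->
  0 <= \int[mu]_z f z.
Proof.
move=> fi hpos.
have mf : measurable_fun setT f by apply/measurable_EFinP; case/integrableP: fi.
(* The sets on which [f] is kept increase with n and exhaust almost all of [Omega] by hypothesis, so
   dominated convergence passes from [F n] to [f]. *)
pose F n z : R := if 0 < birkhoff_max f n.+1 z then f z else 0.
have mF n : measurable_fun setT (F n).
  apply: measurable_fun_ifT => //.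
  by apply: measurable_fun_ltr => //; exact: measurable_birkhoff_max.
have Fle n z : `|F n z| <= `|f z| by rewrite /F; case: ifP => //; rewrite normr0.
have Fi n : mu.-integrable setT (EFin \o F n).
  apply: le_integrable fi => //; first exact/measurable_EFinP.
  by move=> z _ /=; rewrite lee_fin.
have F0 n : 0 <= \int[mu]_z F n z.
  have Mi := integrable_birkhoff_max n.+1 fi.
  have MTi := integrable_preserving Mi.
  have e : \int[mu]_z (birkhoff_max f n.+1 z - birkhoff_max f n.+1 (T z)) = 0.
    rewrite RintegralB//; apply/eqP; rewrite subr_eq0; apply/eqP.
    have mM : measurable_fun setT (EFin \o birkhoff_max f n.+1).
      by apply/measurable_EFinP; exact: measurable_birkhoff_max.
    by rewrite /Rintegral; have /= <- := integral_preserving mM MTi.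
  rewrite -e; apply: le_Rintegral => //; first exact: (integrableB _ Mi MTi).
  move=> z _; rewrite /F; case: ifPn => [h|].
    have -> : birkhoff_max f n.+1 z = f z + birkhoff_max f n (T z).
      by move: h => /=; rewrite lt_max ltxx /= => h; rewrite max_r// ltW.
    by rewrite lerBlDr lerD2l birkhoff_maxS.
  rewrite -leNgt => h; rewrite subr_le0 (le_trans h)//; exact: birkhoff_max_ge0.
have cvgF : {ae mu, forall z, setT z -> (F n z)%:E @[n --> \oo] --> (f z)%:E}.
  apply: filterS hpos => z [m hm] _.
  apply: cvg_near_cst; exists m => // n /= mn.
  rewrite /F (lt_le_trans hm)// (le_trans (birkhoff_max_ge_sum _ _ _))//.
  by apply: birkhoff_max_le; exact: leqW.
have [_ _ cvgI] := dominated_convergence (mu := mu) measurableT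
  (f_ := fun n z => (F n z)%:E) (f := EFin \o f) (g := fun z => (`|f z|)%:E)
  ltac:(by move=> n; exact/measurable_EFinP) ltac:(exact/measurable_EFinP)
  cvgF ltac:(exact: (integrable_norm fi)) ltac:(by apply: aeW => z n _; rewrite /= lee_fin).
have : (0 <= \int[mu]_z (f z)%:E)%E.
  apply: (cvge_ge _ cvgI); apply: nearW => n /=.
  by rewrite -(fineK (integrable_fin_num measurableT (Fi n))) lee_fin; exact: F0.
by rewrite -(fineK (integrable_fin_num measurableT fi)) lee_fin.
Qed.

(** The set where the upper limit of the averages of [g] is positive. Countable quantifiers make it
    measurable, and the variable rate 1 / (j + 1) makes it invariant. *)
Definition often_large (g : Omega -> R) : set Omega :=
  [set z | exists j, forall N, exists2 n, (N <= n)%N &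
    n%:R / j.+1%:R < birkhoff_sum g n z].

Lemma measurable_often_large g : measurable_fun setT g ->
  measurable (often_large g).
Proof.
move=> mg; rewrite (_ : often_large g = \bigcup_j \bigcap_N \bigcup_(n in [set n | (N <= n)%N])
    [set z | n%:R / j.+1%:R < birkhoff_sum g n z]); last first.
  apply/seteqP; split => z.
    by move=> [j h]; exists j => // N _; have [n Nn hn] := h N; exists n.
  by move=> [j _ h]; exists j => N; have [n Nn hn] := h N I; exists n.
apply: bigcup_measurable => j _; apply: bigcap_measurable => [|N _]; first by exists 0%N.
apply: bigcup_measurable => n _.
rewrite -[X in measurable X]setTI.
have : measurable_fun setT (fun z => n%:R / j.+1%:R < birkhoff_sum g n z).
  by apply: measurable_fun_ltr => //; exact: measurable_birkhoff_sum.
by move=> /(_ measurableT [set true]); apply.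
Qed.

(** Replacing z by T z changes a Birkhoff sum by the single term g z and its length by one; passing
    from j to j + 1 absorbs both for large n. Equality is exact, as the definition of [ergodic]
    demands. *)
Lemma often_large_invariant g : T @^-1` often_large g = often_large g.
Proof.
have shift (j : nat) (s : R) : exists M : nat, forall n, (M <= n)%N ->
    n.+1%:R / j.+2%:R + `|s| < n%:R / j.+1%:R.
  have d0 : 0 < j.+1%:R^-1 - j.+2%:R^-1 :> R.
    by rewrite subr_gt0 ltf_pV2 ?posrE ?ltr0n// ltr_nat.
  set dl : R := _ - _ in d0.
  exists (Num.Def.archi_bound ((`|s| + 1) / dl)) => n hn.
  have : (`|s| + 1) / dl < n%:R.
    apply: (lt_le_trans (archi_boundP _)); last by rewrite ler_nat.
    by apply: divr_ge0; [exact: addr_ge0|exact: ltW].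
  rewrite ltr_pdivrMr// /dl mulrBr => h.
  have -> : n.+1%:R / j.+2%:R = n%:R / j.+2%:R + j.+2%:R^-1 :> R.
    by rewrite -[n.+1%:R]natr1 mulrDl mul1r.
  have : j.+2%:R^-1 <= 1 :> R by rewrite invf_le1// ler1n.
  move: h; clear; move: (n%:R / j.+1%:R : R) (n%:R / j.+2%:R : R) (j.+2%:R^-1 : R) => p t u.
  lra.
apply/seteqP; split => z [j h]; exists j.+1 => N.
  have [M hM] := shift j (g z).
  have [n Nn hn] := h (maxn N M).
  exists n.+1; first by move: Nn; rewrite geq_max => /andP[? _]; exact: leqW.
  rewrite birkhoff_sumS; have := hM n; move: Nn; rewrite geq_max => /andP[_ ->].
  move=> /(_ isT); move: hn; have := ler_norm (- g z); rewrite normrN.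
  clear; move: (n.+1%:R / j.+2%:R : R) (n%:R / j.+1%:R : R) (birkhoff_sum _ _ _).
  by move=> p t u; lra.
have [M hM] := shift j (g z).
have [[|n] Nn hn] := h (maxn N M).+1; first by [].
exists n; first by move: Nn; rewrite ltnS geq_max => /andP[].
have := hM n; move: Nn; rewrite ltnS geq_max => /andP[_ ->] /(_ isT).
move: hn; rewrite birkhoff_sumS => hn.
have le1 i : n%:R / i.+1%:R <= n.+1%:R / i.+1%:R :> R.
  by rewrite ler_pM2r ?invr_gt0// ler_nat.
move: (le1 j) (le1 j.+1) hn; have := ler_norm (g z); clear.
move: (n.+1%:R / j.+2%:R : R) (n.+1%:R / j.+1%:R : R) (n%:R / j.+1%:R : R)
  (n%:R / j.+2%:R : R) (birkhoff_sum _ _ _).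
by move=> p t u v w; lra.
Qed.

(** By ergodicity the set has measure 0 or 1. If it had measure 1, [maximal_ergodic] would apply to
    f - c and give f a mean of at least c. *)
Lemma not_often_large f (c : R) : ergodic mu T ->
  mu.-integrable setT (EFin \o f) -> \int[mu]_z f z < c ->
  {ae mu, forall z, ~ often_large (fun x => f x - c) z}.
Proof.
move=> [_ erg] fi fc.
have mf : measurable_fun setT f by apply/measurable_EFinP; case/integrableP: fi.
set g := fun x => f x - c.
have ci : mu.-integrable setT (EFin \o (fun=> c)).
  by apply: finite_measure_integrable_cst.
have gi : mu.-integrable setT (EFin \o g).
  exact: (integrableB measurableT fi ci).
have mg : measurable_fun setT g by apply/measurable_EFinP; case/integrableP: gi.
have mE := measurable_often_large mg.
have [E0|E1] := erg _ mE (often_large_invariant g).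
  by exists (often_large g); split => // z /= /contrapT.
have : 0 <= \int[mu]_z g z.
  apply: maximal_ergodic => //; exists (~` often_large g); split.
  - exact: measurableC.
  - by rewrite probability_setC// E1 subee.
  - move=> z /= hz [j h]; apply: hz.
    have [n _ hn] := h 0%N; exists n.
    by apply: le_lt_trans hn; rewrite divr_ge0.
rewrite RintegralB// Rintegral_cst//.
rewrite (_ : fine _ = 1); last exact: (congr1 fine (probability_setT mu)).
rewrite mulr1.
by rewrite subr_ge0 leNgt fc.
Qed.

Lemma birkhoff_upper f : ergodic mu T -> mu.-integrable setT (EFin \o f) ->
  {ae mu, forall z, forall e : R, 0 < e -> \forall n \near \oo,
     n%:R^-1 * birkhoff_sum f n z <= \int[mu]_z f z + e}.
Proof.
move=> erg fi.
have h : {ae mu, forall z, forall i : nat,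
    ~ often_large (fun x => f x - (\int[mu]_z f z + i.+1%:R^-1)) z}.
  apply: ae_foralln => i; apply: not_often_large => //.
  by rewrite ltrDl invr_gt0.
apply: filterS h => z hz e e0.
(* 1 / (i + 1) is spent twice, as the excess of the constant over the mean and as the rate in
   [often_large]. *)
have [i hi] : exists i : nat, 2 / e < i.+1%:R.
  exists (Num.Def.archi_bound (2 / e)); apply: (lt_trans (archi_boundP _)).
    by rewrite divr_ge0// ltW.
  by rewrite ltr_nat.
have /existsNP[N hN] : ~ forall N, exists2 n, (N <= n)%N & n%:R / i.+1%:R <
    birkhoff_sum (fun x => f x - (\int[mu]_z f z + i.+1%:R^-1)) n z.
  by move=> h; apply: (hz i); exists i.
exists N.+1 => // n /= Nn.
have n0 : 0 < n%:R :> R by rewrite ltr0n (leq_trans _ Nn).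
rewrite mulrC ler_pdivrMr// leNgt; apply/negP => hlt; apply: hN; exists n.
  exact: ltnW.
rewrite birkhoff_sumB -[(_ + _) *+ n]mulr_natr ltrBrDr; apply: le_lt_trans hlt.
move: hi; rewrite ltr_pdivrMr// => hi.
have i0 : 0 < i.+1%:R :> R by [].
have : 2 * i.+1%:R^-1 <= e.
  by rewrite ler_pdivrMr// mulrC ltW.
move: n0; clear.
move: (i.+1%:R^-1 : R) (n%:R : R) (\int[mu]_z f z) => p t u t0 pe.
by have := ler_wpM2l (ltW t0) pe; lra.
Qed.

Theorem birkhoff f : ergodic mu T -> mu.-integrable setT (EFin \o f) ->
  {ae mu, forall z,
     n%:R^-1 * birkhoff_sum f n z @[n --> \oo] --> \int[mu]_z f z}.
Proof.
move=> erg fi.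
have fiN : mu.-integrable setT (EFin \o (fun x => - f x)).
  exact: (integrableN fi).
have IN : \int[mu]_z (- f z) = - \int[mu]_z f z.
  have := RintegralZl (-1) measurableT fi.
  by under eq_Rintegral do rewrite mulN1r; rewrite mulN1r.
have := birkhoff_upper erg fiN; have := birkhoff_upper erg fi.
apply: filterS2 => z h1 h2.
apply/cvgrPdist_le => e e0; near=> n.
rewrite ler_norml lerBlDr -lerBlDl; apply/andP; split.
  rewrite lerBrDl -lerBrDr opprK; near: n; exact: h1.
have : n%:R^-1 * birkhoff_sum (fun x => - f x) n z <= \int[mu]_z (- f z) + e.
  by near: n; exact: h2.
rewrite IN /birkhoff_sum sumrN mulrN; clear; lra.
Unshelve. all: by end_near.
Qed.

End birkhoff.

(** * Complex limits, ultrafilters and the principal logarithm *)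

Section complex_limits.
Context {R : realType}.
Local Notation C := R[i]^o.

Lemma cmod_le_ReIm (x : R[i]) : cmod x <= `|complex.Re x| + `|complex.Im x|.
Proof.
case: x => x y /=; rewrite /cmod /=.
rewrite -[leRHS]ger0_norm ?addr_ge0// -sqrtr_sqr ler_sqrt ?sqr_ge0//.
rewrite sqrrD !real_normK ?num_real// lerD2r lerDl mulrn_wge0//.
Qed.

Lemma Re_le_cmod (x : R[i]) : `|complex.Re x| <= cmod x.
Proof.
case: x => x y /=; rewrite /cmod /= -sqrtr_sqr ler_sqrt ?addr_ge0 ?sqr_ge0//.
by rewrite lerDl sqr_ge0.
Qed.

Lemma Im_le_cmod (x : R[i]) : `|complex.Im x| <= cmod x.
Proof.
case: x => x y /=; rewrite /cmod /= -sqrtr_sqr ler_sqrt ?addr_ge0 ?sqr_ge0//.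
by rewrite lerDr sqr_ge0.
Qed.

Lemma cmod_lt (x : R[i]) (e : R) : (`|x| < e%:C) = (cmod x < e).
Proof. by rewrite cmodE ltcR. Qed.

Lemma cmod_le (x : R[i]) (e : R) : (`|x| <= e%:C) = (cmod x <= e).
Proof. by rewrite cmodE lecR. Qed.

Lemma gt0_complex_real (e : R[i]) : 0 < e -> exists2 r : R, 0 < r & e = r%:C.
Proof.
case: e => e1 e2; rewrite ltcE /= => /andP[/eqP -> e0].
by exists e1.
Qed.

Lemma nbhs_cmodP (p : C) (A : set C) :
  nbhs p A <-> exists2 e : R, 0 < e & forall x, cmod (x - p) < e -> A x.
Proof.
split.
  move=> /nbhs_ballP[e /= /gt0_complex_real[r r0 ->]] h; exists r => // x hx.
  by apply: h; rewrite /ball /= distrC cmod_lt.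
move=> [e e0 h]; apply/nbhs_ballP; exists e%:C; first by rewrite /= ltcR.
by move=> x; rewrite /ball /= distrC cmod_lt; exact: h.
Qed.

Lemma cvgC_lt {I : Type} (F : set_system I) {FF : Filter F} (f : I -> C) (l : C) :
  f n @[n --> F] --> l <->
  forall e : R, 0 < e -> \forall n \near F, cmod (f n - l) < e.
Proof.
rewrite cvgrPdist_lt; split=> h e e0.
  have := h e%:C; rewrite ltcR => /(_ e0); apply: filterS => n.
  by rewrite distrC cmod_lt.
have [r r0 ->] := gt0_complex_real e0; have := h r r0.
by apply: filterS => n; rewrite distrC cmod_lt.
Qed.

Lemma cvgC_real {I : Type} (F : set_system I) {FF : Filter F} (f : I -> R) (l : R) :
  f n @[n --> F] --> l -> ((f n)%:C : C) @[n --> F] --> (l%:C : C).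
Proof.
move=> /cvgrPdist_lt h; apply/cvgC_lt => e e0; have := h e e0.
by apply: filterS => n; rewrite -rmorphB cmod_real distrC.
Qed.

Lemma cvgC_ReIm {I : Type} (F : set_system I) {FF : Filter F} (f : I -> C) (x y : R) :
  complex.Re (f n) @[n --> F] --> x -> complex.Im (f n) @[n --> F] --> y ->
  f n @[n --> F] --> (x +i* y : C).
Proof.
move=> /cvgrPdist_lt hx /cvgrPdist_lt hy; apply/cvgC_lt => e e0.
have e20 : 0 < e / 2 by rewrite divr_gt0.
apply: filterS2 (hx _ e20) (hy _ e20) => n h1 h2.
apply: (le_lt_trans (cmod_le_ReIm _)).
move: h1 h2; rewrite distrC [X in _ -> X < _ -> _]distrC.
case: (f n) => p t /=; move: (p - x) (t - y) => u v; clear; lra.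
Qed.

Lemma cvgC_squeeze {I : Type} (F : set_system I) {FF : Filter F}
    (f : I -> C) (l : C) (g : I -> R) :
  (\forall n \near F, cmod (f n - l) <= g n) -> g n @[n --> F] --> 0 ->
  f n @[n --> F] --> l.
Proof.
move=> h /cvgrPdist_lt hg; apply/cvgC_lt => e e0.
apply: filterS2 h (hg e e0) => n h1; rewrite sub0r normrN => h2.
by apply: (le_lt_trans h1); apply: le_lt_trans h2; exact: ler_norm.
Qed.

Lemma cmod_cvg_le {I : Type} (F : set_system I) {FF : ProperFilter F}
    (f : I -> C) (l : C) (g : I -> R) (b : R) :
  f n @[n --> F] --> l -> g n @[n --> F] --> b ->
  (\forall n \near F, cmod (f n) <= g n) -> cmod l <= b.
Proof.
move=> /cvgC_lt hf /cvgrPdist_lt hg h; apply/ler_addgt0Pl => e e0.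
have e20 : 0 < e / 2 by rewrite divr_gt0.
have [n [[h1 h2] h3]] := filter_ex (filterI (filterI (hf _ e20) (hg _ e20)) h).
have := cmodD_le (lexx (cmod (l - f n))) h3; rewrite subrK cmod_distC => h4.
by move: h1 h2 h4; have := ler_norm (- (b - g n)); rewrite normrN; clear; lra.
Qed.

Lemma near_cvgC_neq0 {I : Type} (F : set_system I) {FF : Filter F} (f : I -> C) (l : C) :
  l != 0 -> f n @[n --> F] --> l -> \forall n \near F, f n != 0.
Proof.
move=> l0 /cvgC_lt /(_ _ (cmod_gt0 l0)); apply: filterS => n.
by apply: contraTneq => ->; rewrite sub0r cmodN ltxx.
Qed.

Lemma cvg_holomorphic {I : Type} (F : set_system I) {FF : Filter F} (U : set C)
  (q : C -> C) (f : I -> C) (l : C) : holomorphic_on U q -> U l ->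
  f n @[n --> F] --> l -> q (f n) @[n --> F] --> q l.
Proof.
move=> hq Ul hf; have /derivable1_diffP/differentiable_continuous h := hq l Ul.
exact: (cvg_comp _ _ hf h).
Qed.

(** Otherwise the complement of [P] meets every set of [\oo], and an ultrafilter that contains these
    traces contradicts the hypothesis. Convergence along [\oo] can thus be tested on ultrafilters,
    along which every bounded sequence has a limit. *)
Lemma near_ultra (P : set nat) :
  (forall F : set_system nat, UltraFilter F -> \oo `<=` F -> F P) -> \oo P.
Proof.
move=> h; apply: contrapT => nP.
have FF : ProperFilter (within (~` P) \oo).
  apply: Build_ProperFilter_ex => A hA.
  apply: contrapT => nA; apply: nP; move: hA; rewrite /within /=.
  apply: filterS => n hn.
  by apply: contrapT => nPn; apply: nA; exists n; exact: hn.
have [G [GU sG]] := ultraFilterLemma FF.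
have GP : G P.
  by apply: h => // A hA; apply: sG; apply: filterS hA => n An _.
have GnP : G (~` P) by apply: sG; rewrite /within /=; exact: nearW.
by have [n [h1 h2]] := filter_ex (filterI GP GnP); case: (h2 h1).
Qed.

Lemma cvg_ultra_bounded {I : Type} (F : set_system I) {FU : UltraFilter F}
    (f : I -> R) (M : R) : F [set n | `|f n| <= M] -> cvg (f n @[n --> F]).
Proof.
move=> hM; have FF : ProperFilter F by exact: ultra_proper.
have co : compact `[-M, M] by exact: segment_compact.
have FA : F (f @^-1` [set` `[-M, M]]).
  by apply: filterS hM => n; rewrite /= in_itv /= ler_norml.
have [p [_ hp]] := co (f @ F) _ FA.
apply/cvg_ex; exists p => V hV.
have [//|nV] := in_ultra_setVsetC (f @^-1` V) FU.
by have [x [h1 h2]] := hp (~` V) V nV hV; case: (h1 h2).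
Qed.

Lemma cvgC_ultra_bounded {I : Type} (F : set_system I) {FU : UltraFilter F}
    (f : I -> C) (M : R) : F [set n | cmod (f n) <= M] ->
  exists l : C, f n @[n --> F] --> l.
Proof.
move=> hM; have FF : ProperFilter F by exact: ultra_proper.
have /cvg_ex[x hx] : cvg (complex.Re (f n) @[n --> F]).
  apply: (@cvg_ultra_bounded _ F _ _ M); apply: filterS hM => n.
  exact: le_trans (Re_le_cmod _).
have /cvg_ex[y hy] : cvg (complex.Im (f n) @[n --> F]).
  apply: (@cvg_ultra_bounded _ F _ _ M); apply: filterS hM => n.
  exact: le_trans (Im_le_cmod _).
by exists (x +i* y); exact: cvgC_ReIm.
Qed.

Lemma principal_log_scale (t : R) (z : R[i]) : 0 < t -> z != 0 ->
  principal_log (t%:C * z) = (ln t)%:C + principal_log z.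
Proof.
move=> t0 z0; have cz := cmod_gt0 z0.
have e1 : cmod (t%:C * z) = t * cmod z by rewrite cmodM cmod_real gtr0_norm.
have eR : complex.Re (t%:C * z) = t * complex.Re z.
  by case: (z) => x y /=; rewrite mul0r subr0.
have eI : complex.Im (t%:C * z) = t * complex.Im z.
  by case: (z) => x y /=; rewrite mul0r addr0.
rewrite /principal_log /principal_arg e1 eR eI pmulr_rge0//.
rewrite -mulf_div divff ?gt_eqF// mul1r lnM ?posrE//.
by apply/eqP; rewrite eq_complex /= add0r !eqxx.
Qed.

Lemma principal_arg_le (z : R[i]) : z != 0 -> `|principal_arg z| <= pi.
Proof.
move=> z0; have cz := cmod_gt0 z0.
have h : -1 <= complex.Re z / cmod z <= 1.
  rewrite -ler_norml normrM normfV (ger0_norm (ltW cz)) ler_pdivrMr// mul1r.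
  exact: Re_le_cmod.
by rewrite /principal_arg; case: ifP => _; rewrite ?normrN ger0_norm ?acos_ge0 ?acos_lepi.
Qed.

Lemma principal_log_le (z : R[i]) : z != 0 ->
  cmod (principal_log z) <= `|ln (cmod z)| + pi.
Proof.
move=> z0; apply: (le_trans (cmod_le_ReIm _)) => /=; rewrite lerD2l.
exact: principal_arg_le.
Qed.

Lemma acos_lt (x e : R) : 0 < e < pi -> cos e < x -> x <= 1 -> acos x < e.
Proof.
move=> /andP[e0 epi] hx x1; have hx1 : -1 <= x <= 1.
  by rewrite x1 andbT (le_trans (cos_geN1 e))// ltW.
rewrite ltNge; apply/negP => h; move: hx; apply/negP; rewrite -leNgt.
rewrite -[leLHS](@acosK R x) ?in_itv//.
rewrite leNgt (@ltr_cos R) -?leNgt// in_itv /= ?acos_ge0 ?acos_lepi//.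
by rewrite ltW//= ltW.
Qed.

Lemma principal_log_near1 (e : R) : 0 < e -> exists2 d : R, 0 < d &
  forall z : R[i], cmod (z - 1) < d -> cmod (principal_log z) < e.
Proof.
move=> e0.
pose e' := Num.min (e / 2) 1.
have e'0 : 0 < e' by rewrite lt_min ltr01 divr_gt0.
have e'1 : e' <= 1 by rewrite ge_min lexx orbT.
have e'e : e' <= e / 2 by rewrite ge_min lexx.
have hln : ln t @[t --> (1 : R)] --> 0.
  by rewrite -(@ln1 R); exact: continuous_ln.
have [d d0 hd] : exists2 d : R, 0 < d & forall t, `|t - 1| < d -> `|ln t| < e / 2.
  have h0 : nbhs (1 : R) [set t | `|0 - ln t| < e / 2].
    by move/cvgrPdist_lt : hln; apply; rewrite divr_gt0.
  move/nbhs_ballP : h0 => [d /= d0 h]; exists d => // t ht.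
  by have := h t; rewrite /ball /= distrC sub0r normrN; apply.
have ce : cos e' < 1.
  rewrite -(@cos0 R) ltr_cos// in_itv /= ?lexx ?pi_ge0// ltW//=.
  by rewrite (le_trans e'1)// (le_trans _ (pi_ge2 R))// ler1n.
(* The three bounds control ln |z|, keep |z| above 1 / 2, and force Re z > cos(e') |z|: with t = |z
   - 1|, Re z >= 1 - t while cos(e') |z| <= cos(e') + t. *)
pose d2 := Num.min (Num.min d (1 / 2)) ((1 - cos e') / 2).
have d20 : 0 < d2 by rewrite !lt_min d0 !divr_gt0// subr_gt0.
exists d2; first exact: d20.
move=> z; rewrite [_ < d2]lt_min [_ < Num.min _ _]lt_min => /andP[/andP[z1 z2] z3].
have hz : `|cmod z - 1| <= cmod (z - 1).
  rewrite ler_norml; apply/andP; split.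
    have := cmod_ge (x := 1) (y := z) (lexx _) (lexx _).
    by rewrite cmod1 cmod_distC; clear; lra.
  have := cmod_ge (x := z) (y := 1) (lexx _) (lexx _).
  by rewrite cmod1; clear; lra.
have cz : 1 / 2 < cmod z.
  by move: hz z2 => /ler_normlP[]; clear; lra.
have z0 : z != 0 by apply: cmod_neq0; move: cz; clear; lra.
apply: (le_lt_trans (cmod_le_ReIm _)) => /=.
have h1 : `|ln (cmod z)| < e / 2 by apply: hd; exact: le_lt_trans z1.
suff h2 : `|principal_arg z| < e / 2 by move: h1 h2; clear; lra.
have cz0 : 0 < cmod z by exact: cmod_gt0.
apply: (@lt_le_trans _ _ e') => //.
have ac : acos (complex.Re z / cmod z) < e'.
  apply: acos_lt; first by rewrite e'0 (le_lt_trans e'1)// (lt_le_trans _ (pi_ge2 R))// ltr1n.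
    rewrite ltr_pdivlMr//.
    have hR : `|complex.Re z - 1| <= cmod (z - 1).
      by have := Re_le_cmod (z - 1); case: (z) => x y.
    have c1 := cos_geN1 e'; move: hz hR => /ler_normlP[_ k1] /ler_normlP[k2 _].
    have c0 : 0 <= cos e'.
      by have := cos_ge e'; move: e'0 e'1; clear; nra.
    have k3 : cos e' * cmod z <= cos e' * (1 + cmod (z - 1)).
      by rewrite ler_wpM2l//; move: k1; clear; lra.
    have k4 : cos e' * cmod (z - 1) <= cmod (z - 1).
      by rewrite ler_piMl ?cmod_ge0// cos_le1.
    by move: k2 k3 k4 z3; clear; lra.
  by rewrite ler_pdivrMr// mul1r (le_trans (ler_norm _))// Re_le_cmod.
have a0 : 0 <= acos (complex.Re z / cmod z).
  apply: acos_ge0.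
  rewrite -ler_norml normrM normfV (ger0_norm (ltW cz0)) ler_pdivrMr// mul1r.
  exact: Re_le_cmod.
by rewrite /principal_arg; case: ifP => _; rewrite ?normrN ger0_norm.
Qed.

End complex_limits.

(** * From plain averages to averages with the weights 2 sin(e k)^2 / n *)

Section weighted_average.
Context {R : realType}.

Lemma summation_by_parts (h t : nat -> R) n :
  \sum_(k < n) h k * t k = h n * \sum_(k < n) t k
     - \sum_(k < n) (h k.+1 - h k) * \sum_(j < k.+1) t j.
Proof.
elim: n => [|n IH]; first by rewrite !big_ord0 mulr0 subr0.
rewrite big_ord_recr /= IH [X in _ = _ - X]big_ord_recr /= [in RHS]big_ord_recr /=.
by ring.
Qed.

Lemma sublinear_bound (S : nat -> R) (dl : R) (N : nat) :
  0 <= dl -> (forall n, (N <= n)%N -> `|S n| <= dl * n%:R) ->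
  exists2 c : R, 0 <= c & forall n, `|S n| <= dl * n%:R + c.
Proof.
move=> dl0 h; exists (\sum_(j < N) `|S j|); first by rewrite sumr_ge0.
move=> n; have [Nn|nN] := leqP N n.
  by apply: (le_trans (h n Nn)); rewrite lerDl sumr_ge0.
apply: (@le_trans _ _ (\sum_(j < N) `|S j|)); last by rewrite lerDr mulr_ge0.
by rewrite (bigD1 (Ordinal nN))//= lerDl sumr_ge0.
Qed.

(** The partial sums of s - u are o(n), and consecutive weights before division by n differ by at
    most 2 e; summation by parts leaves n (2 e) o(n) / n = o(n) / n. The boundary term vanishes
    because sin(pi) = 0. *)
Lemma weighted_average (s : nat -> R) (u : R) :
  n%:R^-1 * \sum_(k < n) s k @[n --> \oo] --> u ->
  \sum_(k < n) 2 * sin (step_size n * k%:R) ^+ 2 / n%:R * s k @[n --> \oo] --> u.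
Proof.
move=> /cvgrPdist_le hs; apply/cvgrPdist_le => e e0.
(* The final bound is 2 pi (dl n + c) / n with 2 pi <= 8: the first part is at most e / 2, and n >=
   16 c / e makes the second at most e / 2. *)
pose t k := s k - u; pose dl := e / 16.
have dl0 : 0 < dl by rewrite divr_gt0.
have [N _ hN] := hs dl dl0.
have [c c0 hc] : exists2 c : R, 0 <= c & forall n,
    `|\sum_(k < n) t k| <= dl * n%:R + c.
  apply: (@sublinear_bound _ _ N.+1); first exact: ltW.
  move=> n Nn; have n0 : 0 < n%:R :> R by rewrite ltr0n (leq_trans _ Nn).
  have := hN n (ltnW Nn); rewrite /= => h.
  have -> : \sum_(k < n) t k = - ((u - n%:R^-1 * \sum_(k < n) s k) * n%:R).
    rewrite /t sumrB big_const_ord iter_addr_0 mulrBl mulrAC mulVf ?gt_eqF// mul1r.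
    by rewrite opprB mulr_natr.
  by rewrite normrN normrM (ger0_norm (ltW n0)) ler_pM2r.
near=> n.
have n1 : (1 < n)%N by near: n; exact: nbhs_infty_gt.
have n0 : 0 < n%:R :> R by rewrite ltr0n ltnW.
have nc : 16 * c / e <= n%:R.
  by near: n; exact: nbhs_infty_ger.
pose h k : R := 2 * sin (step_size n * k%:R) ^+ 2.
have step0 : 0 < step_size n :> R by rewrite step_size_gt0// ltnW.
have hn : h n = 0 by rewrite /h step_sizeM 1?ltnW// sinpi expr0n mulr0.
have dh k : `|h k.+1 - h k| <= 2 * step_size n.
  rewrite /h -mulrBr normrM ger0_norm// ler_wpM2l//.
  apply: (le_trans (sin2_lipschitz _ _)).
  by rewrite -mulrBr -natrB// subSnn mulr1 gtr0_norm.
have hsum : \sum_(k < n) h k = n%:R.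
  by rewrite -(sum_sin2 n1); apply: eq_bigr => k _; rewrite -step_sizeE.
have -> : u - \sum_(k < n) 2 * sin (step_size n * k%:R) ^+ 2 / n%:R * s k =
   n%:R^-1 * \sum_(k < n) (h k.+1 - h k) * \sum_(j < k.+1) t j.
  have := summation_by_parts h t n; rewrite hn mul0r sub0r => /eqP.
  rewrite -eqr_oppLR => /eqP <-.
  rewrite mulrN /t; under [X in - (_ * X)]eq_bigr do rewrite mulrBr.
  rewrite sumrB -mulr_suml hsum mulrBr mulrA mulVf ?gt_eqF// mul1r opprB.
  by rewrite mulr_sumr; congr (_ - _); apply: eq_bigr => k _; rewrite /h; ring.
have h1 : `|\sum_(k < n) (h k.+1 - h k) * \sum_(j < k.+1) t j| <=
    \sum_(k < n) (2 * step_size n * (dl * n%:R + c)).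
  apply: (le_trans (ler_norm_sum _ _ _)); apply: ler_sum => k _.
  rewrite normrM; apply: ler_pM => //; apply: (le_trans (hc _)).
  by rewrite lerD2r ler_pM2l// ler_nat.
rewrite normrM ger0_norm ?invr_ge0 ?(ltW n0)//.
rewrite ler_pdivrMl//; apply: (le_trans h1).
rewrite big_const_ord iter_addr_0 -[leLHS]mulr_natl.
have -> : n%:R * (2 * step_size n * (dl * n%:R + c)) =
  2 * (step_size n * n%:R) * (dl * n%:R + c) :> R by ring.
rewrite step_sizeM 1?ltnW//.
have pi4 : 2 * pi <= 8 :> R by have := pihalf_lt2 R; clear; lra.
have le0 : 0 <= dl * n%:R + c by rewrite addr_ge0// mulr_ge0// ltW.
apply: (le_trans (ler_wpM2r le0 pi4)).
rewrite ler_pdivrMr// in nc.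
rewrite /dl; move: nc; clear; lra.
Unshelve. all: by end_near.
Qed.

Lemma weighted_average_complex (s : nat -> R[i]^o) (x y : R) :
  n%:R^-1 * \sum_(k < n) complex.Re (s k) @[n --> \oo] --> x ->
  n%:R^-1 * \sum_(k < n) complex.Im (s k) @[n --> \oo] --> y ->
  (\sum_(k < n) (2 * sin (step_size n * k%:R) ^+ 2 / n%:R)%:C * s k : R[i]^o)
     @[n --> \oo] --> (x +i* y : R[i]^o).
Proof.
move=> hx hy.
have {}hx := weighted_average (s := fun k => complex.Re (s k)) hx.
have {}hy := weighted_average (s := fun k => complex.Im (s k)) hy.
apply: cvgC_ReIm.
  apply: cvg_trans hx; apply: near_eq_cvg; apply: nearW => n.
  rewrite (big_morph (@complex.Re R) (id1 := 0) (op1 := +%R))//; last by case=> ? ? [].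
  by apply: eq_bigr => k _; case: (s k) => p t /=; rewrite mul0r subr0.
apply: cvg_trans hy; apply: near_eq_cvg; apply: nearW => n.
rewrite (big_morph (@complex.Im R) (id1 := 0) (op1 := +%R))//; last by case=> ? ? [].
by apply: eq_bigr => k _; case: (s k) => p t /=; rewrite mul0r addr0.
Qed.

End weighted_average.

(** * Elementary limits and the logarithm along an orbit *)

Section expansions.
Context {R : realType}.
Local Notation C := R[i]^o.

Lemma cvg_invn : (n%:R^-1 : R) @[n --> \oo] --> 0.
Proof. 
apply/cvgrPdist_lt => e e0; near=> n.
have n0 : 0 < n%:R :> R by rewrite ltr0n; near: n; exact: nbhs_infty_gt.
rewrite sub0r normrN ger0_norm ?invr_ge0 ?(ltW n0)// invf_plt ?posrE//.
by near: n; exact: nbhs_infty_gtr.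
Unshelve. all: by end_near. Qed.

Lemma cvg_inv_sqrtn : ((Num.sqrt n%:R)^-1 : R) @[n --> \oo] --> 0.
Proof.
apply/cvgrPdist_lt => e e0; near=> n.
have n0 : 0 < n%:R :> R by rewrite ltr0n; near: n; exact: nbhs_infty_gt.
have s0 : 0 < Num.sqrt n%:R :> R by rewrite sqrtr_gt0.
rewrite sub0r normrN ger0_norm ?invr_ge0 ?(ltW s0)// invf_plt ?posrE//.
rewrite -(ltr_pXn2r (ltn0Sn 1)) ?nnegrE ?invr_ge0 ?(ltW s0) ?(ltW e0)//.
rewrite sqr_sqrtr//.
by near: n; exact: nbhs_infty_gtr.
Unshelve. all: by end_near. Qed.

Lemma cvg_step_size : (step_size n : R) @[n --> \oo] --> 0.
Proof.
rewrite -(mulr0 pi); under eq_fun do rewrite step_sizeE.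
by apply: cvgM; [exact: cvg_cst|exact: cvg_invn].
Qed.

(* The petal is the image of a half-plane under inversion. *)
Lemma inv_repelling_petal (r : R) (z : R[i]) : 0 < r -> 1 < 2 * r * complex.Re z ->
  repelling_petal r (z^-1).
Proof.
move=> r0 hz; rewrite /repelling_petal /= cmod_lt.
have z0 : z != 0.
  by apply/eqP => z0; move: hz; rewrite z0 /= mulr0 ltr10.
have -> : z^-1 - r%:C = (1 - r%:C * z) / z by rewrite mulrBl mul1r mulfK.
rewrite cmodM cmodV ltr_pdivrMr ?cmod_gt0//.
have -> : r * cmod z = cmod (r%:C * z) by rewrite cmodM cmod_real gtr0_norm.
case: z hz {z0} => x y /= hz.
rewrite /cmod /= ltr_sqrt.
  by move: hz; clear; rewrite !expr2; nra.
have x0 : 0 < x by move: hz r0; clear; nra.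
rewrite ltr_wpDr ?sqr_ge0// exprn_gt0//; move: (mulr_gt0 r0 x0); clear; lra.
Qed.

(** Taking out the positive factor 1 / k leaves k / z_k, which tends to 1, where the logarithm is
    continuous. This serves both sides, with z_k = - 1 / p_k at the entrance and z_m = 1 / P_m at
    the exit, so that both logarithms become - ln k + o(1). *)
Lemma log_inv_near (z : nat -> C) (A : R) :
  (\forall k \near \oo, cmod (z k - k%:R) <= A * Num.sqrt k%:R) ->
  (principal_log ((z k)^-1) + (ln k%:R)%:C : C) @[k --> \oo] --> (0 : C).
Proof.
move=> hz; apply/cvgC_lt => e e0; have [d d0 hd] := principal_log_near1 e0.
have hA : A / Num.sqrt k%:R @[k --> \oo] --> 0.
  by rewrite -(mulr0 A); apply: cvgM; [exact: cvg_cst|exact: cvg_inv_sqrtn].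
near=> k.
have k0 : 0 < k%:R :> R by rewrite ltr0n; near: k; exact: nbhs_infty_gt.
have kC : k%:R != 0 :> R[i] by rewrite pnatr_eq0 -lt0n -(ltr0n R).
have s0 : 0 < Num.sqrt k%:R :> R by rewrite sqrtr_gt0.
have kE : k%:R = Num.sqrt k%:R * Num.sqrt k%:R :> R by rewrite -expr2 sqr_sqrtr// ltW.
have hk : cmod (z k - k%:R) <= A * Num.sqrt k%:R by near: k.
have hd2 : A / Num.sqrt k%:R < d / 2.
  near: k; move/cvgrPdist_lt : hA => /(_ (d / 2) ltac:(by rewrite divr_gt0)).
  by apply: filterS => k; rewrite sub0r normrN; apply: le_lt_trans; exact: ler_norm.
have h12 : A / Num.sqrt k%:R < 1 / 2.
  near: k; move/cvgrPdist_lt : hA => /(_ (1 / 2) ltac:(by rewrite divr_gt0)).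
  by apply: filterS => k; rewrite sub0r normrN; apply: le_lt_trans; exact: ler_norm.
have AE : A * Num.sqrt k%:R = A / Num.sqrt k%:R * k%:R.
  transitivity (A / Num.sqrt k%:R * (Num.sqrt k%:R * Num.sqrt k%:R)).
    by rewrite mulrA divfK// gt_eqF.
  by rewrite -kE.
rewrite AE in hk; set t := A / _ in hk hd2 h12.
have ck : cmod (k%:R : R[i]) = k%:R.
  by rewrite -(rmorph_nat (real_complex R)) cmod_real ger0_norm ?ltW.
have cz : k%:R / 2 < cmod (z k).
  have := cmod_ge (lexx (cmod k%:R)) (y := z k) (t := t * k%:R).
  rewrite cmod_distC ck => /(_ hk); move: h12 k0; clear; nra.
have z0 : z k != 0 by apply: cmod_neq0; move: cz k0; clear; lra.
have -> : (z k)^-1 = (k%:R^-1)%:C * (k%:R / z k).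
  by rewrite fmorphV rmorph_nat mulrA mulVf ?mul1r.
rewrite principal_log_scale ?invr_gt0 ?mulf_neq0 ?invr_eq0//.
rewrite lnV ?posrE// rmorphN subr0 addrAC addNr add0r; apply: hd.
have -> : k%:R / z k - 1 = (k%:R - z k) / z k by rewrite mulrBl divff.
rewrite cmodM cmodV ltr_pdivrMr ?cmod_gt0// cmod_distC.
apply: (le_lt_trans hk).
have h1 : t * k%:R < d / 2 * k%:R by rewrite ltr_pM2r.
have h2 : d * (k%:R / 2) < d * cmod (z k) by rewrite ltr_pM2l.
by move: h1 h2; clear; lra.
Unshelve. all: by end_near. Qed.

End expansions.

(** * The unperturbed orbit in the attracting petal *)

Section attracting_side.
Context {R : realType}.
Local Notation C := R[i]^o.

Lemma eventual_valueE (s : nat -> C) (v : C) :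
  (\forall m \near \oo, s m = v) -> eventual_value s = v.
Proof.
move=> h; have h2 : \forall m \near \oo, s m = eventual_value s.
  exact: (@getPex C [set v | \forall m \near \oo, s m = v] (ex_intro _ v h)).
by have [m [<- <-]] := filter_ex (filterI h h2).
Qed.

Lemma cvg_within {I : Type} (F : set_system I) {FF : Filter F} (P : set C)
    (f : C -> C) (p l : C) (x : I -> C) :
  f @ within P (nbhs p) --> l -> x n @[n --> F] --> p ->
  (\forall n \near F, P (x n)) -> f (x n) @[n --> F] --> l.
Proof.
move=> hf hx hP A /hf hA; have hA' : nbhs p [set y | P y -> A (f y)] := hA.
have := hx _ hA'; rewrite /=; change (F [set n | P (x n) -> A (f (x n))] -> F [set n | A (f (x n))]).
by move=> h; apply: filterS2 hP h => n h1; apply.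
Qed.

Lemma petal_neq0 (r : R) (w : C) : 0 < r -> attracting_petal r w -> w != 0.
Proof.
move=> r0; apply: contraPneq => ->; rewrite /attracting_petal /= add0r cmod_lt.
by rewrite cmod_real gtr0_norm// ltxx.
Qed.

Lemma attracting_orbit (U : set C) (q : C -> C) (a : C) (r : R) (phii : C -> C) (w : C) :
  admissible_radius U q r -> attracting_fatou_coordinate q a r phii ->
  parabolic_basin U q r w ->
  exists m0, [/\ forall k, U (iter k q w),
    forall k, (m0 <= k)%N -> attracting_petal r (iter k q w),
    forall k, (m0 <= k)%N ->
      phii (iter k q w) = attracting_extension q phii w + k%:R &
    iter k q w @[k --> \oo] --> (0 : C)].
Proof.
move=> [r0 pU _ pq p0] [_ _ hphi _] [m0 [hU hp]]; exists m0.
have hpet k : (m0 <= k)%N -> attracting_petal r (iter k q w).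
  by move=> /subnK <-; elim: (k - m0)%N => // i IH; rewrite addSn iterS; exact: pq.
have hphik k : (m0 <= k)%N -> phii (iter k q w) = phii (iter m0 q w) + (k - m0)%:R.
  move=> m0k; rewrite -{1}(subnK m0k); elim: (k - m0)%N => [|i IH].
    by rewrite addr0.
  rewrite addSn iterS hphi; first by rewrite IH -[i.+1%:R]natr1 addrA.
  by apply: hpet; rewrite leq_addl.
split => //.
- move=> k; have [km|mk] := ltnP k m0; first exact: hU.
  by apply: pU; exact: hpet.
- suff -> : attracting_extension q phii w = phii (iter m0 q w) - m0%:R.
    by move=> k mk; rewrite hphik// natrB//; ring.
  apply: eventual_valueE; exists m0 => // k /= mk.
  by rewrite hphik// natrB//; ring.
- rewrite -(cvg_shiftn m0) /=.
  by under eq_fun do rewrite iterD; exact: p0.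
Qed.

Lemma ln_le_sqrt (x : R) : 1 <= x -> `|ln x| <= 2 * Num.sqrt x.
Proof.
move=> x1; have x0 : 0 < x by exact: lt_le_trans x1.
rewrite ger0_norm ?ln_ge0// -[in leLHS](sqr_sqrtr (ltW x0)) lnXn ?sqrtr_gt0//.
by rewrite -[leLHS]mulr_natl ler_pM2l// ltW// ln_sublinear// sqrtr_gt0.
Qed.

(** The asymptotics of [phii] determine - 1 / p_k only implicitly, since log(- p_k) depends on p_k.
    With X = 1 / |p_k|, the crude bound of the logarithm by sqrt(X) gives X <= k + B1 + B2 sqrt(X),
    hence X = O(k) and - 1 / p_k = k + O(sqrt(k)); only then can the logarithm be replaced by - ln
    k. *)
Lemma attracting_expansion (U : set C) (q : C -> C) (a : C) (r : R)
    (phii : C -> C) (w : C) :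
  admissible_radius U q r -> attracting_fatou_coordinate q a r phii ->
  parabolic_basin U q r w ->
  (exists2 A : R, 0 <= A & \forall k \near \oo,
     cmod (- (iter k q w)^-1 - k%:R) <= A * Num.sqrt k%:R) /\
  (- (iter k q w)^-1 - k%:R - (1 - a) * (ln k%:R)%:C : C) @[k --> \oo] -->
     attracting_extension q phii w.
Proof.
move=> hr hphi hw; have [m0 [_ hpet hext p0]] := attracting_orbit hr hphi hw.
have [r0 _ _ _ _] := hr; have [_ _ _ hasym] := hphi.
pose p k := iter k q w; pose Phi := attracting_extension q phii w.
have petp : \forall k \near \oo, attracting_petal r (p k) by exists m0.
have asym : (phii (p k) - (- (p k)^-1 + (1 - a) * principal_log (- p k)) : C)
    @[k --> \oo] --> (0 : C).
  exact: (cvg_within hasym p0 petp).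
(* The 1 covers the o(1) of the Fatou coordinate, the 4 the argument (at most pi), and the 2 comes
   from [ln_le_sqrt]. *)
pose B1 := cmod Phi + 1 + cmod (1 - a) * 4; pose B2 := cmod (1 - a) * 2.
have B10 : 0 <= B1 by rewrite /B1 !addr_ge0 ?mulr_ge0 ?cmod_ge0//.
have B20 : 0 <= B2 by rewrite /B2 mulr_ge0 ?cmod_ge0//.
pose A := B1 + B2 * (1 + B1 + B2).
have A0 : 0 <= A.
  by apply: (addr_ge0 B10); apply: (mulr_ge0 B20); exact: addr_ge0 (addr_ge0 ler01 B10) B20.
have hA : \forall k \near \oo, cmod (- (p k)^-1 - k%:R) <= A * Num.sqrt k%:R.
  have asym1 := (cvgC_lt _ _).1 asym 1 ltr01.
  have p1 := (cvgC_lt _ _).1 p0 1 ltr01.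
  near=> k.
  have k1 : 1 <= k%:R :> R by rewrite ler1n; near: k; exact: nbhs_infty_gt.
  have mk : (m0 <= k)%N by near: k; exact: nbhs_infty_ge.
  have pk0 : p k != 0 by apply: (petal_neq0 r0); exact: hpet.
  have h1 : cmod (phii (p k) - (- (p k)^-1 + (1 - a) * principal_log (- p k)) - 0) < 1.
    by near: k; exact: asym1.
  have h2 : cmod (p k - 0) < 1 by near: k; exact: p1.
  rewrite !subr0 in h1 h2.
  have cp0 := cmod_gt0 pk0.
  pose X := (cmod (p k))^-1.
  have X1 : 1 <= X by rewrite /X invf_ge1// ltW.
  have cX : cmod (- (p k)^-1) = X by rewrite cmodN cmodV.
  have hlog : cmod (principal_log (- p k)) <= 2 * Num.sqrt X + 4.
    apply: (le_trans (principal_log_le _)); first by rewrite oppr_eq0.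
    apply: lerD; last by have := pihalf_lt2 R; clear; lra.
    rewrite cmodN -[cmod _]invrK lnV ?posrE ?invr_gt0// normrN.
    exact: ln_le_sqrt.
  have h3 : cmod (- (p k)^-1 - k%:R) <= B1 + B2 * Num.sqrt X.
    have -> : - (p k)^-1 - k%:R = Phi - (1 - a) * principal_log (- p k) -
       (phii (p k) - (- (p k)^-1 + (1 - a) * principal_log (- p k))).
      by rewrite hext// -/Phi; ring.
    apply: (le_trans (cmodB_le (cmodB_le (lexx _) (cmodM_le (lexx _) hlog)) (ltW h1))).
    by rewrite /B1 /B2; clear; lra.
  have s1 : 1 <= Num.sqrt k%:R :> R by rewrite -[leLHS]sqrtr1; exact: ler_wsqrtr.
  have t1 : 1 <= Num.sqrt X by rewrite -[leLHS]sqrtr1; exact: ler_wsqrtr.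
  have ks : k%:R = Num.sqrt k%:R ^+ 2 :> R by rewrite sqr_sqrtr// (le_trans ler01).
  have Xt : X = Num.sqrt X ^+ 2 by rewrite sqr_sqrtr// (le_trans ler01).
  have h4 : X <= k%:R + B1 + B2 * Num.sqrt X.
    have := cmodD_le h3 (lexx (cmod (k%:R : R[i]))); rewrite subrK cX.
    rewrite -(rmorph_nat (real_complex R)) cmod_real ger0_norm//.
    by clear; lra.
  have h5 : Num.sqrt X <= (1 + B1 + B2) * Num.sqrt k%:R.
    rewrite leNgt; apply/negP => hlt; move: h4; rewrite Xt ks; apply/negP.
    rewrite -ltNge !sqrtr_sqr !ger0_norm ?sqrtr_ge0//.
    move: s1 t1 hlt B10 B20; clear.
    move: (Num.sqrt X) (Num.sqrt _) => t s s1 t1 hlt B10 B20.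
    have st : s <= t by move: hlt; nra.
    have g1 : s ^+ 2 <= t * s by rewrite expr2; nra.
    have g2 : B1 <= B1 * (t * s) by rewrite ler_peMr//; nra.
    have g3 : B2 * t <= B2 * (t * s) by rewrite ler_wpM2l//; nra.
    have g4 : t * ((1 + B1 + B2) * s) < t ^+ 2 by rewrite expr2 ltr_pM2l//; lra.
    by move: g1 g2 g3 g4; clear; lra.
  apply: (le_trans h3); rewrite /A.
  have g1 : B1 <= B1 * Num.sqrt k%:R by rewrite ler_peMr.
  have g2 := ler_wpM2l B20 h5.
  by move: g1 g2; clear; lra.
split; first by exists A.
have hA' : \forall k \near \oo, cmod ((fun k => - (p k)^-1) k - k%:R) <= A * Num.sqrt k%:R := hA.
have hlog := log_inv_near hA'.
rewrite (_ : attracting_extension q phii w = Phi - 0 - (1 - a) * 0); last first.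
  by rewrite mulr0 !subr0.
have : (Phi - (phii (p k) - (- (p k)^-1 + (1 - a) * principal_log (- p k)))
   - (1 - a) * (principal_log ((- (p k)^-1)^-1) + (ln k%:R)%:C) : C) @[k --> \oo]
   --> (Phi - 0 - (1 - a) * 0 : C).
  apply: cvgB; first by apply: cvgB; [exact: cvg_cst|exact: asym].
  by apply: cvgM; [exact: cvg_cst|exact: hlog].
apply: cvg_trans; apply: near_eq_cvg; near=> k.
have mk : (m0 <= k)%N by near: k; exact: nbhs_infty_ge.
rewrite hext// -/Phi invrN invrK.
by rewrite /p; ring.
Unshelve. all: by end_near. Qed.

End attracting_side.

(** * The perturbed orbit for a fixed sequence s, from entrance to exit *)

Section perturbed_orbit.
Context {R : realType}.
Local Notation C := R[i]^o.
Variables (U : set C) (q : C -> C) (a : C) (K1 rho M : R).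
Hypotheses (hq : holomorphic_on U q) (K10 : 0 <= K1) (rho0 : 0 < rho).
Hypothesis hrho : forall w : C, cmod w < rho ->
  U w /\ cmod (q w - (w + w ^+ 2 + a * w ^+ 3)) <= K1 * cmod w ^+ 4.
Variables (s : nat -> C) (u : C).
Hypotheses (M0 : 0 <= M) (hs : forall k, cmod (s k) <= M).
Hypothesis havg :
  (\sum_(k < n) (2 * sin (step_size n * k%:R) ^+ 2 / n%:R)%:C * s k : C)
    @[n --> \oo] --> u.
Variables (E : nat -> nat -> C) (b : nat -> R).
Hypothesis hb : b n @[n --> \oo] --> 0.
Hypothesis hE : \forall n \near \oo, forall k,
  cmod (E n k - ((step_size n)%:C ^+ 2 + (2 * step_size n ^+ 2 / n%:R)%:C * s k))
    <= b n * step_size n ^+ 2 / n%:R.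
Variables (w : C) (x : nat -> nat -> C).
Hypotheses (hUw : forall k, U (iter k q w)).
Hypotheses (x0 : forall n, x n 0%N = w) (xS : forall n k, x n k.+1 = q (x n k) + E n k).

Let kap n k : C := E n k - (step_size n)%:C ^+ 2.

Lemma perturbation_le : \forall n \near \oo, forall k,
  cmod (kap n k) <= (2 * M + 1) * step_size n ^+ 3.
Proof.
near=> n => k.
have n0 : (0 < n)%N by near: n; exact: nbhs_infty_gt.
have n0' : 0 < n%:R :> R by rewrite ltr0n.
have b1 : b n <= 1.
  near: n; move/cvgrPdist_le : hb => /(_ 1 ltr01); apply: filterS => n.
  by rewrite sub0r normrN; exact: le_trans (ler_norm _).
have h : cmod (E n k - ((step_size n)%:C ^+ 2 + (2 * step_size n ^+ 2 / n%:R)%:C * s k))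
    <= b n * step_size n ^+ 2 / n%:R.
  by move: k; near: n; exact: hE.
have e0 := step_size_gt0 (R := R) n0.
have ninv : n%:R^-1 <= step_size n :> R.
  rewrite step_sizeE -[leLHS]mul1r ler_pM2r ?invr_gt0//.
  by rewrite (le_trans _ (pi_ge2 R))// ler1n.
have -> : kap n k = (E n k - ((step_size n)%:C ^+ 2 + (2 * step_size n ^+ 2 / n%:R)%:C * s k)) +
   (2 * step_size n ^+ 2 / n%:R)%:C * s k by rewrite /kap; ring.
have h2 : cmod ((2 * step_size n ^+ 2 / n%:R)%:C * s k) <= 2 * step_size n ^+ 2 / n%:R * M.
  apply: cmodM_le => //; rewrite cmod_real ger0_norm// divr_ge0// mulr_ge0//.
  by rewrite sqr_ge0.
apply: (le_trans (cmodD_le h h2)).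
have -> : b n * step_size n ^+ 2 / n%:R + 2 * step_size n ^+ 2 / n%:R * M =
  (b n + 2 * M) * (step_size n ^+ 2 * n%:R^-1) by ring.
have g1 : step_size n ^+ 2 * n%:R^-1 <= step_size n ^+ 3 :> R.
  by rewrite [leRHS]exprSr ler_wpM2l// sqr_ge0.
have g0 : 0 <= step_size n ^+ 2 * n%:R^-1 :> R by rewrite mulr_ge0 ?sqr_ge0// invr_ge0 ltW.
apply: (@le_trans _ _ ((2 * M + 1) * (step_size n ^+ 2 * n%:R^-1))).
  by rewrite ler_wpM2r//; move: b1; lra.
by rewrite ler_wpM2l//; move: M0; lra.
Unshelve. all: by end_near. Qed.

Lemma cvg_perturbation0 (k : nat -> nat) : E n (k n) @[n --> \oo] --> (0 : C).
Proof.
apply: (@cvgC_squeeze _ _ \oo _ _ _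
  (fun n => (2 * M + 1) * step_size n ^+ 3 + step_size n ^+ 2)).
  have := perturbation_le; apply: filterS => n h; rewrite subr0.
  have -> : E n (k n) = kap n (k n) + (step_size n)%:C ^+ 2 by rewrite /kap subrK.
  apply: cmodD_le; first exact: h.
  by rewrite cmodX cmod_real real_normK ?num_real.
have h := cvg_step_size (R := R).
rewrite (_ : 0 = (2 * M + 1) * (0 * (0 * 0)) + 0 * 0 :> R); last by rewrite !mulr0 addr0.
have h2 : step_size n ^+ 2 @[n --> \oo] --> (0 * 0 : R).
  by under eq_fun do rewrite expr2; apply: cvgM.
apply: cvgD => //; apply: cvgM; first exact: cvg_cst.
by under eq_fun do rewrite exprS; apply: cvgM.
Qed.

Lemma orbit_start k : x n k @[n --> \oo] --> (iter k q w : C).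
Proof.
elim: k => [|k IH]; first by under eq_fun do rewrite x0; exact: cvg_cst.
rewrite iterS -[q _]addr0; under eq_fun do rewrite xS.
apply: cvgD; last exact: (cvg_perturbation0 (fun=> k)).
exact: (cvg_holomorphic hq (hUw k) IH).
Qed.

Lemma cvg_cot_orbit K : (0 < K)%N ->
  ((cot_orbit n K)%:C : C) @[n --> \oo] --> (- K%:R^-1 : C).
Proof.
move=> K0; have K0' : 0 < K%:R :> R by rewrite ltr0n.
have -> : - K%:R^-1 = (- K%:R^-1 : R)%:C :> R[i] by rewrite rmorphN fmorphV rmorph_nat.
apply: cvgC_real; apply/cvgrPdist_le => e e0.
have h : step_size n * K%:R @[n --> \oo] --> (0 : R).
  by rewrite -(mul0r K%:R); apply: cvgM; [exact: cvg_step_size|exact: cvg_cst].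
near=> n.
have h1 : step_size n * K%:R <= Num.min 1 e.
  near: n; move/cvgrPdist_le : h => /(_ (Num.min 1 e)).
  rewrite lt_min ltr01 e0 => /(_ isT); apply: filterS => n.
  by rewrite sub0r normrN; exact: le_trans (ler_norm _).
have nK : (0 < K < n)%N by rewrite K0; near: n; exact: nbhs_infty_gt.
have e1 : 0 < step_size n :> R by rewrite step_size_gt0//; lia.
move: h1; rewrite le_min => /andP[h1 h2].
rewrite -opprD normrN addrC.
apply: (le_trans (cot_orbit_near nK h1)); apply: le_trans h2.
rewrite expr2 -mulrA ler_piMl// ?(mulr_ge0 (ltW e1) (ltW K0'))//.
rewrite (le_trans _ h1)// ler_peMr ?(ltW e1)// ler1n//.
Unshelve. all: by end_near. Qed.

Lemma cvg_step_size_sqr : ((step_size n)%:C ^+ 2 : C) @[n --> \oo] --> (0 : C).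
Proof.
have h : ((step_size n)%:C : C) @[n --> \oo] --> (0%:C : C).
  by apply: cvgC_real; exact: cvg_step_size.
by rewrite -(mul0r 0); under eq_fun do rewrite expr2; apply: cvgM.
Qed.

(** For fixed K the model point tends to - 1 / K and e to 0, so the coordinate tends to (p + 1 / K)
    / (- p / K) = - 1 / p - K. *)
Lemma cvg_shift_start K : (0 < K)%N -> iter K q w != 0 ->
  (fatou_shift n K (x n K) : C) @[n --> \oo] --> (- (iter K q w)^-1 - K%:R : C) /\
  \forall n \near \oo, shift_rel n K (x n K).
Proof.
move=> K0 p0; set p := iter K q w.
have KC : K%:R != 0 :> C by rewrite pnatr_eq0 -lt0n.
have hx : x n K @[n --> \oo] --> (p : C) by exact: orbit_start.
have hW := cvg_cot_orbit K0.
have he : ((step_size n)%:C ^+ 2 : C) @[n --> \oo] --> (0 : C).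
  exact: cvg_step_size_sqr.
have hden : ((step_size n)%:C ^+ 2 + x n K * (cot_orbit n K)%:C : C) @[n --> \oo] -->
    (0 + p * - K%:R^-1 : C) by apply: cvgD; [exact: he|exact: (cvgM hx hW)].
have d0 : 0 + p * - K%:R^-1 != 0 :> C.
  by rewrite add0r mulf_neq0// oppr_eq0 invr_eq0.
split.
  rewrite (_ : - p^-1 - K%:R = (p - - K%:R^-1) / (0 + p * - K%:R^-1)); last first.
    by rewrite add0r; field; rewrite p0 KC.
  exact: cvgM (cvgB hx hW) (cvgV d0 hden).
apply: filterS (near_cvgC_neq0 d0 hden) => n h; rewrite /shift_rel /moebius_rel.
have : fatou_shift n K (x n K) * ((step_size n)%:C ^+ 2 + x n K * (cot_orbit n K)%:C) =
   x n K - (cot_orbit n K)%:C by rewrite /fatou_shift /moebius divfK.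
by move=> hY; apply: (eq_subr_eq (esym hY)); ring.
Qed.

(** Division by (e / sin(e j))^2 turns 2 e^2 s_j / n into the terms of [havg]. The K terms missing
    at each end cost at most 4 K M / n altogether, and the remainder of the perturbation at most |b
    n|. *)
Lemma cvg_weighted_tail K : (0 < K)%N ->
  (\sum_(K <= j < n - K) kap n j / (sin_gap n j ^+ 2)%:C : C) @[n --> \oo] --> u.
Proof.
move=> K0; pose wt n k : C := (2 * sin (step_size n * k%:R) ^+ 2 / n%:R)%:C * s k.
have hd : (\sum_(K <= j < n - K) kap n j / (sin_gap n j ^+ 2)%:C - \sum_(k < n) wt n k : C)
    @[n --> \oo] --> (0 : C).
  have hg : `|b n| + 4 * K%:R * M * n%:R^-1 @[n --> \oo] --> (`|0 : R| + 4 * K%:R * M * 0 : R).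
    have h1 : `|b n| @[n --> \oo] --> `|0 : R| by exact: (cvg_norm hb).
    have h2 : 4 * K%:R * M * n%:R^-1 @[n --> \oo] --> (4 * K%:R * M * 0 : R).
      by apply: cvgM; [exact: cvg_cst|exact: cvg_invn].
    exact: (cvgD h1 h2).
  rewrite normr0 mulr0 addr0 in hg; apply: (cvgC_squeeze _ hg).
  near=> n.
  have nK : (K.*2 < n)%N by near: n; exact: nbhs_infty_gt.
  have n0 : 0 < n%:R :> R by rewrite ltr0n; lia_nat.
  have h k : cmod (E n k - ((step_size n)%:C ^+ 2 + (2 * step_size n ^+ 2 / n%:R)%:C * s k))
    <= b n * step_size n ^+ 2 / n%:R.
    by move: k; near: n; exact: hE.
  have wtM k : cmod (wt n k) <= 2 * M / n%:R.
    rewrite mulrAC; apply: cmodM_le => //.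
    have w0 : 0 <= 2 * sin (step_size n * k%:R) ^+ 2 / n%:R :> R.
      by apply: divr_ge0 => //; rewrite pmulr_rge0// sqr_ge0.
    rewrite cmod_real (ger0_norm w0) ler_pM2r ?invr_gt0// -[leRHS]mulr1 ler_pM2l//.
  rewrite subr0 -(big_mkord xpredT (wt n)).
  rewrite [X in _ - X](@big_cat_nat _ _ _ K)//=; last by lia_nat.
  rewrite [X in _ - (_ + X)](@big_cat_nat _ _ _ (n - K))//=; [|lia_nat|lia_nat].
  set s1 := \sum_(0 <= i < K) _; set s3 := \sum_(n - K <= i < n) _.
  rewrite (_ : _ - _ = \sum_(K <= j < n - K) (kap n j / (sin_gap n j ^+ 2)%:C - wt n j)
     - (s1 + s3)); last by rewrite sumrB; ring.
  apply: cmodB_le.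
    apply: (@le_trans _ _ (\sum_(K <= j < n - K) (`|b n| / n%:R))).
      apply: cmod_sum => j hj; have jn : (0 < j < n)%N by lia_nat.
      have v0 := sin_gap_gt0 (R := R) jn.
      have e0 := step_size_gt0 (R := R) (n := n) ltac:(lia_nat).
      have ev := step_size_le_gap (R := R) jn.
      have vC : (sin_gap n j ^+ 2)%:C != 0 :> R[i].
        by rewrite fmorph_eq0 gt_eqF// exprn_gt0.
      have wtE : wt n j = (2 * step_size n ^+ 2 / n%:R)%:C * s j / (sin_gap n j ^+ 2)%:C.
        rewrite mulrAC -fmorphV -rmorphM /wt; congr (_%:C * _).
        have s0 := sin_step_gt0 (R := R) jn.
        rewrite /sin_gap; move: (step_size n) (sin _) (n%:R) e0 s0 n0 => e z t e0 z0 t0.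
        by field; rewrite !gt_eqF.
      rewrite wtE -mulrBl.
      rewrite (_ : `|b n| / n%:R = `|b n| * step_size n ^+ 2 / n%:R / step_size n ^+ 2); last first.
        by move: (step_size n) n%:R e0 n0 => e t e0 t0; field; rewrite !gt_eqF.
      apply: cmod_div_le; first exact: exprn_gt0.
        rewrite /kap -addrA -opprD; apply: (le_trans (h j)).
        by rewrite !ler_pM2r ?invr_gt0 ?exprn_gt0// ler_norm.
      rewrite cmod_real ger0_norm ?sqr_ge0//.
      by rewrite lerXn2r ?nnegrE ?(ltW e0) ?(ltW v0).
    rewrite sumr_const_nat -[leLHS]mulr_natr mulrAC ler_pdivrMr// ler_wpM2l//.
    by rewrite ler_nat; lia_nat.
  have hs1 : cmod s1 <= \sum_(0 <= j < K) (2 * M / n%:R) by exact: cmod_sum.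
  have hs3 : cmod s3 <= \sum_(n - K <= j < n) (2 * M / n%:R) by exact: cmod_sum.
  apply: (le_trans (cmodD_le hs1 hs3)).
  rewrite !sumr_const_nat subn0 (_ : (n - (n - K) = K)%N); last by lia_nat.
  by rewrite -[_ *+ K]mulr_natr; lra.
rewrite -[u]add0r; apply: cvg_trans (cvgD hd havg).
by apply: near_eq_cvg; apply: nearW => n /=; rewrite subrK.
Unshelve. all: by end_near. Qed.

Variable A0 : R.
Hypotheses (A00 : 0 <= A0) (hA0 : \forall k \near \oo,
  cmod (- (iter k q w)^-1 - k%:R) <= A0 * Num.sqrt k%:R).
Hypothesis p_neq0 : \forall k \near \oo, iter k q w != 0.

Lemma transit_orbit : exists A B : R, \forall K \near \oo, \forall n \near \oo,
  forall k, (K <= k <= n - K)%N ->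
  [/\ U (x n k), shift_rel n k (x n k),
   cmod (fatou_shift n k (x n k)) <= A * Num.sqrt (minn k (n - k))%:R &
   cmod (fatou_shift n k (x n k) - fatou_shift n K (x n K)
      - \sum_(K <= j < k) (odd_term a n j + kap n j / (sin_gap n j ^+ 2)%:C))
    <= B / Num.sqrt K%:R].
Proof.
have M20 : 0 <= 2 * M + 1 by rewrite addr_ge0// mulr_ge0.
(* [A0] concerns the unperturbed orbit; the extra 1 covers the perturbed point at time K, for n
   large after K is fixed. *)
have A10 : 0 <= A0 + 1 by rewrite addr_ge0.
have [A [B [K0 K00 tr]]] := transit a K10 M20 rho0 A10.
exists A, B; near=> K.
have KK0 : (K0 <= K)%N by near: K; exact: nbhs_infty_ge.
have Kpos : (0 < K)%N by exact: leq_trans KK0.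
have pK0 : iter K q w != 0 by near: K.
have hA0K : cmod (- (iter K q w)^-1 - K%:R) <= A0 * Num.sqrt K%:R by near: K.
have [hY hrel] := cvg_shift_start Kpos pK0.
have hY1 := (cvgC_lt _ _).1 hY 1 ltr01.
near=> n => k hk.
have nK : (K.*2 < n)%N by near: n; exact: nbhs_infty_gt.
have kapn : forall k, cmod (kap n k) <= (2 * M + 1) * step_size n ^+ 3.
  by near: n; exact: perturbation_le.
have reln : shift_rel n K (x n K) by near: n.
have Yn : cmod (fatou_shift n K (x n K)) <= (A0 + 1) * Num.sqrt K%:R.
  have h1 : cmod (fatou_shift n K (x n K) - (- (iter K q w)^-1 - K%:R)) < 1.
    by near: n; exact: hY1.
  have := cmodD_le (ltW h1) hA0K; rewrite subrK => /le_trans; apply.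
  rewrite mulrDl mul1r addrC lerD2l -[leLHS]sqrtr1 ler_wsqrtr// ler1n.
  exact: Kpos.
have [] := tr K n q (x n) (kap n) KK0 nK _ _ _ reln Yn k hk.
- by move=> z /hrho[].
- by move=> j _; rewrite xS /kap -addrA [X in _ = _ + X]addrC subrK.
- by move=> j _; exact: kapn.
by move=> _ /hrho[? _] ? ? ?; split.
Unshelve. all: by end_near. Qed.

Variable F : set_system nat.
Hypotheses (FU : UltraFilter F) (FF : ProperFilter F) (ooF : \oo `<=` F).

Let cvgF (f : nat -> C) (l : C) : f n @[n --> \oo] --> l -> f n @[n --> F] --> l.
Proof. by move=> h B /h; exact: ooF. Qed.

(** The coordinate at time n - m is bounded, so it has a limit [y] along [F]. The model point there
    tends to 1 / m, and the Moebius relation with eps = 0 yields the limit point 1 / (m - y), whose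
    denominator is nonzero because A sqrt(m) < m. *)
Lemma orbit_exit : exists A B : R, \forall m \near \oo, exists y : C,
  [/\ x n (n - m)%N @[n --> F] --> ((m%:R - y)^-1 : C),
   cmod y <= A * Num.sqrt m%:R &
   cmod (y - (- (iter m q w)^-1 - m%:R) - u) <= B / Num.sqrt m%:R].
Proof.
have [A [B tr]] := transit_orbit.
exists A, (B + (1 + cmod a) * 4); near=> m.
have m0 : (0 < m)%N by near: m; exact: nbhs_infty_gt.
have pm0 : iter m q w != 0 by near: m.
have trm : \forall n \near \oo, forall k, (m <= k <= n - m)%N ->
  [/\ U (x n k), shift_rel n k (x n k),
   cmod (fatou_shift n k (x n k)) <= A * Num.sqrt (minn k (n - k))%:R &
   cmod (fatou_shift n k (x n k) - fatou_shift n m (x n m)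
      - \sum_(m <= j < k) (odd_term a n j + kap n j / (sin_gap n j ^+ 2)%:C))
    <= B / Num.sqrt m%:R] by near: m.
have mA : A / Num.sqrt m%:R < 1.
  near: m; have h : A / Num.sqrt k%:R @[k --> \oo] --> 0.
    by rewrite -(mulr0 A); apply: cvgM; [exact: cvg_cst|exact: cvg_inv_sqrtn].
  move/cvgrPdist_lt : h => /(_ 1 ltr01); apply: filterS => k.
  by rewrite sub0r normrN; exact: le_lt_trans (ler_norm _).
have m0' : 0 < m%:R :> R by rewrite ltr0n.
have s0 : 0 < Num.sqrt m%:R :> R by rewrite sqrtr_gt0.
have mE : m%:R = Num.sqrt m%:R * Num.sqrt m%:R :> R by rewrite -expr2 sqr_sqrtr// ltW.
pose Y n : C := fatou_shift n (n - m) (x n (n - m)%N).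
have at_exit : \forall n \near \oo, [/\ (m.*2 < n)%N, shift_rel n (n - m) (x n (n - m)%N),
    cmod (Y n) <= A * Num.sqrt m%:R &
    cmod (Y n - fatou_shift n m (x n m)
      - \sum_(m <= j < n - m) kap n j / (sin_gap n j ^+ 2)%:C)
    <= (B + (1 + cmod a) * 4) / Num.sqrt m%:R].
  near=> n.
  have nm : (m.*2 < n)%N by near: n; exact: nbhs_infty_gt.
  have trn : forall k, (m <= k <= n - m)%N ->
  [/\ U (x n k), shift_rel n k (x n k),
   cmod (fatou_shift n k (x n k)) <= A * Num.sqrt (minn k (n - k))%:R &
   cmod (fatou_shift n k (x n k) - fatou_shift n m (x n m)
      - \sum_(m <= j < k) (odd_term a n j + kap n j / (sin_gap n j ^+ 2)%:C))
    <= B / Num.sqrt m%:R] by near: n.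
  have [_ h1 h2 h3] := trn (n - m)%N ltac:(lia_nat).
  split => //; first by move: h2; rewrite (_ : minn _ _ = m)//; lia_nat.
  rewrite big_split /= in h3.
  (* The range excludes n - m, so the term j = m has no partner; it is of order 1 / m and goes into
     the error. *)
  have odd0 : \sum_(m <= j < n - m) odd_term a n j = odd_term a n m.
    rewrite (@odd_sum _ _ n m)//; [|by move=> z /esym/eqP; rewrite eqNr => /eqP
      |by move=> j jn; apply: odd_term_rev => //; lia_nat|lia_nat].
    by rewrite (_ : (n - (n - m)).+1 = m.+1) ?big_nat1//; lia_nat.
  rewrite odd0 in h3.
  have h4 : cmod (odd_term a n m) <= (1 + cmod a) * (4 / Num.sqrt m%:R).
    apply: (le_trans (odd_term_le a _)); first by lia_nat.
    rewrite ler_wpM2l ?addr_ge0 ?cmod_ge0//.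
    apply: (le_trans (sin_gap_half (R := R) (n := n) m0 _)); first by lia_nat.
    rewrite ler_pM2l// lef_pV2 ?posrE// [leRHS]mE ler_peMr ?(ltW s0)//.
    by rewrite -[leLHS]sqrtr1 ler_wsqrtr// ler1n.
  rewrite [leRHS]mulrDl -[X in _ <= _ + X]mulrA; apply: le_trans (cmodD_le h3 h4).
  rewrite le_eqVlt; apply/orP; left; apply/eqP; congr cmod.
  by rewrite /Y; ring.
have [y hy] : exists y : C, Y n @[n --> F] --> y.
  apply: (@cvgC_ultra_bounded _ _ F FU Y (A * Num.sqrt m%:R)).
  by apply: ooF; apply: filterS at_exit => n [].
exists y.
have y_le : cmod y <= A * Num.sqrt m%:R.
  apply: (@cmod_cvg_le _ _ F _ Y y (fun=> A * Num.sqrt m%:R)) => //.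
    exact: cvg_cst.
  by apply: ooF; apply: filterS at_exit => n [].
have mC : m%:R != 0 :> C by rewrite pnatr_eq0 -lt0n.
have cm : cmod (m%:R : C) = m%:R.
  by rewrite -(rmorph_nat (real_complex R)) cmod_real ger0_norm ?ltW.
have my : cmod y < m%:R.
  apply: (le_lt_trans y_le); rewrite [ltRHS]mE ltr_pM2r//.
  by move: mA; rewrite ltr_pdivrMr// mul1r.
have den0 : 1 - m%:R^-1 * y != 0.
  apply/eqP => /eqP; rewrite subr_eq0 => /eqP e; move: my.
  have -> : y = m%:R by rewrite -[LHS](mulVKf mC) -e mulr1.
  by rewrite cm ltxx.
have hW : ((cot_orbit n (n - m))%:C : C) @[n --> F] --> (m%:R^-1 : C).
  rewrite -[m%:R^-1]opprK; apply: cvgF.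
  apply: cvg_trans (cvgN (cvg_cot_orbit m0)); apply: near_eq_cvg.
  near=> n.
  have mn : (m < n)%N by near: n; exact: nbhs_infty_gt.
  have n0 : (0 < n)%N by exact: leq_ltn_trans mn.
  by rewrite (cot_orbit_rev n0 (ltnW mn)) rmorphN.
have he : ((step_size n)%:C ^+ 2 : C) @[n --> F] --> (0 : C).
  exact: (@cvgF (fun n => (step_size n)%:C ^+ 2) 0 cvg_step_size_sqr).
split; [|exact: y_le|].
  have -> : (m%:R - y)^-1 = (m%:R^-1 + 0 * y) / (1 - m%:R^-1 * y).
    rewrite mul0r addr0 -invfM; congr (_^-1).
    by rewrite mulrBr mulr1 mulrA mulfV// mul1r.
  have hl : ((cot_orbit n (n - m))%:C + (step_size n)%:C ^+ 2 * Y n) /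
      (1 - (cot_orbit n (n - m))%:C * Y n) @[n --> F] -->
      ((m%:R^-1 + 0 * y) / (1 - m%:R^-1 * y) : C).
    apply: cvgM; first exact: cvgD hW (cvgM he hy).
    exact: cvgV den0 (cvgB (cvg_cst _) (cvgM hW hy)).
  move: hl; apply: cvg_trans; apply: near_eq_cvg.
  have hden : (1 - (cot_orbit n (n - m))%:C * Y n : C) @[n --> F] -->
      (1 - m%:R^-1 * y : C) by exact: cvgB (cvg_cst _) (cvgM hW hy).
  have hden0 : F [set n | 1 - (cot_orbit n (n - m))%:C * Y n != 0].
    exact: near_cvgC_neq0 den0 hden.
  apply: filterS2 hden0 (ooF at_exit) => n dn [_ rel _ _].
  by rewrite -rel mulfK.
apply: (@cmod_cvg_le _ _ F _ (fun n => Y n - fatou_shift n m (x n m)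
      - \sum_(m <= j < n - m) kap n j / (sin_gap n j ^+ 2)%:C) _
   (fun=> (B + (1 + cmod a) * 4) / Num.sqrt m%:R)).
- have h1 : (fatou_shift n m (x n m) : C) @[n --> F] --> (- (iter m q w)^-1 - m%:R : C).
    exact: (@cvgF (fun n => fatou_shift n m (x n m)) _ (cvg_shift_start m0 pm0).1).
  have h2 : (\sum_(m <= j < n - m) kap n j / (sin_gap n j ^+ 2)%:C : C) @[n --> F] --> u.
    apply: (@cvgF (fun n => \sum_(m <= j < n - m) kap n j / (sin_gap n j ^+ 2)%:C) u).
    exact: cvg_weighted_tail.
  exact: (cvgB (cvgB hy h1) h2).
- exact: cvg_cst.
- by apply: ooF; apply: filterS at_exit => n [].
Unshelve. all: by end_near. Qed.

End perturbed_orbit.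

(** * Identification of the limit with the Lavaurs map *)

Section implosion.
Context {R : realType}.
Local Notation C := R[i]^o.

Lemma near_all_lt {I : Type} (F : set_system I) {FF : Filter F} (P : I -> nat -> Prop) j :
  (forall i, (i < j)%N -> \forall n \near F, P n i) ->
  \forall n \near F, forall i, (i < j)%N -> P n i.
Proof.
elim: j => [|j IH] h; first by apply: filterE.
have h1 := IH (fun i ij => h i (ltnW ij)); have h2 := h j (ltnSn j).
apply: filterS2 h1 h2 => n h1 h2 i; rewrite ltnS leq_eqVlt => /predU1P[->//|].
exact: h1.
Qed.

Lemma near_choice (P : nat -> C -> Prop) : (\forall m \near \oo, exists y, P m y) ->
  exists y : nat -> C, \forall m \near \oo, P m (y m).
Proof.
move=> h; have /choice[y hy] : forall m, exists y, (exists y', P m y') -> P m y.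
  move=> m; have [[y Py]|nP] := pselect (exists y, P m y); first by exists y.
  by exists 0 => /nP.
by exists y; apply: filterS h => m; exact: hy.
Qed.

Lemma germ_bound (U : set C) (q : C -> C) (a : C) : open U -> U 0 ->
  (exists K : R, \forall w \near (0 : C),
     `|q w - (w + w ^+ 2 + a * w ^+ 3)| <= K%:C * `|w| ^+ 4) ->
  exists2 K1 : R, 0 <= K1 & exists2 rho : R, 0 < rho & forall w : C, cmod w < rho ->
    U w /\ cmod (q w - (w + w ^+ 2 + a * w ^+ 3)) <= K1 * cmod w ^+ 4.
Proof.
move=> hU hU0 [K hK]; exists `|K| => //.
have hU' : \forall w \near (0 : C), U w by exact: open_nbhs_nbhs.
have [rho rho0 h] := (nbhs_cmodP 0 _).1 (filterI hU' hK).
exists rho => // w hw; have [] := h w; first by rewrite subr0.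
move=> Uw; rewrite cmodE -rmorphXn -rmorphM /= cmod_le => hw4; split => //.
by apply: (le_trans hw4); rewrite ler_wpM2r ?exprn_ge0 ?cmod_ge0// ler_norm.
Qed.

Section ultrafilter.
Variables (U : set C) (q : C -> C) (a : C).
Hypotheses (hU : open U) (hq : holomorphic_on U q).
Variables (r : R) (phio : C -> C).
Hypotheses (r0 : 0 < r) (petalU : repelling_petal r `<=` U).
Hypothesis hphio : repelling_fatou_coordinate q a r phio.
Hypothesis hext : repelling_extension_defined U q r phio.
Variables (E : nat -> nat -> C) (x : nat -> nat -> C) (L : nat -> C) (zeta : C).
Hypothesis E0 : forall k : nat -> nat, E n (k n) @[n --> \oo] --> (0 : C).
Hypothesis xS : forall n k, x n k.+1 = q (x n k) + E n k.
Hypothesis hL : (L k - k%:R - (1 - a) * (ln k%:R)%:C : C) @[k --> \oo] --> zeta.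
Variable F : set_system nat.
Hypotheses (FF : ProperFilter F) (ooF : \oo `<=` F).
Variables (A B : R) (y : nat -> C).
Hypothesis hy : \forall m \near \oo,
  [/\ x n (n - m)%N @[n --> F] --> ((m%:R - y m)^-1 : C),
   cmod (y m) <= A * Num.sqrt m%:R &
   cmod (y m - (L m - m%:R)) <= B / Num.sqrt m%:R].

Let P m : C := (m%:R - y m)^-1.

Let exit_large : \forall m \near \oo, m%:R / 2 <= complex.Re (m%:R - y m).
Proof.
have h : A / Num.sqrt k%:R @[k --> \oo] --> 0.
  by rewrite -(mulr0 A); apply: cvgM; [exact: cvg_cst|exact: cvg_inv_sqrtn].
near=> m.
have m0 : (0 < m)%N by near: m; exact: nbhs_infty_gt.
have m0' : 0 < m%:R :> R by rewrite ltr0n.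
have s0 : 0 < Num.sqrt m%:R :> R by rewrite sqrtr_gt0.
have mA : A / Num.sqrt m%:R < 1 / 2.
  near: m; move/cvgrPdist_lt : h => /(_ (1 / 2) ltac:(by rewrite divr_gt0)).
  by apply: filterS => k; rewrite sub0r normrN; exact: le_lt_trans (ler_norm _).
have ym : cmod (y m) <= A * Num.sqrt m%:R by near: m; apply: filterS hy => m [].
have AE : A * Num.sqrt m%:R = A / Num.sqrt m%:R * m%:R.
  transitivity (A / Num.sqrt m%:R * (Num.sqrt m%:R * Num.sqrt m%:R)).
    by rewrite mulrA divfK// gt_eqF.
  by rewrite -expr2 sqr_sqrtr// ltW.
have yR : complex.Re (y m) <= m%:R / 2.
  apply: (le_trans (ler_norm _)); apply: (le_trans (Re_le_cmod _)).
  apply: (le_trans ym); rewrite AE mulrC ler_pM2l//.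
  by move: mA; rewrite div1r => /ltW.
have -> : complex.Re (m%:R - y m) = m%:R - complex.Re (y m).
  by rewrite -(rmorph_nat (real_complex R)); case: (y m).
by move: yR; lra.
Unshelve. all: by end_near. Qed.

Let exit_petal : \forall m \near \oo, repelling_petal r (P m).
Proof.
near=> m; apply: inv_repelling_petal => //.
have h : m%:R / 2 <= complex.Re (m%:R - y m) by near: m; exact: exit_large.
have h2 : r^-1 < m%:R by near: m; exact: nbhs_infty_gtr.
apply: (@lt_le_trans _ _ (2 * r * (m%:R / 2))).
  by move: h2; rewrite -div1r ltr_pdivrMr//; lra.
by rewrite ler_wpM2l// mulr_ge0// ltW.
Unshelve. all: by end_near. Qed.

Let exit_cvg0 : P m @[m --> \oo] --> (0 : C).
Proof.
have h : 2 * n%:R^-1 @[n --> \oo] --> (2 * 0 : R).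
  by apply: cvgM; [exact: cvg_cst|exact: cvg_invn].
rewrite mulr0 in h; apply: (cvgC_squeeze _ h).
near=> m.
have m0 : 0 < m%:R :> R by rewrite ltr0n; near: m; exact: nbhs_infty_gt.
have hm : m%:R / 2 <= complex.Re (m%:R - y m) by near: m; exact: exit_large.
rewrite subr0 /P cmodV -[leRHS]invrK lef_pV2 ?posrE.
- rewrite invfM invrK mulrC; apply: (le_trans hm); apply: (le_trans (ler_norm _)).
  exact: Re_le_cmod.
- by apply: lt_le_trans (Re_le_cmod _); rewrite normr_gt0 gt_eqF// (lt_le_trans _ hm)// divr_gt0.
- by rewrite invr_gt0 mulr_gt0// invr_gt0.
Unshelve. all: by end_near. Qed.

Let step_cvg (k : nat -> nat) (p : C) : U p -> x n (k n) @[n --> F] --> p ->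
  x n (k n).+1 @[n --> F] --> q p.
Proof.
move=> Up hx; rewrite -[q p]addr0; under eq_fun do rewrite xS.
have h0 : E n (k n) @[n --> F] --> (0 : C).
  by move=> V /(E0 k); exact: ooF.
exact: cvgD (cvg_holomorphic hq Up hx) h0.
Qed.

(** Time n - (m + 1) is one step before time n - m and the perturbation tends to 0, so both sides
    are limits of the same sequence. *)
Let exit_step : \forall m \near \oo, q (P m.+1) = P m.
Proof.
have [N1 _ hN1] := hy; have [N2 _ hN2] := exit_petal.
exists (maxn N1 N2) => // m; rewrite /= geq_max => /andP[m1 m2].
have [h1 _ _] := hN1 _ m1; have [h2 _ _] := hN1 _ (leqW m1).
have hU1 : U (P m.+1) by apply: petalU; exact: hN2 (leqW m2).
have h3 : x n (n - m)%N @[n --> F] --> q (P m.+1).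
  apply: cvg_trans (step_cvg hU1 h2); apply: near_eq_cvg; apply: ooF.
  by exists m.+1 => // n /= mn; rewrite -subSn.
exact: (cvg_unique _ h3 h1).
Qed.

(** Here - 1 / P_m = y_m - m and log P_m = - ln m + o(1). The correction (1 - a) ln m is the one
    subtracted in [hL] on the attracting side, so the two logarithms cancel. *)
Let exit_limit : (phio (P m) + m%:R : C) @[m --> \oo] --> zeta.
Proof.
have [_ _ _ hasym] := hphio.
have asym : (phio (P m) - (- (P m)^-1 + (1 - a) * principal_log (P m)) : C)
    @[m --> \oo] --> (0 : C).
  exact: (cvg_within hasym exit_cvg0 exit_petal).
have hlog : (principal_log ((m%:R - y m)^-1) + (ln m%:R)%:C : C) @[m --> \oo] --> (0 : C).
  apply: (@log_inv_near _ (fun m => m%:R - y m) A); apply: filterS hy => m [_ h _].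
  by rewrite addrAC subrr add0r cmodN.
have hyL : (y m - (L m - m%:R) : C) @[m --> \oo] --> (0 : C).
  have h : B / Num.sqrt k%:R @[k --> \oo] --> (B * 0 : R).
    exact: cvgM (cvg_cst _) cvg_inv_sqrtn.
  rewrite mulr0 in h; apply: (cvgC_squeeze _ h).
  by apply: filterS hy => m [_ _]; rewrite subr0.
rewrite (_ : zeta = 0 + (1 - a) * 0 + 0 + zeta); last by rewrite mulr0 !add0r.
apply: cvg_trans (cvgD (cvgD (cvgD asym (cvgM (cvg_cst (1 - a)) hlog)) hyL) hL).
apply: near_eq_cvg; apply: nearW => m.
have PE : (P m)^-1 = m%:R - y m by exact: invrK.
rewrite !fctE PE /= -/(P m); ring.
Qed.

(* In particular [zeta - m] belongs to the image of the repelling petal. *)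
Let exit_phio : \forall m \near \oo, phio (P m) = zeta - m%:R.
Proof.
have [N1 _ hN1] := exit_petal; have [N2 _ hN2] := exit_step.
have [_ _ hphi _] := hphio.
exists (maxn N1 N2) => // m; rewrite /= geq_max => /andP[m1 m2].
(* By the functional equation phio(P_m) + m does not depend on m, so an asymptotic equality becomes
   an exact one. *)
have step i : phio (P (m + i)%N) + (m + i)%:R = phio (P m) + m%:R.
  elim: i => [|i IH]; first by rewrite addn0.
  rewrite -IH addnS -(hN2 (m + i)%N) /=; last exact: leq_trans (leq_addr _ _).
  rewrite hphi; first by rewrite -natr1; ring.
    by apply: hN1 => /=; rewrite (leq_trans m1)// leqW// leq_addr.
  rewrite hN2 /=; last exact: leq_trans (leq_addr _ _).
  by apply: hN1 => /=; rewrite (leq_trans m1)// leq_addr.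
have h1 : (phio (P n) + n%:R : C) @[n --> \oo] --> (phio (P m) + m%:R : C).
  apply: cvg_near_cst; exists m => // n /= mn.
  by rewrite -(subnKC mn) step.
have -> : zeta = phio (P m) + m%:R by exact: (cvg_unique _ exit_limit h1).
by rewrite addrK.
Qed.

Let exit_inverse : \forall m \near \oo, repelling_inverse r phio (zeta - m%:R) = P m.
Proof.
have [_ inj _ _] := hphio.
apply: filterS2 exit_phio exit_petal => m <- hp.
by rewrite /repelling_inverse pinvKV// inE.
Qed.

(** The relation q(P_(n+1)) = P_n makes the sequence under [eventual_value] constant from m on. *)
Let exit_lavaurs : \forall m \near \oo,
  repelling_inverse_extension q r phio zeta = iter m q (P m).
Proof.
have [N1 _ hN1] := exit_inverse; have [N2 _ hN2] := exit_step.
exists (maxn N1 N2) => // m; rewrite /= geq_max => /andP[m1 m2].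
apply: eventual_valueE; exists m => // n /= mn.
rewrite hN1 /=; last exact: leq_trans mn.
rewrite -(subnKC mn); elim: (n - m)%N => [|i IH]; first by rewrite addn0.
by rewrite addnS iterSr hN2//= (leq_trans m2)// leq_addr.
Qed.

Hypothesis transit : \forall K \near \oo, \forall n \near \oo,
  forall k, (K <= k <= n - K)%N -> U (x n k).
Hypothesis start : forall k, \forall n \near \oo, U (x n k).

(** One [m] is fixed beyond all thresholds. The first m points stay in [U] by [start] and the middle
    ones by [transit]; the last m tend to iterates of P_m, which lie in the open set [U] by [hext],
    as P_m is the value of [repelling_inverse]. *)
Lemma implosion_ultra :
  F [set n | forall k, (k < n)%N -> U (x n k)] /\
  x n n @[n --> F] --> repelling_inverse_extension q r phio zeta.
Proof.
have [N1 _ h1] := transit; have [N2 _ h2] := exit_lavaurs.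
have [N3 _ h3] := exit_inverse; have [N4 _ h4] := hext zeta.
have [N5 _ h5] := hy.
pose m := maxn (maxn (maxn N1 N2) (maxn N3 N4)) N5.
have m1 : (N1 <= m)%N by rewrite /m; lia.
have m2 : (N2 <= m)%N by rewrite /m; lia.
have m3 : (N3 <= m)%N by rewrite /m; lia.
have m4 : (N4 <= m)%N by rewrite /m; lia.
have m5 : (N5 <= m)%N by rewrite /m; lia.
have UP k : (k < m)%N -> U (iter k q (P m)).
  by move=> km; have := h4 m m4 k km; rewrite h3.
have [hx _ _] := h5 m m5.
have tail j : (j <= m)%N -> x n (n - m + j)%N @[n --> F] --> iter j q (P m).
  elim: j => [_|j IH jm].
    by under eq_fun do rewrite addn0; exact: hx.
  under eq_fun do rewrite addnS.
  exact: (step_cvg (UP j jm) (IH (ltnW jm))).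
split; last first.
  rewrite (h2 m m2); apply: cvg_trans (tail m (leqnn m)); apply: near_eq_cvg.
  by apply: ooF; exists m => // n /= mn; rewrite subnK.
have U1 : \forall n \near F, forall j, (j < m)%N -> U (x n j).
  by apply: near_all_lt => j _; apply: ooF; exact: start.
have U2 : \forall n \near F, forall j, (j < m)%N -> U (x n (n - m + j)%N).
  apply: near_all_lt => j jm; apply: (tail j (ltnW jm)).
  exact: open_nbhs_nbhs (conj hU (UP j jm)).
have U3 := ooF (h1 m m1).
have U4 : F [set n | (m <= n)%N] by apply: ooF; exact: nbhs_infty_ge.
apply: filterS (filterI (filterI U1 U2) (filterI U3 U4)) => n [[u1 u2] [u3 mn]] k kn.
have [km|mk] := ltnP k m; first exact: u1.
have [knm|nmk] := leqP k (n - m); first by apply: u3; rewrite mk.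
have -> : k = (n - m + (k - (n - m)))%N by rewrite subnKC// ltnW.
by apply: u2; move: mn => /= mn; clear -kn nmk mn; lia.
Qed.

End ultrafilter.
(** The deterministic core: any bounded sequence whose weighted averages converge may drive the
    perturbation. *)
Theorem nonautonomous_implosion (U : set C) (q : C -> C) (a : C)
  (r : R) (phii phio : C -> C) (s : nat -> C) (u : C) (M : R)
  (E : nat -> nat -> C) (b : nat -> R) (w : C) (x : nat -> nat -> C) :
  open U -> U 0 -> holomorphic_on U q ->
  (exists K : R, \forall w \near (0 : C),
     `|q w - (w + w ^+ 2 + a * w ^+ 3)| <= K%:C * `|w| ^+ 4) ->
  admissible_radius U q r ->
  attracting_fatou_coordinate q a r phii ->
  repelling_fatou_coordinate q a r phio ->
  repelling_extension_defined U q r phio ->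
  (forall k, cmod (s k) <= M) ->
  (\sum_(k < n) (2 * sin (step_size n * k%:R) ^+ 2 / n%:R)%:C * s k : C)
     @[n --> \oo] --> u ->
  b n @[n --> \oo] --> 0 ->
  (\forall n \near \oo, forall k,
    cmod (E n k - ((step_size n)%:C ^+ 2 + (2 * step_size n ^+ 2 / n%:R)%:C * s k))
      <= b n * step_size n ^+ 2 / n%:R) ->
  parabolic_basin U q r w ->
  (forall n, x n 0%N = w) -> (forall n k, x n k.+1 = q (x n k) + E n k) ->
  (\forall n \near \oo, forall k, (k < n)%N -> U (x n k)) /\
  x n n @[n --> \oo] --> lavaurs_map q r phii phio u w.
Proof.
move=> hU hU0 hq hqa hr hphii hphio hext hs havg hb hE hw x0 xS.
have [K1 K10 [rho rho0 hrho]] := germ_bound hU hU0 hqa.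
have M0 : 0 <= M by exact: le_trans (cmod_ge0 _) (hs 0%N).
have [m0 [hUw hpet _ _]] := attracting_orbit hr hphii hw.
have [[A0 A00 hA0] hexp] := attracting_expansion hr hphii hw.
have [r0 _ petalU _ _] := hr.
have p_neq0 : \forall k \near \oo, iter k q w != 0.
  by exists m0 => // k mk; apply: (petal_neq0 r0); exact: hpet.
have [A1 [B1 tr]] := transit_orbit hq K10 rho0 hrho M0 hs hb hE hUw x0 xS A00 hA0 p_neq0.
have hstart k : \forall n \near \oo, U (x n k).
  apply: (orbit_start hq M0 hs hb hE hUw x0 xS (k := k)).
  exact: open_nbhs_nbhs (conj hU (hUw k)).
have hE0 (k : nat -> nat) : E n (k n) @[n --> \oo] --> (0 : C).
  exact: (cvg_perturbation0 M0 hs hb hE).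
(* [L m - m] is the coordinate predicted at time n - m: the value - 1 / p_m - m at the entrance,
   increased by the phase. *)
pose L k : C := - (iter k q w)^-1 + u.
have hL : (L k - k%:R - (1 - a) * (ln k%:R)%:C : C) @[k --> \oo] -->
    attracting_extension q phii w + u.
  apply: cvg_trans (cvgD hexp (cvg_cst u)); apply: near_eq_cvg; apply: nearW => k.
  by rewrite fctE /L; ring.
have main (F : set_system nat) : UltraFilter F -> \oo `<=` F ->
    F [set n | forall k, (k < n)%N -> U (x n k)] /\
    x n n @[n --> F] --> lavaurs_map q r phii phio u w.
  move=> FU ooF; have FF : ProperFilter F by exact: ultra_proper.
  have [A [B hexit]] := orbit_exit hq K10 rho0 hrho M0 hs havg hb hE hUw x0 xS
    A00 hA0 p_neq0 FU FF ooF.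
  have [y hy] := near_choice hexit.
  apply: (@implosion_ultra U q a hU hq r phio r0 petalU hphio hext E x L _
    hE0 xS hL F FF ooF A B y) => //.
    apply: filterS hy => m [h1 h2 h3]; split; [exact: h1|exact: h2|].
    by move: h3; congr (cmod _ <= _); rewrite /L; ring.
  by apply: filterS tr => K; apply: filterS => n h k hk; have [] := h k hk.
split; first by apply: near_ultra => F FU ooF; exact: (main F FU ooF).1.
by move=> V hV; apply: near_ultra => F FU ooF; exact: ((main F FU ooF).2 V hV).
Qed.

End implosion.

(** * Measurability and integrability of the parts of sigma *)

Section essentially_bounded.
Context {R : realType} {d : measure_display} {Omega : measurableType d}.
Variables (mu : probability Omega R) (sigma : Omega -> R[i]^o).
Hypothesis hsigma : complex_Linfty mu sigma.

Lemma measurable_lipschitz (f : borelC R -> R) :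
  (forall x y : R[i]^o, `|f x - f y| <= cmod (x - y)) -> measurable_fun setT f.
Proof.
move=> lip mD; apply: (measurability _ (RGenOInfty.measurableE R)) => //.
move=> _ [_ [t ->] <-]; rewrite setTI; apply: sub_sigma_algebra.
rewrite /= openE => w /=; rewrite in_itv /= andbT => tw.
apply/nbhs_cmodP; exists (f w - t); first by rewrite subr_gt0.
move=> z hz; rewrite /= in_itv /= andbT.
have := le_lt_trans (lip w z) (_ : _ < f w - t); rewrite cmod_distC => /(_ hz).
by move=> /ltr_normlP[_]; lra.
Qed.

Lemma essentially_bounded : exists2 M : R, 0 <= M &
  {ae mu, forall z, cmod (sigma z) <= M}.
Proof.
have [_] := hsigma; rewrite /finite_norm unlock.
have -> : (mu [set: Omega] > 0)%E by rewrite probability_setT lte01.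
move=> /(ess_supr_bounded (f := fun z => `|cmod (sigma z)|))[M hM].
exists (Num.max M 0); first by rewrite le_max lexx orbT.
apply: filterS hM => z /=; rewrite ger0_norm ?cmod_ge0// => hz.
by rewrite le_max hz.
Qed.

(** Meant for the real and imaginary parts: |f(sigma)| <= |sigma| is essentially bounded, and the
    measure is finite. *)
Lemma integrable_lipschitz (f : R[i]^o -> R) :
  (forall x y : R[i]^o, `|f x - f y| <= cmod (x - y)) -> f 0 = 0 ->
  mu.-integrable setT (EFin \o (f \o sigma)).
Proof.
move=> lip f0; have [M M0 hM] := essentially_bounded.
have mf : measurable_fun setT (f \o sigma).
  exact: measurableT_comp (measurable_lipschitz lip) hsigma.1.
apply/integrableP; split; first exact/measurable_EFinP.
apply: (le_lt_trans (integral_le_bound M%:E measurableT _ _ _)).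
- exact/measurable_EFinP.
- by rewrite lee_fin.
- apply: filterS hM => z hz _; rewrite /= lee_fin (le_trans _ hz)//.
  by have := lip (sigma z) 0; rewrite f0 !subr0.
- rewrite (_ : (_ * _)%E = M%:E) ?ltry// -[RHS]mule1.
  by congr (_ * _)%E; exact: probability_setT.
Qed.

End essentially_bounded.

(** * Reduction of the random skew-product to the deterministic theorem *)

Section main.
Context {R : realType}.

Lemma cvg_powRN (al : R) : 0 < al -> (n%:R `^ al)^-1 @[n --> \oo] --> (0 : R).
Proof.
move=> al0; apply/cvgrPdist_lt => e e0; near=> n.
have n0 : 0 < n%:R :> R by rewrite ltr0n; near: n; exact: nbhs_infty_gt.
have h : e^-1 `^ al^-1 < n%:R by near: n; exact: nbhs_infty_gtr.
have p0 : 0 < n%:R `^ al by exact: powR_gt0.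
rewrite sub0r normrN ger0_norm ?invr_ge0 ?(ltW p0)// invf_plt ?posrE//.
have := gt0_ltr_powR al0 _ _ h; rewrite !nnegrE powR_ge0 ltW// => /(_ isT isT).
by rewrite -powRrM mulVf ?gt_eqF// powRr1// invr_ge0 ltW.
Unshelve. all: by end_near. Qed.

(** For e = pi / n the term (e / n) s is pi s / n^2, and the cross term of the square is the origin
    of the 2 in the weights. The remainder is e^2 / n times a factor that vanishes as n grows and
    eta tends to 0. *)
Lemma sqr_perturbed_step (e eta n M : R) (s c : R[i]) : 0 < e -> 0 <= eta -> 1 <= n ->
  0 <= M -> cmod s <= M ->
  cmod (c - (e%:C + (e / n)%:C * s)) <= eta * e / n ->
  cmod (c ^+ 2 - (e%:C ^+ 2 + (2 * e ^+ 2 / n)%:C * s)) <=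
    (M ^+ 2 / n + 2 * eta + 2 * M * eta + eta ^+ 2) * e ^+ 2 / n.
Proof.
move=> e0 eta0 n1 M0 hs; set dl := c - _ => hdl.
have n0 : 0 < n by exact: lt_le_trans n1.
have ninv : n^-1 <= 1 by rewrite invf_le1.
have ninv0 : 0 < n^-1 by rewrite invr_gt0.
have -> : c ^+ 2 - (e%:C ^+ 2 + (2 * e ^+ 2 / n)%:C * s) =
   (e / n)%:C ^+ 2 * s ^+ 2 + 2%:R * (e%:C * dl) + 2%:R * ((e / n)%:C * s * dl) + dl ^+ 2.
  have -> : c = e%:C + (e / n)%:C * s + dl by rewrite /dl addrC subrK.
  have -> : (2 * e ^+ 2 / n)%:C = 2%:R * (e%:C * (e / n)%:C).
    by rewrite -(rmorph_nat (real_complex R)) -!rmorphM; congr (_%:C); ring.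
  ring.
have c2 : cmod (2%:R : R[i]) <= 2.
  by rewrite -(rmorph_nat (real_complex R)) cmod_real ger0_norm.
have ce : cmod e%:C <= e by rewrite cmod_real gtr0_norm.
have en : 0 < e / n by rewrite divr_gt0.
have cen : cmod (e / n)%:C <= e / n by rewrite cmod_real gtr0_norm.
apply: (le_trans (cmodD_le (cmodD_le (cmodD_le (cmodM_le (cmodX_le 2 cen) (cmodX_le 2 hs))
  (cmodM_le c2 (cmodM_le ce hdl))) (cmodM_le c2 (cmodM_le (cmodM_le cen hs) hdl)))
  (cmodX_le 2 hdl))).
have z0 : 0 <= e ^+ 2 * n^-1 by rewrite mulr_ge0 ?sqr_ge0// ltW.
have k1 : n^-1 * (2 * M * eta) <= 2 * M * eta by rewrite ler_piMl// !mulr_ge0.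
have k2 : n^-1 * eta ^+ 2 <= eta ^+ 2 by rewrite ler_piMl// sqr_ge0.
have := ler_wpM2l z0 (lerD k1 k2).
have -> : (e / n) ^+ 2 * M ^+ 2 + 2 * (e * (eta * e / n)) +
    2 * (e / n * M * (eta * e / n)) + (eta * e / n) ^+ 2 =
  e ^+ 2 * n^-1 * (M ^+ 2 * n^-1 + 2 * eta) +
  e ^+ 2 * n^-1 * (n^-1 * (2 * M * eta) + n^-1 * eta ^+ 2) by ring.
have -> : (M ^+ 2 / n + 2 * eta + 2 * M * eta + eta ^+ 2) * e ^+ 2 / n =
  e ^+ 2 * n^-1 * (M ^+ 2 * n^-1 + 2 * eta) + e ^+ 2 * n^-1 * (2 * M * eta + eta ^+ 2).
  by ring.
by move=> h; rewrite lerD2l.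
Qed.

Lemma ae_iter {d : measure_display} {Omega : measurableType d}
  (mu : probability Omega R) (T : Omega -> Omega) (P : Omega -> Prop) k :
  measure_preserving mu T -> {ae mu, forall z, P z} ->
  {ae mu, forall z, P (iter k T z)}.
Proof.
move=> hT [N [mN N0 hN]].
have : forall A, measurable A -> mu (iter k T @^-1` A) = mu A.
  elim: k => [|k IH] A mA; first by [].
  rewrite -[RHS]hT.2// -[RHS]IH//.
  by rewrite -[X in measurable X]setTI; exact: hT.1.
move=> /(_ _ mN) pN; exists (iter k T @^-1` N); split.
- by rewrite -[X in measurable X]setTI; exact: (measurable_iter hT k).
- by rewrite -N0.
- by move=> z hz; apply: hN.
Qed.

End main.

Theorem corollary1p5 (R : realType)
  (d : measure_display) (Omega : measurableType d) (mu : probability Omega R)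
  (T : Omega -> Omega) (hT : ergodic mu T)
  (sigma : Omega -> R[i]^o) (hsigma : complex_Linfty mu sigma)
  (U : set R[i]^o) (q : R[i]^o -> R[i]^o) (a : R[i]^o)
  (hU : open U) (hU0 : U 0) (hq : holomorphic_on U q)
  (hqa : exists K : R, \forall w \near (0 : R[i]^o),
     `|q w - (w + w ^+ 2 + a * w ^+ 3)| <= K%:C * `|w| ^+ 4)
  (r : R) (hr : admissible_radius U q r)
  (phii phio : R[i]^o -> R[i]^o)
  (hphii : attracting_fatou_coordinate q a r phii)
  (hphio : repelling_fatou_coordinate q a r phio)
  (hext : repelling_extension_defined U q r phio)
  (eps : nat -> Omega -> R[i]^o) (alpha : R) (halpha : 0 < alpha < 1)
  (heps : exists K : R, \forall n \near \oo, forall z : Omega,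
     `|eps n z - ((pi / n%:R)%:C + (pi / n%:R ^+ 2)%:C * sigma z)|
       <= (K / n%:R `^ (2 + alpha))%:C)
  (hmeas : forall n, (0 < n)%N ->
     measurable_fun ([set: Omega] `*` (U : set (borelC R)))
       (skew_product T q (eps n) :
          Omega * borelC R -> Omega * borelC R)) :
  {ae mu, forall z : Omega, forall w : R[i]^o, parabolic_basin U q r w ->
    (\forall n \near \oo, forall k, (k < n)%N ->
       U (iter k (skew_product T q (eps n)) (z, w)).2) /\
    (iter n (skew_product T q (eps n)) (z, w)).2 @[n --> \oo]
      --> lavaurs_map q r phii phio (complex_integral mu sigma) w}.
Proof.
have [M M0 hM] := essentially_bounded hsigma.
have hMk : {ae mu, forall z, forall k, cmod (sigma (iter k T z)) <= M}.
  by apply: ae_foralln => k; exact: ae_iter hT.1 hM.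
have lipRe (x y : R[i]^o) : `|complex.Re x - complex.Re y| <= cmod (x - y).
  by have := Re_le_cmod (x - y); case: x y => ? ? [].
have lipIm (x y : R[i]^o) : `|complex.Im x - complex.Im y| <= cmod (x - y).
  by have := Im_le_cmod (x - y); case: x y => ? ? [].
have bRe := birkhoff hT.1 hT (integrable_lipschitz hsigma lipRe erefl).
have bIm := birkhoff hT.1 hT (integrable_lipschitz hsigma lipIm erefl).
have [al0 _] := andP halpha; have [K hK] := heps.
(* K / n^(2 + alpha) is at most eta e / n with e = pi / n, since pi >= 1; [b] is then the factor
   given by [sqr_perturbed_step]. *)
pose eta n : R := `|K| * (n%:R `^ alpha)^-1.
pose b n : R := M ^+ 2 / n%:R + 2 * eta n + 2 * M * eta n + eta n ^+ 2.
have heta : eta n @[n --> \oo] --> (0 : R).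
  have h : eta n @[n --> \oo] --> (`|K| * 0 : R).
    exact: cvgM (cvg_cst _) (cvg_powRN al0).
  by rewrite mulr0 in h.
have hb : b n @[n --> \oo] --> (0 : R).
  have h : b n @[n --> \oo] --> (M ^+ 2 * 0 + 2 * 0 + 2 * M * 0 + 0 * 0 : R).
    exact: cvgD (cvgD (cvgD (cvgM (cvg_cst _) cvg_invn) (cvgM (cvg_cst _) heta))
      (cvgM (cvg_cst _) heta)) (cvgM heta heta).
  by rewrite !mulr0 !addr0 in h.
(* The good z are selected by conditions on their [T]-orbit alone, so one null set serves every
   [w]. *)
apply: filterS2 (filterI bRe bIm) hMk => z [hRe hIm] hMz w hw.
pose s k := sigma (iter k T z).
pose x n k := (iter k (skew_product T q (eps n)) (z, w)).2.
have fstE n k : (iter k (skew_product T q (eps n)) (z, w)).1 = iter k T z.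
  by elim: k => //= k ->.
apply: (@nonautonomous_implosion R U q a r phii phio s (complex_integral mu sigma) M
  (fun n k => eps n (iter k T z) ^+ 2) b w x hU hU0 hq hqa hr hphii hphio hext hMz
  _ hb _ hw).
- exact: weighted_average_complex hRe hIm.
- near=> n => k.
  have n0 : (0 < n)%N by near: n; exact: nbhs_infty_gt.
  have n0' : 0 < n%:R :> R by rewrite ltr0n.
  have hKn : forall z, `|eps n z - ((pi / n%:R)%:C + (pi / n%:R ^+ 2)%:C * sigma z)|
       <= (K / n%:R `^ (2 + alpha))%:C by near: n; exact: hK.
  apply: sqr_perturbed_step => //; first exact: step_size_gt0.
  + by rewrite mulr_ge0// invr_ge0 powR_ge0.
  + by rewrite ler1n.
  + exact: hMz.
  have := hKn (iter k T z); rewrite cmod_le step_sizeE.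
  have -> : pi / n%:R / n%:R = pi / n%:R ^+ 2 :> R by rewrite -mulrA -invfM -expr2.
  move=> /le_trans; apply.
  have p0 : 0 < n%:R `^ alpha by exact: powR_gt0.
  rewrite powRD; last by rewrite (gt_eqF n0') implybT.
  rewrite powR_mulrn ?(ltW n0')// /eta.
  have -> : `|K| / n%:R `^ alpha * (pi / n%:R) / n%:R =
      pi * (`|K| / (n%:R ^+ 2 * n%:R `^ alpha)) :> R.
    move: (n%:R `^ alpha) (n%:R) p0 n0' => t u t0 u0.
    by field; rewrite !gt_eqF.
  apply: (@le_trans _ _ (`|K| / (n%:R ^+ 2 * n%:R `^ alpha))).
    by rewrite ler_pM2r ?ler_norm// invr_gt0 mulr_gt0// exprn_gt0.
  apply: ler_peMl; last by rewrite (le_trans _ (pi_ge2 R))// ler1n.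
  by apply: divr_ge0 => //; rewrite mulr_ge0 ?exprn_ge0 ?(ltW p0) ?(ltW n0').
- by [].
- by move=> n k; rewrite /x iterS /= fstE.
Unshelve. all: by end_near. Qed.
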